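(* There is an absolute constant $C_0>0$ such that the following holds. Assume: (a) $d\le n$ and $\eta_1 := C_0\sigma_x^2\sqrt{d/n}<\tfrac12$; (b) (small or moderate tail effective rank) $r_d(\Sigma)/n\le C_1$ for a constant $C_1>0$; (c) (rotational sparsity) for some $0<\delta_1<1$, $\dfrac{\Vert\theta^*_{(d+1):p}\Vert^2_{\Sigma_{(d+1):p}}}{\Vert\theta^*_{1:d}\Vert^2_{\Sigma_{1:d}^{-1}}}\le \dfrac{\delta_1}{4(1+\sigma_x^2)}\lambda_{d+1}^2$. Let $$\kappa_1(\tau)=\max\Big\{1-\Big(\tfrac{2C_0\sigma_x^2(2+C_1)\lambda_{d+1}}{\tau}\big(1+16(2C_0\sigma_x^2+1)(1+C_1)\tfrac{\sqrt{\delta_1}}{1-\sqrt{\delta_1}}\big)+64\tfrac{\sqrt{\delta_1}}{1-\sqrt{\delta_1}}\Big),\,0\Big\}.$$ Then for any $\nu$ with $0<\nu<\frac14\min\{1,\sigma_x^2\}$ and any $A_0$ with $A_0\ge 1$ and $(1+A_0)^2<4\delta_1^{-1}$, there are constants $M_1,M_2>0$ depending only on $(\sigma_x,\eta_1,C_1,\delta_1,\nu,A_0)$ such that, with probability at least $$1-2\exp\{-\tfrac{\nu^2 n}{C_0^2\sigma_x^4}\}-2\exp\{-\tfrac{\nu^2 n}{C_0\sigma_x^4}\}-8\exp\{-\tfrac{n}{C_0}\},$$ the following inequalities hold uniformly over all $\tau\ge0$ in the stated ranges: (i) for $\tau\le A_0^{-1}\lambda_{d+1}$: $\ \mathrm{MSE}_{\mathrm{in}}\ge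 M_1\,\sigma^2\left(\frac dn+\frac{r_d^2(\Sigma)}{n^2}\right)$; (ii) for $A_0^{-1}\lambda_{d+1}\le\tau\le A_0\lambda_d$: $$M_2\left(\Vert\theta^*_{1:d}\Vert^2_{\Sigma_{1:d}^{-1}}\tau^2+\sigma^2\Big(\frac dn+\frac{\lambda_{d+1}^2}{\tau^2}\frac{r_d(\Sigma)}{n}\Big)\right)\ge \mathrm{MSE}_{\mathrm{in}}\ge M_1\left(\kappa_1(\tau)\Vert\theta^*_{1:d}\Vert^2_{\Sigma_{1:d}^{-1}}\tau^2+\sigma^2\Big(\frac dn+\frac{\lambda_{d+1}^2}{\tau^2}\frac{r_d^2(\Sigma)}{n^2}\Big)\right);$$ (iii) for $\tau\ge A_0\lambda_d$: $\ \mathrm{MSE}_{\mathrm{in}}\ge M_1\left(\kappa_1(\tau)\Vert\theta^*_{1:d}\Vert^2_{\Sigma_{1:d}^{-1}}\lambda_d^2+\sigma^2\frac{\lambda_{d+1}^2}{\tau^2}\frac{r_d^2(\Sigma)}{n^2}\right)$.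
   Context: Let $n\ge 1$ and $1\le d<p$ be integers. The data $(y_1,x_1),\dots,(y_n,x_n)$ are i.i.d. from the model $y_i=x_i^\top\theta^*+\epsilon_i$, where $\theta^*\in\mathbb R^p$, $x_i\in\mathbb R^p$ is random with $E(x_i)=0$, $\mathrm{Var}(x_i)=\Sigma$ non-singular, and $\epsilon_i\in\mathbb R$ is independent of $x_i$ with $E(\epsilon_i)=0$, $\mathrm{Var}(\epsilon_i)=\sigma^2$. Throughout, $\Sigma=\mathrm{Diag}(\lambda_1,\dots,\lambda_p)$ with $\lambda_1\ge\dots\ge\lambda_p>0$. The vector $\Sigma^{-1/2}x_i$ is sub-gaussian with sub-gaussian norm $\sigma_x$; here a real random variable $z$ has norm $\Vert z\Vert_{\psi_2}=\inf\{t>0: E\exp(z^2/t^2)\le 2\}$ and a random vector $Z$ has norm $\sup_{s\ne 0}\Vert\langle s,Z\rangle/\Vert s\Vert\,\Vert_{\psi_2}$. $Y=(y_1,\dots,y_n)^\top$, $X=(x_1,\dots,x_n)^\top\in\mathbb R^{n\times p}$, $\hat\Sigma=X^\top X/n$. For $\tau>0$ the ridge estimator is $\hat\theta(\tau)=\arg\min_\theta\{\frac1n\Vert Y-X\theta\Vert^2+\tau\Vert\theta\Vert^2\}=X^\top(XX^\top+n\tau I_n)^{-1}Y$, and $\hat\theta(0)=\lim_{\tau\to0+}\hat\theta(\tau)$. For positive semi-definite $M$, $\Vert b\Vert_M=(b^\top Mb)^{1/2}$. The in-sample error is $\mathrm{MSE}_{\mathrm{in}}=E[\frac1n\Vert X(\hat\theta(\tau)-\theta^*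 )\Vert^2\mid X]=E[\Vert\hat\theta(\tau)-\theta^*\Vert_{\hat\Sigma}^2\mid X]$, a function of $X$ and $\tau$. $\theta^*_{1:d}$ and $\theta^*_{(d+1):p}$ are the first $d$ and last $p-d$ entries of $\theta^*$; $\Sigma_{1:d}=\mathrm{Diag}(\lambda_1,\dots,\lambda_d)$, $\Sigma_{(d+1):p}=\mathrm{Diag}(\lambda_{d+1},\dots,\lambda_p)$. Tail effective rank: $r_d(\Sigma)=\frac{\sum_{j>d}\lambda_j}{\lambda_{d+1}}$; $r_d^2(\Sigma)=(r_d(\Sigma))^2$. (At $\tau=0$ part (i) is the only part that can apply, so $\kappa_1(\tau)$ is only needed for $\tau>0$.) *)

(* Defs.v *)
From HB Require Import structures.
From mathcomp Require Import all_boot all_order all_algebra.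
From mathcomp Require Import all_classical all_reals all_analysis.

Set Implicit Arguments.
Unset Strict Implicit.
Unset Printing Implicit Defensive.

Import Order.TTheory GRing.Theory Num.Theory.
Import numFieldNormedType.Exports.

Local Open Scope classical_set_scope.
Local Open Scope ring_scope.

Section Vectors.
Context {R : realType}.

(* Entries are numbered from 1, as in (v_1, ..., v_p); the value is 0 when the
   index is not in 1..p. *)
Definition entry p (v : 'cV[R]_p) (j : nat) : R :=
  \sum_(i < p | i.+1 == j) v i ord0.

(* v_{1:d} and v_{(d+1):p} *)
Definition head_part p (d : nat) (v : 'cV[R]_p) : 'cV[R]_d :=
  \col_(k < d) entry v k.+1.
Definition tail_part p (d : nat) (v : 'cV[R]_p) : 'cV[R]_(p - d) :=
  \col_(k < p - d) entry v (d + k).+1.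

Definition Diag p (v : 'cV[R]_p) : 'M[R]_p := diag_mx v^T.

(* The Euclidean norm; the library's `|v| is the sup norm on matrices. *)
Definition enorm p (v : 'cV[R]_p) : R := Num.sqrt (\sum_i v i ord0 ^+ 2).

Definition qnorm p (M : 'M[R]_p) (b : 'cV[R]_p) : R :=
  Num.sqrt ((b^T *m M *m b) ord0 ord0).

(* r_d(Diag(lam)) *)
Definition eff_rank p (lam : 'cV[R]_p) (d : nat) : R :=
  (\sum_(d.+1 <= j < p.+1) entry lam j) / entry lam d.+1.

End Vectors.

Section Ridge.
Context {R : realType} {n p : nat}.

(* For tau > 0 this is the unique minimiser of
   theta |-> n^-1 * |Y - X theta|^2 + tau * |theta|^2. *)
Definition ridge_pos (X : 'M[R]_(n, p)) (Y : 'cV[R]_n) (tau : R) : 'cV[R]_p :=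
  X^T *m invmx (X *m X^T + (n%:R * tau)%:M) *m Y.

(* Only used for 0 <= tau. *)
Definition ridge (X : 'M[R]_(n, p)) (Y : 'cV[R]_n) (tau : R) : 'cV[R]_p :=
  if 0 < tau then ridge_pos X Y tau
  else lim (ridge_pos X Y t @[t --> 0^'+]).

End Ridge.

Section RandomVectors.
Local Open Scope ereal_scope.
Context {disp : measure_display} {T : measurableType disp} {R : realType}.
Variable P : probability T R.

(* The Borel (= product) sigma-algebra of the space of m x n matrices. *)
Definition borel_mx (m n : nat) : set (set 'M[R]_(m, n)) :=
  <<s [set A | exists (i : 'I_m) (j : 'I_n) (B : set R),
         measurable B /\ A = [set M : 'M[R]_(m, n) | B (M i j)]] >>.

Definition sigma_gen m n (Z : T -> 'M[R]_(m, n)) : set (set T) :=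
  preimage_set_system setT Z (@borel_mx m n).

Definition random_mx m n (Z : T -> 'M[R]_(m, n)) : Prop :=
  sigma_gen Z `<=` measurable.

(* The sets A i may be taken to be the whole space, so the product rule for
   subfamilies is included. *)
Definition mutually_independent n m (Z : 'I_n -> T -> 'cV[R]_m) : Prop :=
  forall A : 'I_n -> set 'cV[R]_m, (forall i, borel_mx (A i)) ->
    P (\bigcap_(i in [set: 'I_n]) (Z i @^-1` A i)) =
    \prod_(i < n) P (Z i @^-1` A i).

Definition identically_distributed n m (Z : 'I_n -> T -> 'cV[R]_m) : Prop :=
  forall (A : set 'cV[R]_m) (i k : 'I_n), borel_mx A ->
    P (Z i @^-1` A) = P (Z k @^-1` A).

Definition independent_rv_vec m (e : T -> R) (Z : T -> 'cV[R]_m) : Prop :=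
  forall (A : set R) (B : set 'cV[R]_m), measurable A -> borel_mx B ->
    P (e @^-1` A `&` Z @^-1` B) = P (e @^-1` A) * P (Z @^-1` B).

Definition psi2_norm (z : T -> R) : \bar R :=
  ereal_inf [set t%:E | t in
    [set t : R | (0 < t)%R /\
       'E_P[(fun w => expR (z w ^+ 2 / t ^+ 2))%R] <= 2%:E]].

Definition psi2_norm_vec m (Z : T -> 'cV[R]_m) : \bar R :=
  ereal_sup [set psi2_norm (fun w => (s^T *m Z w) ord0 ord0 / enorm s)%R | s in
    [set s : 'cV[R]_m | s != 0%R]].

(* W is a version of the conditional expectation of Z given the
   sub-sigma-algebra G. *)
Definition is_condE (G : set (set T)) (Z W : T -> R) : Prop :=
  [/\ forall B : set R, measurable B -> G (W @^-1` B),
      P.-integrable setT (EFin \o W) &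
      forall A, G A -> \int[P]_(w in A) (W w)%:E = \int[P]_(w in A) (Z w)%:E].

End RandomVectors.

Section Model.
Context {disp : measure_display} {T : measurableType disp} {R : realType}.
Variable P : probability T R.
Context {n p : nat}.

Definition design (x : 'I_n -> T -> 'cV[R]_p) (w : T) : 'M[R]_(n, p) :=
  \matrix_(i < n, j < p) x i w j ord0.

Definition response (y : 'I_n -> T -> R) (w : T) : 'cV[R]_n :=
  \col_(i < n) y i w.

(* The pair (y_i, x_i), stacked into one random vector. *)
Definition datum (x : 'I_n -> T -> 'cV[R]_p) (y : 'I_n -> T -> R)
    (i : 'I_n) (w : T) : 'cV[R]_(1 + p) :=
  col_mx (y i w)%:M (x i w).

(* Second moments need no separate finiteness clause: both infinities are
   excluded by the real values prescribed for the (co)variances. *)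
Record regression_model (theta lam : 'cV[R]_p) (sigma sigma_x : R)
    (x : 'I_n -> T -> 'cV[R]_p) (eps y : 'I_n -> T -> R) : Prop := {
  model_x_measurable : forall i, random_mx (x i) ;
  model_eps_measurable : forall i, measurable_fun setT (eps i) ;
  model_eq : forall i w,
    y i w = ((x i w)^T *m theta) ord0 ord0 + eps i w ;
  model_indep : mutually_independent P (datum x y) ;
  model_id : identically_distributed P (datum x y) ;
  model_x_mean : forall i j, ('E_P[(fun w => x i w j ord0)] = 0)%E ;
  model_x_var : forall i j k,
    covariance P (fun w => x i w j ord0) (fun w => x i w k ord0)
    = (Diag lam j k)%:E ;
  model_eps_x : forall i, independent_rv_vec P (eps i) (x i) ;
  model_eps_mean : forall i, ('E_P[eps i] = 0)%E ;
  model_eps_var : forall i, 'V_P[eps i] = (sigma ^+ 2)%:E ;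
  model_subgaussian : forall i,
    psi2_norm_vec P
      (fun w => Diag (map_mx (fun l => (Num.sqrt l)^-1) lam) *m x i w)
    = sigma_x%:E
}.

(* m (X, tau) is the in-sample error E[n^-1 * |X (ridge tau - theta)|^2 | X].
   A conditional expectation is only determined up to a null set for each
   tau; the continuity clause selects versions that are coherent in tau, so
   that any two choices of m agree almost surely for all tau >= 0 at once. *)
Record in_sample_mse (theta : 'cV[R]_p) (X : T -> 'M[R]_(n, p))
    (Y : T -> 'cV[R]_n) (m : 'M[R]_(n, p) -> R -> R) : Prop := {
  mse_condE : forall tau, 0 <= tau ->
    is_condE P (sigma_gen X)
      (fun w => enorm (X w *m (ridge (X w) (Y w) tau - theta)) ^+ 2 / n%:R)
      (fun w => m (X w) tau) ;
  mse_continuous :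
    {ae P, forall w, {within `[0, +oo[, continuous (m (X w))}}
}.

End Model.

Definition kappa1 {R : realType} (C0 sigma_x C1 delta1 lam_d1 tau : R) : R :=
  let q := Num.sqrt delta1 / (1 - Num.sqrt delta1) in
  Num.max
    (1 - (2 * C0 * sigma_x ^+ 2 * (2 + C1) * lam_d1 / tau
          * (1 + 16 * (2 * C0 * sigma_x ^+ 2 + 1) * (1 + C1) * q)
          + 64 * q))
    0.

(* Main.v *)
(* Whiten the first d coordinates: X theta = Z D v + X2 th2, where the columns
   of Z are the whitened head coordinates, D = Diag(lambda_1, ..., lambda_d),
   |v|^2 is the bias norm of the statement and X2 holds the tail coordinates.
   Outside an event of exponentially small probability, Z^T Z / n lies between
   9/10 and 11/10, |X2|_F^2 / n and |X2 th2|^2 / n are close to (resp. at most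
   about) their means, and |X2 X2^T| <= n K lambda_{d+1} for a constant K.  The
   first three facts follow from Bernstein's inequality, the first one with a
   net of the unit ball of R^d, whose cardinality is absorbed because
   eta_1 < 1/2 makes n large compared with d.

   Given X, the risk is bias + variance, with
     bias = n tau^2 |G X theta|^2,  variance = sigma^2 |X X^T G|_F^2 / n,
     G = (X X^T + n tau I)^-1,
   and on the good event both are estimated by linear algebra.  For a fixed tau
   this expression is a version of the conditional expectation; rational tau
   and the continuity of the chosen version give all tau >= 0 at once. *)
Require Import Defs.
From HB Require Import structures.
From mathcomp Require Import all_boot all_order all_algebra.
From mathcomp Require Import all_classical all_reals all_analysis.
From mathcomp Require Import measurable_realfun simple_functions measurable_fun_approximation.
From mathcomp Require Import ring lra.
Import Order.TTheory GRing.Theory Num.Theory.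
Import numFieldNormedType.Exports.
Import HBSimple HBNNSimple.
Set Implicit Arguments.
Unset Strict Implicit.
Unset Printing Implicit Defensive.
Local Open Scope classical_set_scope.
Local Open Scope ring_scope.

(** * Deterministic estimates of the ridge resolvent *)

(** The number p of coordinates is unrelated to n, so no union bound over the tail is available; one
    exponential moment averaged over blocks of n tail coordinates controls the norm of X2 instead.
    Resolvents are never diagonalised: upper bounds come from testing S u + t u = b, lower bounds on
    the hat matrix S (S + t)^-1 from trial vectors in a dual problem. The variance rates of (ii)
    differ because the lower bound passes through the trace, where Cauchy-Schwarz produces r_d^2 /
    n^2, while the upper bound keeps r_d / n. The factor [kappa1] acts only as a switch: when it is
    positive, tau exceeds a large multiple of lambda_{d+1} and delta1 is small, so that the tail
    signal cannot cancel the head bias. The constant C0 is the denominator of Bernstein's exponent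
    at tolerance 1/30, which the net argument turns into 1/10. The noise has two moments only, and
    its independence of the whole design has to be assembled from independence within each pair and
    between pairs; this occupies the part on conditional expectations. *)

Section Euclid.
Context {R : realFieldType}.

(** Working with squared norms avoids square roots, so the deterministic estimates hold over any
    ordered field. *)
Definition dot n (u v : 'cV[R]_n) : R := \sum_i u i 0 * v i 0.
Definition sqn n (u : 'cV[R]_n) : R := dot u u.
Definition fro m n (A : 'M[R]_(m, n)) : R := \sum_i \sum_j A i j ^+ 2.

Lemma dotC n (u v : 'cV[R]_n) : dot u v = dot v u.
Proof. by apply: eq_bigr => i _; rewrite mulrC. Qed.

Lemma dotDr n (u v w : 'cV[R]_n) : dot u (v + w) = dot u v + dot u w.
Proof. by rewrite -big_split; apply: eq_bigr => i _; rewrite mxE mulrDr. Qed.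

Lemma dotZr n a (u v : 'cV[R]_n) : dot u (a *: v) = a * dot u v.
Proof. by rewrite mulr_sumr; apply: eq_bigr => i _; rewrite mxE; ring. Qed.

Lemma dotDl n (u v w : 'cV[R]_n) : dot (u + v) w = dot u w + dot v w.
Proof. by rewrite dotC dotDr !(dotC w). Qed.

Lemma dotZl n a (u v : 'cV[R]_n) : dot (a *: u) v = a * dot u v.
Proof. by rewrite dotC dotZr dotC. Qed.

Lemma dotNr n (u v : 'cV[R]_n) : dot u (- v) = - dot u v.
Proof. by rewrite -scaleN1r dotZr mulN1r. Qed.

Lemma dotNl n (u v : 'cV[R]_n) : dot (- u) v = - dot u v.
Proof. by rewrite dotC dotNr dotC. Qed.

Definition dotE := (dotDl, dotDr, dotNl, dotNr, dotZl, dotZr).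

Lemma dot_mulmx m n (A : 'M[R]_(m, n)) u v : dot u (A *m v) = dot (A^T *m u) v.
Proof.
rewrite /dot; under eq_bigr do rewrite mxE mulr_sumr.
rewrite exchange_big; apply: eq_bigr => j _ /=.
by rewrite mxE mulr_suml; apply: eq_bigr => i _; rewrite mxE; ring.
Qed.

Lemma dot_trmx m n (A : 'M[R]_(m, n)) u v : dot u (A^T *m v) = dot (A *m u) v.
Proof. by rewrite dot_mulmx trmxK. Qed.

Lemma sqn_ge0 n (u : 'cV[R]_n) : 0 <= sqn u.
Proof. by apply: sumr_ge0 => i _; rewrite -expr2 sqr_ge0. Qed.

Lemma sqn_eq0 n (u : 'cV[R]_n) : sqn u = 0 -> u = 0.
Proof.
move=> /eqP; rewrite psumr_eq0; last by move=> i _; rewrite -expr2 sqr_ge0.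
move=> /allP h; apply/colP => i; rewrite mxE.
by have := h i (mem_index_enum _); rewrite mulf_eq0 orbb => /eqP.
Qed.

Lemma sqnD n (u v : 'cV[R]_n) : sqn (u + v) = sqn u + 2 * dot u v + sqn v.
Proof. by rewrite /sqn !dotE (dotC v u); ring. Qed.

Lemma sqnZ n a (u : 'cV[R]_n) : sqn (a *: u) = a ^+ 2 * sqn u.
Proof. by rewrite /sqn !dotE; ring. Qed.

Lemma sqnN n (u : 'cV[R]_n) : sqn (- u) = sqn u.
Proof. by rewrite /sqn !dotE opprK. Qed.

Lemma dot_CS n (u v : 'cV[R]_n) : dot u v ^+ 2 <= sqn u * sqn v.
Proof.
have [/eqP v0|v0] := boolP (sqn v == 0).
  have -> : dot u v = 0.
    by rewrite (sqn_eq0 v0) /dot big1// => i _; rewrite mxE mulr0.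
  by rewrite v0 expr0n mulr0.
have vp : 0 < sqn v by rewrite lt_def v0 sqn_ge0.
have := sqn_ge0 (sqn v *: u - dot u v *: v).
rewrite sqnD sqnN !sqnZ !dotE => h.
have {}h : 0 <= sqn v * (sqn u * sqn v - dot u v ^+ 2) by lra.
by rewrite -subr_ge0; move: h; rewrite pmulr_rge0.
Qed.

Lemma sqn_add_le n (u v : 'cV[R]_n) : sqn (u + v) <= 2 * sqn u + 2 * sqn v.
Proof.
have := sqn_ge0 (u - v); rewrite !sqnD sqnN dotNr; lra.
Qed.

Lemma sqn_add_ge n (u v : 'cV[R]_n) : sqn u / 2 - sqn v <= sqn (u + v).
Proof.
have := sqn_ge0 (u + 2 *: v); rewrite !sqnD !dotE sqnZ; lra.
Qed.

(** A matrix and its transpose have the same operator norm: for b = A^T w, |b|^2 = <w, A b>; apply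
    Cauchy-Schwarz and divide by |b|^2. *)
Lemma sqn_mulmx_trmx m n (A : 'M[R]_(m, n)) s : 0 <= s ->
  (forall b, sqn (A *m b) <= s * sqn b) -> forall w, sqn (A^T *m w) <= s * sqn w.
Proof.
move=> s0 As w; set b := A^T *m w.
have h1 : sqn b = dot w (A *m b) by rewrite dot_mulmx.
have h2 := dot_CS w (A *m b); rewrite -h1 in h2.
have h3 : sqn w * sqn (A *m b) <= sqn w * (s * sqn b).
  by apply: ler_wpM2l (sqn_ge0 _) _ _ _.
have [/eqP b0|b0] := boolP (sqn b == 0).
  by rewrite b0 mulr_ge0// sqn_ge0.
have bp : 0 < sqn b by rewrite lt_def b0 sqn_ge0.
rewrite -(ler_pM2r bp); move: (le_trans h2 h3); lra.
Qed.

Lemma fro_trmx m n (A : 'M[R]_(m, n)) : fro A^T = fro A.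
Proof.
rewrite /fro exchange_big; apply: eq_bigr => i _; apply: eq_bigr => j _.
by rewrite mxE.
Qed.

Lemma fro_col m n (A : 'M[R]_(m, n)) : fro A = \sum_j sqn (col j A).
Proof.
rewrite /fro exchange_big; apply: eq_bigr => i _; apply: eq_bigr => j _.
by rewrite !mxE expr2.
Qed.

Lemma fro_ge0 m n (A : 'M[R]_(m, n)) : 0 <= fro A.
Proof. by do 2 (apply: sumr_ge0 => ? _); rewrite sqr_ge0. Qed.

Lemma fro_add_le m n (A B : 'M[R]_(m, n)) : fro (A + B) <= 2 * fro A + 2 * fro B.
Proof.
rewrite !fro_col !mulr_sumr -big_split; apply: ler_sum => j _ /=.
by rewrite raddfD sqn_add_le.
Qed.

Lemma fro_mulmx_le m n k (A : 'M[R]_(m, n)) (B : 'M[R]_(n, k)) s :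
  (forall b, sqn (A *m b) <= s * sqn b) -> fro (A *m B) <= s * fro B.
Proof.
move=> As; rewrite !fro_col mulr_sumr; apply: ler_sum => j _.
by rewrite colE -mulmxA -colE As.
Qed.

Lemma sqn_le_fro m n (A : 'M[R]_(m, n)) v : sqn (A *m v) <= fro A * sqn v.
Proof.
rewrite {1}/sqn /dot /fro mulr_suml; apply: ler_sum => i _.
have := dot_CS (row i A)^T v.
rewrite {2}/sqn /dot.
under eq_bigr do rewrite !mxE.
under [X in _ <= X * _]eq_bigr do rewrite !mxE -expr2.
by rewrite expr2 mxE.
Qed.

Lemma sum_sqr_le n (a : 'I_n -> R) : (\sum_i a i) ^+ 2 <= n%:R * \sum_i a i ^+ 2.
Proof.
have := dot_CS (const_mx 1 : 'cV[R]_n) (\col_i a i).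
rewrite /sqn /dot.
under eq_bigr do rewrite !mxE mul1r.
under [X in _ <= X * _]eq_bigr do rewrite !mxE mul1r.
under [X in _ <= _ * X]eq_bigr do rewrite !mxE -expr2.
by rewrite sumr_const card_ord.
Qed.

(** Source of the squared effective rank in the lower bounds on the variance. *)
Lemma sqr_trace_le n (A : 'M[R]_n) : (\tr A) ^+ 2 <= n%:R * fro A.
Proof.
apply: (le_trans (sum_sqr_le (fun i => A i i))).
rewrite ler_wpM2l//; apply: ler_sum => i _.
by rewrite (bigD1 i)//= lerDl sumr_ge0// => j _; rewrite sqr_ge0.
Qed.

Lemma dot_delta n (A : 'M[R]_n) i : dot (delta_mx i 0) (A *m delta_mx i 0) = A i i.
Proof.
rewrite -colE /dot (bigD1 i)//= big1 ?addr0 => [|j ji].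
  by rewrite !mxE !eqxx mul1r.
by rewrite mxE (negPf ji) mul0r.
Qed.

Lemma sqn_delta n (i : 'I_n) : sqn (delta_mx i 0 : 'cV[R]_n) = 1.
Proof.
by have := @dot_delta n 1%:M i; rewrite mul1mx mxE eqxx.
Qed.

End Euclid.

(** * Elementary facts on (S + t)^-1 for symmetric positive S *)

Section Resolvent.
Context {R : realFieldType}.

Lemma dot_gram n m (X : 'M[R]_(n, m)) u : dot u (X *m X^T *m u) = sqn (X^T *m u).
Proof. by rewrite -mulmxA dot_mulmx. Qed.

(** In the expansion of |S u + t u|^2 every term other than t^2 |u|^2 is non-negative. *)
Lemma sqn_resolvent_le n (S : 'M[R]_n) t u b : 0 < t ->
  0 <= dot u (S *m u) -> S *m u + t *: u = b -> t ^+ 2 * sqn u <= sqn b.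
Proof.
move=> t0 Su0 <-; rewrite sqnD sqnZ dotZr (dotC _ u).
by have := sqn_ge0 (S *m u); have := mulr_ge0 (ltW t0) Su0; lra.
Qed.

(** A singular matrix has a row vector in its kernel; symmetry of [S] turns it into a column, which
    [sqn_resolvent_le] forces to be 0. *)
Lemma ridge_unit n (S : 'M[R]_n) t : 0 < t ->
  (forall u, 0 <= dot u (S *m u)) -> S^T = S -> S + t%:M \in unitmx.
Proof.
move=> t0 S0 St; rewrite unitmxE unitfE; apply/det0P => -[v v0 vG].
have h : S *m v^T + t *: v^T = 0.
  by apply: trmx_inj; rewrite -mul_scalar_mx -mulmxDl trmx_mul trmxK linearD /= St
    tr_scalar_mx vG trmx0.
have h2 := sqn_resolvent_le t0 (S0 v^T) h.
have s0 : @sqn R n 0 = 0 by rewrite /sqn /dot big1// => i _; rewrite mxE mul0r.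
rewrite s0 in h2.
have : sqn v^T = 0.
  apply/le_anti; rewrite sqn_ge0 andbT.
  by rewrite -(pmulr_rle0 (sqn v^T) (exprn_gt0 2 t0)).
move=> /sqn_eq0 /(congr1 trmx); rewrite trmxK trmx0 => vv.
by rewrite vv eqxx in v0.
Qed.

Lemma invmx_ridgeP n (S : 'M[R]_n) t (b : 'cV[R]_n) : 0 < t ->
  (forall u, 0 <= dot u (S *m u)) -> S^T = S ->
  S *m (invmx (S + t%:M) *m b) + t *: (invmx (S + t%:M) *m b) = b.
Proof.
move=> t0 S0 St; rewrite -mul_scalar_mx -mulmxDl mulmxA mulmxV ?mul1mx//.
exact: ridge_unit.
Qed.

End Resolvent.

(** * Resolvent of a well-conditioned head plus a tail of bounded norm *)

Section Spiked.
Context {R : realFieldType} {n d q : nat}.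
Variables (Z : 'M[R]_(n, d)) (l : 'cV[R]_d) (X2 : 'M[R]_(n, q)) (N s t L : R).
Hypothesis N0 : 0 < N.
Hypothesis s0 : 0 <= s.
Hypothesis t0 : 0 < t.
Hypothesis L0 : 0 < L.
Hypothesis lL : forall k, L <= l k 0.
Hypothesis Z_ge : forall a, 9 / 10 * N * sqn a <= sqn (Z *m a).
Hypothesis Z_le : forall a, sqn (Z *m a) <= 11 / 10 * N * sqn a.
Hypothesis X2_le : forall b, sqn (X2 *m b) <= s * sqn b.

Let D : 'M[R]_d := diag_mx l^T.
Let S1 := Z *m D *m Z^T.
Let S2 := X2 *m X2^T.
Let S := S1 + S2.

Let l0 k : 0 < l k 0. Proof. exact: lt_le_trans (lL k). Qed.

Lemma dot_D a b : dot a (D *m b) = \sum_k l k 0 * (a k 0 * b k 0).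
Proof. by apply: eq_bigr => k _; rewrite mul_diag_mx mxE mxE; ring. Qed.

Lemma dot_DC a b : dot a (D *m b) = dot b (D *m a).
Proof. by rewrite !dot_D; apply: eq_bigr => k _; ring. Qed.

Lemma dot_D_ge0 a : 0 <= dot a (D *m a).
Proof.
by rewrite dot_D; apply: sumr_ge0 => k _; rewrite mulr_ge0 ?(ltW (l0 k))// -expr2 sqr_ge0.
Qed.

Lemma S1E u : dot u (S1 *m u) = dot (Z^T *m u) (D *m (Z^T *m u)).
Proof. by rewrite /S1 -!mulmxA dot_mulmx. Qed.

Lemma S2E u : dot u (S2 *m u) = sqn (X2^T *m u).
Proof. exact: dot_gram. Qed.

Lemma S_psd u : 0 <= dot u (S *m u).
Proof. by rewrite mulmxDl dotDr S1E S2E addr_ge0 ?dot_D_ge0 ?sqn_ge0. Qed.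

Lemma S_sym : S^T = S.
Proof. by rewrite /S linearD /= !trmx_mul !trmxK tr_diag_mx mulmxA. Qed.

Let X2t_le w : sqn (X2^T *m w) <= s * sqn w.
Proof. exact: sqn_mulmx_trmx. Qed.

Let Zt_le w : sqn (Z^T *m w) <= 11 / 10 * N * sqn w.
Proof. by apply: sqn_mulmx_trmx => //; move: N0; lra. Qed.

Section Head.
Variables (u : 'cV[R]_n) (v : 'cV[R]_d).
Hypothesis uE : S *m u + t *: u = Z *m (D *m v).

(** Moving the head term to the right turns the equation for [u] into (S2 + t) u = Z g, where only
    the tail resolvent is left. *)
Let g := D *m (v - Z^T *m u).
Let A2u := S2 *m u + t *: u.

Let A2uE : A2u = Z *m g.
Proof.
rewrite /g mulmxBr mulmxBr -uE /A2u /S mulmxDl /S1 -!mulmxA.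
by rewrite addrAC (addrC (Z *m _)) addrK.
Qed.

(** This is A^2 <= (s + t) A for A = S2 + t, whose spectrum lies in [0, s + t]. *)
Let A2u_le : sqn A2u <= (s + t) * dot u A2u.
Proof.
rewrite /A2u sqnD sqnZ dotDr !dotZr (dotC _ u) S2E.
have h1 : sqn (S2 *m u) <= s * sqn (X2^T *m u) by rewrite -mulmxA X2_le.
have := ler_wpM2l (ltW t0) (X2t_le u); rewrite -/(sqn u); nra.
Qed.

(** With A = S2 + t, |Z g|^2 = |A u|^2 <= (s + t) <u, Z g> <= (s + t) <g, v>, the last step dropping
    a non-negative quadratic form in [D]. Hence |g| is at most (s + t) |v| / (9N/10), and t |u| <=
    |Z g|. The eigenvalues in [D] disappear from the bound. *)
Lemma head_upper : 81 / 100 * N * (t ^+ 2 * sqn u) <= 11 / 10 * (s + t) ^+ 2 * sqn v.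
Proof.
have tu : t ^+ 2 * sqn u <= 11 / 10 * N * sqn g.
  apply: (le_trans _ (Z_le g)); rewrite -A2uE.
  by apply: (@sqn_resolvent_le _ _ S2 t) => //; rewrite S2E sqn_ge0.
have gv : dot u A2u <= dot g v.
  rewrite A2uE dot_mulmx (dotC _ g) -subr_ge0 -dotNr -dotDr /g dotC.
  exact: dot_D_ge0.
have h1 : 9 / 10 * N * sqn g <= (s + t) * dot g v.
  apply: (le_trans (Z_ge g)); rewrite -A2uE; apply: (le_trans A2u_le).
  by rewrite ler_wpM2l// addr_ge0// ltW.
have st0 : 0 <= s + t by rewrite addr_ge0// ltW.
have h2 : (9 / 10 * N * sqn g) ^+ 2 <= (s + t) ^+ 2 * (sqn g * sqn v).
  apply: le_trans (ler_wpM2l (sqr_ge0 _) (dot_CS g v)).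
  have g0 : 0 <= 9 / 10 * N * sqn g by rewrite mulr_ge0 ?sqn_ge0//; move: N0; lra.
  by rewrite -exprMn ler_pXn2r// nnegrE//; exact: le_trans g0 h1.
have h3 : 81 / 100 * N ^+ 2 * sqn g <= (s + t) ^+ 2 * sqn v.
  have [/eqP g0|g0] := boolP (sqn g == 0).
    by rewrite g0 mulr0 mulr_ge0 ?sqn_ge0 ?sqr_ge0.
  have gp : 0 < sqn g by rewrite lt_def g0 sqn_ge0.
  by rewrite -(ler_pM2r gp); move: h2; lra.
have := ler_wpM2l (ltW N0) tu; lra.
Qed.

(** Here v = Z^T u + D^-1 g, where |D^-1 g| <= |g| / L and |Z g| = |(S2 + t) u| <= (s + t) |u|. *)
Lemma head_lower :
  sqn v <= (22 / 10 * N + 20 / 9 * (s + t) ^+ 2 / (N * L ^+ 2)) * sqn u.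
Proof.
have vE : v = Z^T *m u + (v - Z^T *m u) by rewrite addrC subrK.
have h1 := sqn_add_le (Z^T *m u) (v - Z^T *m u); rewrite -vE in h1.
have h2 : L ^+ 2 * sqn (v - Z^T *m u) <= sqn g.
  rewrite /g; move: (v - _) => y; rewrite /sqn /dot mulr_sumr; apply: ler_sum => k _.
  rewrite mul_diag_mx !mxE.
  have yk := sqr_ge0 (y k 0).
  have : L ^+ 2 <= l k 0 ^+ 2 by rewrite ler_pXn2r ?nnegrE// ltW.
  by move=> /(ler_wpM2r yk); lra.
have h3 : 9 / 10 * N * sqn g <= (s + t) ^+ 2 * sqn u.
  apply: (le_trans (Z_ge g)); rewrite -A2uE.
  have st0 : 0 < s + t by rewrite ltr_wpDl.
  have a0 := sqn_ge0 A2u.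
  have : sqn A2u ^+ 2 <= (s + t) ^+ 2 * (sqn u * sqn A2u).
    apply: le_trans (ler_wpM2l (sqr_ge0 _) (dot_CS u A2u)).
    by rewrite -exprMn ler_pXn2r// ?nnegrE// (le_trans a0).
  have [/eqP g0|g0] := boolP (sqn A2u == 0).
    by rewrite g0 mulr_ge0 ?sqn_ge0 ?sqr_ge0.
  have gp : 0 < sqn A2u by rewrite lt_def g0 sqn_ge0.
  by move=> h; rewrite -(ler_pM2r gp); move: h; lra.
have NL : 0 < N * L ^+ 2 by rewrite mulr_gt0// exprn_gt0.
rewrite mulrDl mulrAC -(mulrA (20 / 9)).
have h4 : sqn (v - Z^T *m u) <= 10 / 9 * ((s + t) ^+ 2 * sqn u / (N * L ^+ 2)).
  rewrite mulrA ler_pdivlMr//; have := ler_wpM2l (ltW N0) h2; lra.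
have := Zt_le u; move: h1 h4; rewrite -!mulrA; lra.
Qed.

End Head.

(* Weak duality: e.(S x) = e.(S + t)^-1 S e is the supremum over a, b of the
   left-hand side. *)
Lemma resolvent_dual_le e x a b : S *m x + t *: x = e ->
  sqn e - sqn (e - Z *m (D *m a) - X2 *m b) - t * (dot a (D *m a) + sqn b)
  <= dot e (S *m x).
Proof.
move=> xE.
set h := Z *m (D *m (Z^T *m x - a)) + X2 *m (X2^T *m x - b).
have -> : e - Z *m (D *m a) - X2 *m b = h + t *: x.
  rewrite -xE /h !mulmxBr /S mulmxDl /S1 /S2 -!mulmxA.
  by apply/colP => i; rewrite !mxE; ring.
have xh : dot x h = dot (Z^T *m x) (D *m (Z^T *m x - a)) + dot (X2^T *m x) (X2^T *m x - b).
  by rewrite /h dotDr !dot_mulmx.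
have -> : dot e (S *m x) = sqn e - t * dot e x.
  have -> : S *m x = e - t *: x by rewrite -xE addrK.
  by rewrite !dotE.
have ex : dot e x = dot (Z^T *m x) (D *m (Z^T *m x)) + sqn (X2^T *m x) + t * sqn x.
  by rewrite dotC -xE dotDr dotZr mulmxDl dotDr S1E S2E.
rewrite sqnD sqnZ dotZr (dotC h) xh ex.
have h0 := sqn_ge0 h.
have h1 := dot_D_ge0 (Z^T *m x - a).
have h2 := sqn_ge0 (X2^T *m x - b).
have {}h1 : 0 <= 2 * dot (Z^T *m x) (D *m (Z^T *m x - a)) + dot a (D *m a) - dot (Z^T *m x) (D *m (Z^T *m x)).
  move: h1; rewrite !mulmxBr !dotE (dot_DC a (Z^T *m x)); lra.
have {}h2 : 0 <= 2 * dot (X2^T *m x) (X2^T *m x - b) + sqn b - sqn (X2^T *m x).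
  by move: h2; rewrite /sqn !dotE (dotC b (X2^T *m x)); lra.
have := mulr_ge0 (ltW t0) (addr_ge0 h1 h2); nra.
Qed.

Let r := (1 + t / (9 / 10 * N * L))^-1.

(** The hat matrix shrinks a head direction of eigenvalue l by about l / (l + t/N); [r] is the worst
    case l = L, with N lowered to 9N/10. The dual bound gives r |e|^2 <= <e, S x>, and
    Cauchy-Schwarz finishes. *)
Lemma shrink_head e x c : e = Z *m c -> S *m x + t *: x = e ->
  r ^+ 2 * sqn e <= sqn (S *m x).
Proof.
move=> ec xE.
have NL : 0 < 9 / 10 * N * L by rewrite mulr_gt0//; move: N0; lra.
have tNL : 0 < t / (9 / 10 * N * L) by rewrite divr_gt0.
have r0 : 0 < r by rewrite invr_gt0 addr_gt0.
(* The trial vector reproduces the fraction [r] of [e]. With T = t / (9/10 N L) the dual value is at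
   least (2 r - r^2 - r^2 T) |e|^2, and r (1 + T) = 1 makes this r |e|^2. *)
pose a : 'cV[R]_d := \col_k (r * c k 0 / l k 0).
have Da : D *m a = r *: c.
  by apply/colP => k; rewrite mul_diag_mx !mxE mulrC divfK// gt_eqF.
have h1 := resolvent_dual_le a 0 xE.
have e1 : e - Z *m (D *m a) - X2 *m 0 = (1 - r) *: e.
  by rewrite mulmx0 subr0 Da -scalemxAr -ec scalerBl scale1r.
have aDa : dot a (D *m a) <= r ^+ 2 / L * sqn c.
  have ac : dot a c <= r / L * sqn c.
    rewrite /sqn /dot mulr_sumr; apply: ler_sum => k _; rewrite mxE.
    have ck : 0 <= r * (c k 0 * c k 0) by rewrite mulr_ge0 ?(ltW r0)// -expr2 sqr_ge0.
    rewrite [X in X <= _](_ : _ = r * (c k 0 * c k 0) * (l k 0)^-1); last by ring.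
    rewrite [X in _ <= X](_ : _ = r * (c k 0 * c k 0) * L^-1); last by ring.
    by rewrite ler_wpM2l// lef_pV2 ?posrE.
  by rewrite Da dotZr; have := ler_wpM2l (ltW r0) ac; lra.
have Zc : 9 / 10 * N * sqn c <= sqn e by rewrite ec.
have s00 : @sqn R q 0 = 0 by rewrite /sqn /dot big1// => i _; rewrite mxE mul0r.
rewrite e1 sqnZ s00 addr0 in h1.
have h2 : r * sqn e <= dot e (S *m x).
  apply: le_trans h1.
  have h3 : t * dot a (D *m a) <= r ^+ 2 * (t / (9 / 10 * N * L)) * sqn e.
    apply: (le_trans (ler_wpM2l (ltW t0) aDa)).
    rewrite [X in X <= _](_ : _ = r ^+ 2 * (t / (9 / 10 * N * L)) * (9 / 10 * N * sqn c)).
      by rewrite ler_wpM2l// mulr_ge0 ?sqr_ge0// ltW.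
    by field; rewrite !gt_eqF.
  have h4 : r * (1 + t / (9 / 10 * N * L)) = 1 by rewrite mulVf// gt_eqF// addr_gt0.
  have h5 : r ^+ 2 * (t / (9 / 10 * N * L)) = r - r ^+ 2.
    have := congr1 (fun y => r * y) h4.
    by move: (t / _) => T /=; move: r => r' {}h4; lra.
  by rewrite h5 in h3; lra.
have h6 : (r * sqn e) ^+ 2 <= sqn e * sqn (S *m x).
  apply: le_trans (dot_CS e (S *m x)).
  by rewrite ler_pXn2r// nnegrE ?mulr_ge0 ?sqn_ge0 ?(ltW r0)// (le_trans _ h2)// mulr_ge0 ?sqn_ge0 ?(ltW r0).
have [/eqP e0|e0] := boolP (sqn e == 0); first by rewrite e0 mulr0 sqn_ge0.
have ep : 0 < sqn e by rewrite lt_def e0 sqn_ge0.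
by rewrite -(ler_pM2r ep); move: h6; lra.
Qed.

Let G := S + t%:M.
Let f := S *m invmx G.

Let GP (b : 'cV[R]_n) : S *m (invmx G *m b) + t *: (invmx G *m b) = b.
Proof. exact: invmx_ridgeP t0 S_psd S_sym. Qed.

(** [shrink_head] applies to each of the d columns of [Z], and multiplying [f] by [Z] enlarges its
    squared Frobenius norm by at most 11N/10. *)
Lemma fro_hat_ge_head : 9 / 11 * r ^+ 2 * d%:R <= fro f.
Proof.
have h1 : 9 / 10 * N * r ^+ 2 * d%:R <= fro (f *m Z).
  rewrite fro_col mulr_natr -[X in _ *+ X]card_ord -sumr_const.
  apply: ler_sum => k _; rewrite colE /f -!mulmxA.
  apply: le_trans (shrink_head (erefl _) (GP _)).
  by have := ler_wpM2l (sqr_ge0 r) (Z_ge (delta_mx k 0)); rewrite sqn_delta; lra.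
have h2 : fro (f *m Z) <= 11 / 10 * N * fro f.
  by rewrite -fro_trmx trmx_mul -(fro_trmx f); apply: fro_mulmx_le.
by rewrite -(ler_pM2l N0); move: (le_trans h1 h2); lra.
Qed.

(** The dual bound is applied to each diagonal entry of [f], and the trace is then compared with the
    Frobenius norm. *)
Lemma fro_hat_ge_tail : (fro X2 / (s + t)) ^+ 2 <= n%:R * fro f.
Proof.
have st0 : 0 < s + t by rewrite ltr_wpDl.
apply: le_trans (sqr_trace_le f).
have h : fro X2 / (s + t) <= \tr f.
  rewrite -fro_trmx fro_col mulr_suml; apply: ler_sum => i _.
  set e := delta_mx i 0 : 'cV[R]_n.
  rewrite -dot_delta -/e /f -mulmxA colE -/e.
  (* With c = 1 / (s + t) and w = |X2^T e|^2 the dual value is at least 2 c w - c^2 (s + t) w = c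
     w. *)
  apply: le_trans (resolvent_dual_le 0 ((s + t)^-1 *: (X2^T *m e)) (GP e)).
  rewrite !mulmx0 subr0 -scalemxAr sqnZ [dot 0 _](_ : _ = 0); last first.
    by rewrite /dot big1// => j _; rewrite mxE mul0r.
  rewrite add0r sqnD sqnN sqnZ dotNr dotZr mulmxA dot_gram.
  have h1 : sqn (X2 *m X2^T *m e) <= s * sqn (X2^T *m e) by rewrite -mulmxA X2_le.
  have := ler_wpM2l (sqr_ge0 (s + t)^-1) h1.
  set w := sqn (X2^T *m e).
  have : (s + t) * (s + t)^-1 = 1 by rewrite mulfV// gt_eqF.
  set c := (s + t)^-1 => cE.
  have : c ^+ 2 * ((s + t) * w) = c * w * ((s + t) * c) by ring.
  by rewrite cE mulr1 -/w; lra.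
by rewrite ler_pXn2r// nnegrE ?divr_ge0 ?fro_ge0 ?(ltW st0)// (le_trans _ h)// divr_ge0 ?fro_ge0 ?(ltW st0).
Qed.

(** The head part has rank at most d and is treated by [head_upper] on the basis vectors of R^d; for
    the tail, |(S + t)^-1| <= 1/t and |X2 X2^T|_F^2 <= s |X2|_F^2. *)
Lemma fro_hat_le : fro f <= 242 / 81 * ((s + t) ^+ 2 / t ^+ 2) * d%:R
   + 2 * (s * fro X2 / t ^+ 2).
Proof.
have t2 : 0 < t ^+ 2 by rewrite exprn_gt0.
have Gs : (invmx G)^T = invmx G.
  by rewrite trmx_inv linearD /= S_sym tr_scalar_mx.
rewrite /f /S mulmxDl; apply: (le_trans (fro_add_le _ _)).
have h1 : fro (S1 *m invmx G) <= 121 / 81 * ((s + t) ^+ 2 / t ^+ 2) * d%:R.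
  rewrite /S1.
  have ZGD : fro (D *m (Z^T *m invmx G)) <= 110 / 81 * (s + t) ^+ 2 / (N * t ^+ 2) * d%:R.
    rewrite -fro_trmx !trmx_mul Gs trmxK tr_diag_mx fro_col mulr_natr -[X in _ *+ X]card_ord -sumr_const.
    apply: ler_sum => k _; rewrite colE -!mulmxA.
    have := head_upper (GP (Z *m (D *m delta_mx k 0))).
    rewrite sqn_delta ler_pdivlMr ?mulr_gt0//; lra.
  have := @fro_mulmx_le _ _ _ _ Z (D *m (Z^T *m invmx G)) _ Z_le.
  have N1 : N * (110 / 81 * (s + t) ^+ 2 / (N * t ^+ 2) * d%:R) =
      110 / 81 * ((s + t) ^+ 2 / t ^+ 2) * d%:R by field; rewrite !gt_eqF.
  have := ler_wpM2l (ltW N0) ZGD; rewrite N1 !mulmxA; lra.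
have h2 : fro (S2 *m invmx G) <= s * fro X2 / t ^+ 2.
  rewrite -fro_trmx trmx_mul Gs.
  have h3 : t ^+ 2 * fro (invmx G *m S2^T) <= fro S2^T.
    rewrite !fro_col mulr_sumr; apply: ler_sum => i _.
    rewrite colE -mulmxA -colE.
    exact: sqn_resolvent_le t0 (S_psd _) (GP _).
  rewrite ler_pdivlMr// mulrC; apply: (le_trans h3).
  by rewrite fro_trmx /S2 -(fro_trmx X2); apply: fro_mulmx_le.
lra.
Qed.

End Spiked.

(** * Risk bounds for a fixed design *)

Definition ridge_risk {R : realFieldType} n p (X : 'M[R]_(n, p)) (theta : 'cV[R]_p) (sigma tau : R) : R :=
  let G := invmx (X *m X^T + (n%:R * tau)%:M) in
  ((n%:R * tau) ^+ 2 * sqn (G *m (X *m theta))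
     + sigma ^+ 2 * fro (X *m X^T *m G)) / n%:R.

Section Risk.
Context {R : realFieldType} {n d q p : nat}.
Variables (Z : 'M[R]_(n, d)) (l v : 'cV[R]_d) (X2 : 'M[R]_(n, q)) (th2 : 'cV[R]_q).
Variables (X : 'M[R]_(n, p)) (theta : 'cV[R]_p).
Variables (sigma tau L K lam1 r tail : R).
Let N : R := n%:R.
Let D : 'M[R]_d := diag_mx l^T.
Hypothesis n0 : (0 < n)%N.
Hypothesis K0 : 0 <= K.
Hypothesis tau0 : 0 < tau.
Hypothesis lam10 : 0 < lam1.
Hypothesis L0 : 0 < L.
Hypothesis r0 : 0 <= r.
Hypothesis lL : forall k, L <= l k 0.
Hypothesis Z_ge : forall a, 9 / 10 * N * sqn a <= sqn (Z *m a).
Hypothesis Z_le : forall a, sqn (Z *m a) <= 11 / 10 * N * sqn a.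
Hypothesis X2_le : forall b, sqn (X2 *m b) <= N * (K * lam1) * sqn b.
Hypothesis X2_fro_ge : 9 / 10 * (N * (lam1 * r)) <= fro X2.
Hypothesis X2_fro_le : fro X2 <= 11 / 10 * (N * (lam1 * r)).
Hypothesis X2_th2 : sqn (X2 *m th2) <= 11 / 10 * N * tail.
Hypothesis XXt : X *m X^T = Z *m D *m Z^T + X2 *m X2^T.
Hypothesis Xth : X *m theta = Z *m (D *m v) + X2 *m th2.

Let F := ridge_risk X theta sigma tau.
Let N0 : 0 < N. Proof. by rewrite ltr0n. Qed.
Let t := N * tau.
Let s := N * (K * lam1).
Let t0 : 0 < t. Proof. exact: mulr_gt0. Qed.
Let s0 : 0 <= s. Proof. by rewrite mulr_ge0 ?(ltW N0)// mulr_ge0// ltW. Qed.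
Let G := invmx (Z *m D *m Z^T + X2 *m X2^T + t%:M).
Let u1 := G *m (Z *m (D *m v)).
Let u2 := G *m (X2 *m th2).
Let f := (Z *m D *m Z^T + X2 *m X2^T) *m G.
Let stE : s + t = N * (K * lam1 + tau). Proof. by rewrite /s /t; ring. Qed.
Let W0 : 0 < K * lam1 + tau. Proof. by rewrite ltr_wpDl// mulr_ge0// ltW. Qed.

Let FE : F = (t ^+ 2 * sqn (u1 + u2) + sigma ^+ 2 * fro f) / N.
Proof. by rewrite /F /ridge_risk XXt Xth mulmxDr. Qed.

Let bias_ge0 : 0 <= t ^+ 2 * sqn (u1 + u2).
Proof. by rewrite mulr_ge0 ?sqr_ge0 ?sqn_ge0. Qed.

Let var_ge0 : 0 <= sigma ^+ 2 * fro f.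
Proof. by rewrite mulr_ge0 ?sqr_ge0 ?fro_ge0. Qed.

Let u1P := invmx_ridgeP (Z *m (D *m v)) t0 (S_psd Z X2 L0 lL) (S_sym Z l X2).
Let u2P := invmx_ridgeP (X2 *m th2) t0 (S_psd Z X2 L0 lL) (S_sym Z l X2).

Lemma risk_ge_head :
  9 / 11 * (1 + tau / (9 / 10 * L))^-1 ^+ 2 * (sigma ^+ 2 * (d%:R / N)) <= F.
Proof.
have := fro_hat_ge_head X2 N0 t0 L0 lL Z_ge Z_le; rewrite -/D -/G -/f => h.
have E : t / (9 / 10 * N * L) = tau / (9 / 10 * L).
  by rewrite /t; field; rewrite !gt_eqF.
rewrite E in h; rewrite FE ler_pdivlMr//.
have {}h := ler_wpM2l (sqr_ge0 sigma) h.
have -> : 9 / 11 * (1 + tau / (9 / 10 * L))^-1 ^+ 2 * (sigma ^+ 2 * (d%:R / N)) * N =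
  sigma ^+ 2 * (9 / 11 * (1 + tau / (9 / 10 * L))^-1 ^+ 2 * d%:R).
  by move: (_^-1 ^+ 2) => c; field; rewrite gt_eqF.
by have := bias_ge0; lra.
Qed.

Lemma risk_ge_tail :
  sigma ^+ 2 * (9 / 10 * (lam1 * r) / (N * (K * lam1 + tau))) ^+ 2 <= F.
Proof.
have := fro_hat_ge_tail Z s0 t0 L0 lL X2_le; rewrite -/D -/G -/f => h.
have h1 : (9 / 10 * (lam1 * r) / (K * lam1 + tau)) ^+ 2 <= N * fro f.
  apply: le_trans h; rewrite stE.
  have e0 : 0 <= 9 / 10 * (lam1 * r) / (K * lam1 + tau).
    by rewrite divr_ge0 ?(ltW W0)//; have := mulr_ge0 (ltW lam10) r0; lra.
  have e1 : 9 / 10 * (lam1 * r) / (K * lam1 + tau) <= fro X2 / (N * (K * lam1 + tau)).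
    rewrite ler_pdivlMr; last exact: mulr_gt0.
    rewrite [X in X <= _](_ : _ = 9 / 10 * (N * (lam1 * r)))//.
    by field; rewrite gt_eqF.
  by rewrite ler_pXn2r// nnegrE// (le_trans e0).
rewrite FE ler_pdivlMr//.
have {}h1 := ler_wpM2l (sqr_ge0 sigma) h1.
have E : N * (sigma ^+ 2 * (9 / 10 * (lam1 * r) / (N * (K * lam1 + tau))) ^+ 2 * N) =
  sigma ^+ 2 * (9 / 10 * (lam1 * r) / (K * lam1 + tau)) ^+ 2.
  by field; rewrite !gt_eqF.
rewrite -(ler_pM2l N0) E; have := mulr_ge0 (ltW N0) bias_ge0; lra.
Qed.

(** The first hypothesis makes s + t <= 11/10 t, so [head_lower] gives mu^2 |v|^2 <= 5 N tau^2
    |u1|^2. The tail contribution [u2] could cancel [u1]; since |u1 + u2|^2 >= |u1|^2 / 2 - |u2|^2,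
    what remains is at least 1/10 - 11/200 of mu^2 |v|^2, above 1/40. *)
Lemma risk_ge_bias mu delta : 10 * (K * lam1) <= tau -> lam1 <= mu -> mu <= tau -> mu <= L ->
  delta <= 1 / 20 -> tail <= delta * lam1 ^+ 2 * sqn v ->
  1 / 40 * (mu ^+ 2 * sqn v) <= F.
Proof.
move=> Ktau lam_mu mu_tau mu_L delta1 htail.
have mu0 : 0 < mu by apply: lt_le_trans lam_mu.
have v0 := sqn_ge0 v.
have hu := head_lower N0 s0 t0 L0 lL Z_ge Z_le X2_le u1P; rewrite -/u1 in hu.
have hu2 := sqn_resolvent_le t0 (S_psd Z X2 L0 lL _) u2P; rewrite -/u2 in hu2.
have U0 := sqn_ge0 u1.
have h1 : mu ^+ 2 * sqn v <= 5 * (N * (tau ^+ 2 * sqn u1)).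
  have e1 : mu ^+ 2 * (s + t) ^+ 2 <= 121 / 100 * N ^+ 2 * (L ^+ 2 * tau ^+ 2).
    have -> : 121 / 100 * N ^+ 2 * (L ^+ 2 * tau ^+ 2) = (L * (N * (11 / 10 * tau))) ^+ 2 by field.
    have e0 : 0 <= mu * (s + t) by rewrite mulr_ge0 ?addr_ge0// ltW.
    have e3 : mu * (s + t) <= L * (N * (11 / 10 * tau)).
      rewrite stE ler_pM// ?(ltW mu0)//; first by rewrite mulr_ge0 ?(ltW N0) ?(ltW W0).
      by rewrite ler_pM2l//; move: Ktau; lra.
    by rewrite -exprMn ler_pXn2r// nnegrE (le_trans e0).
  have e2 : mu ^+ 2 * (20 / 9 * (s + t) ^+ 2 / (N * L ^+ 2)) <= 27 / 10 * N * tau ^+ 2.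
    rewrite mulrA ler_pdivrMr ?mulr_gt0 ?exprn_gt0//.
    have : 0 <= N ^+ 2 * (L ^+ 2 * tau ^+ 2) by rewrite mulr_ge0 ?sqr_ge0// mulr_ge0 ?sqr_ge0.
    lra.
  have e3 : mu ^+ 2 <= tau ^+ 2 by rewrite ler_pXn2r ?nnegrE ?(ltW tau0) ?(ltW mu0).
  have e4 := ler_wpM2l (ltW N0) e3.
  have e5 : mu ^+ 2 * (22 / 10 * N + 20 / 9 * (s + t) ^+ 2 / (N * L ^+ 2)) <= 5 * (N * tau ^+ 2).
    rewrite mulrDr; have := mulr_ge0 (ltW N0) (sqr_ge0 tau); lra.
  have := ler_wpM2r U0 e5; have := ler_wpM2l (sqr_ge0 mu) hu.
  by move: (22 / 10 * N + _) => c; lra.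
have h2 : tail <= 1 / 20 * (mu ^+ 2 * sqn v).
  apply: (le_trans htail); rewrite -mulrA.
  have e1 : lam1 ^+ 2 <= mu ^+ 2 by rewrite ler_pXn2r ?nnegrE ?(ltW lam10) ?(ltW mu0).
  have e2 := ler_wpM2r v0 e1.
  have e3 : 0 <= lam1 ^+ 2 * sqn v by rewrite mulr_ge0 ?sqr_ge0.
  have := ler_wpM2r e3 delta1; lra.
have h3 := ler_wpM2l (sqr_ge0 t) (sqn_add_ge u1 u2).
rewrite FE ler_pdivlMr//.
have h4 := ler_wpM2l (ltW N0) h1.
have h5 := ler_wpM2l (ltW N0) h2.
have h6 : t ^+ 2 * sqn u1 = N * (N * (tau ^+ 2 * sqn u1)) by rewrite /t; ring.
have h7 : 0 <= N * (mu ^+ 2 * sqn v) by rewrite mulr_ge0 ?(ltW N0)// mulr_ge0 ?sqr_ge0.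
by have := var_ge0; move: X2_th2 h3; rewrite mulrBr [t ^+ 2 * (sqn u1 / 2)]mulrA h6; lra.
Qed.

Lemma risk_le : tail <= lam1 ^+ 2 * sqn v ->
  F <= 3 * ((K * lam1 + tau) ^+ 2 * sqn v) + 3 * (lam1 ^+ 2 * sqn v)
     + sigma ^+ 2 * (3 * ((K * lam1 + tau) ^+ 2 / tau ^+ 2) * (d%:R / N)
         + 22 / 10 * K * (lam1 ^+ 2 / tau ^+ 2 * (r / N))).
Proof.
move=> htail.
have hu := head_upper N0 s0 t0 L0 lL Z_ge Z_le X2_le u1P.
have hf := fro_hat_le N0 s0 t0 L0 lL Z_ge Z_le X2_le.
rewrite -/D -/G -/f -/u1 in hu hf.
have hu2 := sqn_resolvent_le t0 (S_psd Z X2 L0 lL _) u2P.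
rewrite -/u2 in hu2.
rewrite FE ler_pdivrMr//.
have h1 := ler_wpM2l (sqr_ge0 t) (sqn_add_le u1 u2).
have h2 : t ^+ 2 * sqn u1 <= 110 / 81 * N * ((K * lam1 + tau) ^+ 2 * sqn v).
  rewrite -(ler_pM2l N0); move: hu; rewrite stE exprMn; lra.
have h3 : sigma ^+ 2 * fro f <= N * (sigma ^+ 2 * (3 * ((K * lam1 + tau) ^+ 2 / tau ^+ 2) * (d%:R / N)
         + 22 / 10 * K * (lam1 ^+ 2 / tau ^+ 2 * (r / N)))).
  rewrite mulrCA ler_wpM2l ?sqr_ge0//; apply: (le_trans hf).
  have e1 : (s + t) ^+ 2 / t ^+ 2 = (K * lam1 + tau) ^+ 2 / tau ^+ 2.
    by rewrite stE /t; field; rewrite !gt_eqF.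
  have e2 : s * fro X2 / t ^+ 2 <= 11 / 10 * K * (lam1 ^+ 2 / tau ^+ 2 * r).
    rewrite ler_pdivrMr ?exprn_gt0//; apply: (le_trans (ler_wpM2l s0 X2_fro_le)).
    rewrite le_eqVlt; apply/orP; left; apply/eqP; rewrite /s /t.
    by field; rewrite !gt_eqF.
  have e3 : N * (3 * ((K * lam1 + tau) ^+ 2 / tau ^+ 2) * (d%:R / N)
         + 22 / 10 * K * (lam1 ^+ 2 / tau ^+ 2 * (r / N))) =
       3 * ((K * lam1 + tau) ^+ 2 / tau ^+ 2 * d%:R) + 22 / 10 * K * (lam1 ^+ 2 / tau ^+ 2 * r).
    by field; rewrite !gt_eqF.
  have e4 : 0 <= (K * lam1 + tau) ^+ 2 / tau ^+ 2 * d%:R.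
    by rewrite mulr_ge0// divr_ge0 ?sqr_ge0.
  rewrite e3 e1; move: e2 e4; rewrite -!mulrA; lra.
have h4 := ler_wpM2l (ltW N0) htail.
have h5 : 0 <= N * ((K * lam1 + tau) ^+ 2 * sqn v).
  by rewrite mulr_ge0 ?(ltW N0)// mulr_ge0 ?sqr_ge0 ?sqn_ge0.
have h6 : 0 <= N * (lam1 ^+ 2 * sqn v).
  by rewrite mulr_ge0 ?(ltW N0)// mulr_ge0 ?sqr_ge0 ?sqn_ge0.
rewrite mulrDl (mulrC _ N) (mulrC _ N).
by move: X2_th2 h3 => hx h3; lra.
Qed.

End Risk.

(** * Independence, nets and Bernstein's inequality *)

Section IndependentPair.
Local Open Scope ereal_scope.
Context {disp : measure_display} {T : measurableType disp} {R : realType}.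
Variable P : probability T R.

(** Here [c] plays the mean of [H]. The simple functions are chosen on the real line and composed
    with [q], so their level sets are events {q in B}, for which the product rule is assumed;
    monotone convergence does the rest. *)
Lemma integral_mul_indep (q H : T -> R) (c : R) :
  measurable_fun setT q -> measurable_fun setT H ->
  (forall w, 0 <= q w)%R -> (forall w, 0 <= H w)%R -> (0 <= c)%R ->
  (forall B : set R, measurable B ->
     \int[P]_(w in q @^-1` B) (H w)%:E = c%:E * P (q @^-1` B)) ->
  \int[P]_w (q w * H w)%:E = c%:E * \int[P]_w (q w)%:E.
Proof.
move=> mq mH q0 H0 c0 qH.
(* The positive part is non-negative on the whole line and is the identity on the values of [q]. *)
pose f : measurableTypeR R -> \bar R := fun x => (Num.max x 0)%:E.
have mf : measurable_fun [set: measurableTypeR R] f.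
  by apply/measurable_EFinP; apply: measurable_maxr.
have f0 : forall x : measurableTypeR R, [set: measurableTypeR R] x -> 0 <= f x by move=> x _; rewrite lee_fin le_max lexx orbT.
pose g := nnsfun_approx measurableT mf.
have gnd := nd_nnsfun_approx measurableT mf.
have gcvg x : (g n x)%:E @[n --> \oo] --> f x := cvg_nnsfun_approx measurableT mf f0 (I : [set: measurableTypeR R] x).
have g0 n x : (0 <= g n x)%R by [].
have mgq n : measurable_fun setT (g n \o q) by apply: measurableT_comp.
have step n : \int[P]_w (g n (q w) * H w)%:E = c%:E * \int[P]_w (g n (q w))%:E.
  have E w : (g n (q w))%:E = \sum_(y \in range (g n)) (y * \1_(q @^-1` (g n @^-1` [set y])) w)%:E.
    by rewrite [in LHS]fimfunE -fsumEFin.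
  have E2 w : (g n (q w) * H w)%:E = \sum_(y \in range (g n)) (y%:E * (\1_(q @^-1` (g n @^-1` [set y])) w * H w)%:E).
    rewrite EFinM [in LHS]fimfunE -fsumEFin// muleC ge0_mule_fsumr; last first.
      by move=> y; rewrite lee_fin; exact: nnfun_muleindic_ge0.
    by apply: eq_fsbigr => y _; rewrite EFinM [in RHS]EFinM muleC muleA.
  have mg y : measurable (g n @^-1` [set y]) by exact: measurable_funPTI.
  have mA y : measurable (q @^-1` (g n @^-1` [set y])).
    by have := mq measurableT _ (mg y); rewrite setTI.
  under eq_integral do rewrite E2.
  rewrite ge0_integral_fsum//; first last.
  - move=> y w _; have [y0|y0] := leP 0%R y.
      by rewrite mule_ge0// ?lee_fin// mulr_ge0.
    rewrite preimage_nnfun0// preimage_set0 indicE in_set0 mul0r mule0 //.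
  - move=> y; apply/measurable_EFinP; apply: measurable_funM => //.
    by apply: measurable_funM => //; exact: measurable_indic.
  under [in RHS]eq_integral do rewrite E.
  rewrite ge0_integral_fsum//; first last.
  - by move=> y w _; rewrite lee_fin; exact: nnfun_muleindic_ge0.
  - by move=> y; apply/measurable_EFinP; apply: measurable_funM => //; exact: measurable_indic.
  rewrite ge0_mule_fsumr; last first.
    by move=> y; apply: integral_ge0 => w _; rewrite lee_fin; exact: nnfun_muleindic_ge0.
  apply: eq_fsbigr => y _.
  have [y0|y0] := leP 0%R y; last first.
    rewrite preimage_nnfun0// preimage_set0.
    rewrite integral0_eq; last by move=> w _; rewrite indicE in_set0 mul0r mule0.
    by rewrite integral0_eq ?mule0// => w _; rewrite indicE in_set0 mulr0.
  rewrite ge0_integralZl//; first last.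
  - by move=> w _; rewrite lee_fin mulr_ge0.
  - by apply/measurable_EFinP; apply: measurable_funM => //; exact: measurable_indic.
  under [in RHS]eq_integral do rewrite EFinM.
  rewrite ge0_integralZl//; last by apply/measurable_EFinP; exact: measurable_indic.
  rewrite integral_indic// setIT muleCA -qH; last exact: mg.
  rewrite [in RHS]integral_mkcond; congr (_ * _); apply: eq_integral => w _.
  by rewrite epatch_indic EFinM muleC.
have cv1 : \int[P]_w (g n (q w) * H w)%:E @[n --> \oo] --> \int[P]_w (q w * H w)%:E.
  rewrite (_ : \int[P]_w (q w * H w)%:E = \int[P]_w limn (fun n => (g n (q w) * H w)%:E)).
    apply: cvg_monotone_convergence => //.
    - by move=> k; apply/measurable_EFinP; exact: (measurable_funM (mgq k) mH).
    - by move=> ? w _; rewrite lee_fin mulr_ge0.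
    - move=> w _ m k mk; rewrite lee_fin ler_wpM2r//.
      by have /lefP := gnd _ _ mk; apply.
  apply: eq_integral => w _; apply/esym/cvg_lim => //.
  have := gcvg (q w); rewrite /f; rewrite (max_idPl _)// => h.
  rewrite EFinM; under eq_fun do rewrite EFinM.
  by apply: cvgeM => //; rewrite ?mule_def_fin//; exact: cvg_cst.
have cv2 : \int[P]_w (g n (q w))%:E @[n --> \oo] --> \int[P]_w (q w)%:E.
  rewrite (_ : \int[P]_w (q w)%:E = \int[P]_w limn (fun n => (g n (q w))%:E)).
    apply: cvg_monotone_convergence => //.
    - by move=> k; apply/measurable_EFinP; exact: mgq.
    - by move=> ? w _; rewrite lee_fin.
    - move=> w _ m k mk; rewrite lee_fin.
      by have /lefP := gnd _ _ mk; apply.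
  apply: eq_integral => w _; apply/esym/cvg_lim => //.
  by have := gcvg (q w); rewrite /f; rewrite (max_idPl _).
have cv3 : \int[P]_w (g n (q w) * H w)%:E @[n --> \oo] --> c%:E * \int[P]_w (q w)%:E.
  by under eq_fun do rewrite step; apply: cvgeZl.
exact: (cvg_unique _ cv1 cv3).
Qed.

End IndependentPair.

Section IndependentProducts.
Local Open Scope ereal_scope.
Context {disp : measure_display} {T : measurableType disp} {R : realType}.
Variable P : probability T R.

(** Induction on k: the first k factors are [q i], the others indicators of {q i in B i} with [B]
    arbitrary. Turning the k-th indicator into [q k] is an instance of [integral_mul_indep], whose
    hypothesis for a set C is the previous stage with C in place of [B k]. *)
Lemma expectation_prod_indep n (q : 'I_n -> T -> R) (e : 'I_n -> R) :
  (forall i, measurable_fun setT (q i)) -> (forall i w, 0 <= q i w)%R ->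
  (forall B : 'I_n -> set R, (forall i, measurable (B i)) ->
    P (\bigcap_(i in [set: 'I_n]) (q i @^-1` B i)) =
    \prod_(i < n) P (q i @^-1` B i)) ->
  (forall i, \int[P]_w (q i w)%:E = (e i)%:E) ->
  \int[P]_w (\prod_(i < n) q i w)%:E = (\prod_(i < n) e i)%:E.
Proof.
move=> mq q0 ind Eq.
have e0 i : (0 <= e i)%R.
  by rewrite -lee_fin -Eq; apply: integral_ge0 => w _; rewrite lee_fin.
pose F k (B : 'I_n -> set R) (i : 'I_n) w : R := if (i < k)%N then q i w else \1_(B i) (q i w).
pose E k (B : 'I_n -> set R) (i : 'I_n) : R := if (i < k)%N then e i else fine (P (q i @^-1` B i)).
have mqB i (B : set R) : measurable B -> measurable (q i @^-1` B).
  by move=> mB; have := mq i measurableT _ mB; rewrite setTI.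
have F0 k B i w : (0 <= F k B i w)%R by rewrite /F; case: ifP.
have E0 k B i : (0 <= E k B i)%R by rewrite /E; case: ifP => // _; rewrite fine_ge0.
have mF k B i : (forall i, measurable (B i)) -> measurable_fun setT (F k B i).
  move=> mB; rewrite /F; case: (i < k)%N => //.
  have mI : measurable_fun setT (\1_(B i) : R -> R) by exact: (@measurable_indic _ _ R setT (B i) (mB i)).
  exact: (measurableT_comp mI (mq i)).
have claim k : (k <= n)%N -> forall B : 'I_n -> set R, (forall i, measurable (B i)) ->
    \int[P]_w (\prod_(i < n) F k B i w)%:E = (\prod_(i < n) E k B i)%:E.
  elim: k => [_ B mB|k IH kn B mB].
    transitivity (P (\bigcap_(i in [set: 'I_n]) (q i @^-1` B i))).
      rewrite -[X in P X]setIT -integral_indic//; last first.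
        by apply: fin_bigcap_measurable => // i _; exact: mqB.
      apply: eq_integral => w _; congr EFin; rewrite /F /=.
      have [wB|wB] := pselect (forall i, B i (q i w)).
        rewrite indicE mem_set => [|i _]; last exact: wB.
        by rewrite big1// => i _; rewrite indicE mem_set//; exact: wB.
      rewrite indicE memNset; last by move=> h; apply: wB => i; exact: h.
      have [i wBi] : exists i, ~ B i (q i w) by apply/existsNP.
      by rewrite (bigD1 i)//= indicE memNset// mul0r.
    rewrite ind// -prodEFin; apply: eq_bigr => i _; rewrite /E /= fineK//.
    by rewrite fin_num_measure//; exact: mqB.
  pose K := Ordinal kn.
  have FK i w : i != K -> F k.+1 B i w = F k B i w.
    by rewrite /F ltnS leq_eqVlt => /negPf; rewrite -val_eqE/= => ->.
  have EK i : i != K -> E k.+1 B i = E k B i.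
    by rewrite /E ltnS leq_eqVlt => /negPf; rewrite -val_eqE/= => ->.
  rewrite (bigD1 K)//= {1}/E ltnSn.
  rewrite (eq_bigr (E k B)); last by move=> i; exact: EK.
  transitivity (\int[P]_w (q K w * \prod_(i < n | i != K) F k B i w)%:E).
    apply: eq_integral => w _; rewrite (bigD1 K)//= {1}/F ltnSn.
    by congr (_ * _)%:E; apply: eq_bigr => i; exact: FK.
  rewrite (@integral_mul_indep _ _ _ P (q K) _ (\prod_(i < n | i != K) E k B i)%R)//.
  - by rewrite Eq -EFinM mulrC.
  - under eq_fun do rewrite -big_filter.
    by apply: measurable_prod => i _; exact: mF.
  - by move=> w; apply: prodr_ge0.
  - by apply: prodr_ge0.
  - move=> C mC; pose B' i := if i == K then C else B i.
    have mB' i : measurable (B' i) by rewrite /B'; case: ifP.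
    have FB i w : i != K -> F k B' i w = F k B i w.
      by rewrite /F /B' => /negPf ->.
    have EB i : i != K -> E k B' i = E k B i.
      by rewrite /E /B' => /negPf ->.
    transitivity (\int[P]_w (\prod_(i < n) F k B' i w)%:E).
      rewrite integral_mkcond; apply: eq_integral => w _.
      have FK0 : F k B' K w = \1_C (q K w) by rewrite /F /B' eqxx ltnn.
      rewrite (bigD1 K)// FK0 epatch_indic EFinM muleC.
      by congr (_ * _%:E); apply: eq_bigr => i iK; rewrite FB.
    rewrite IH//; last exact: ltnW.
    have EK0 : E k B' K = fine (P (q K @^-1` C)) by rewrite /E /B' eqxx ltnn.
    rewrite (bigD1 K)// EK0 EFinM muleC fineK; last first.
      by rewrite fin_num_measure//; exact: mqB.
    by congr (_%:E * _); apply: eq_bigr => i iK; rewrite EB.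
have := claim n (leqnn n) (fun=> setT) (fun=> measurableT).
rewrite (eq_bigr e); last by move=> i _; rewrite /E ltn_ord.
move=> <-; apply: eq_integral => w _; congr EFin; apply: eq_bigr => i _.
by rewrite /F ltn_ord.
Qed.

End IndependentProducts.

(** * Nets of the unit ball and quadratic forms *)

Section BallNet.
Context {R : realType}.

Lemma sum_geometric_le n : \sum_(k < n) (2^-1 : R) ^+ k <= 2.
Proof.
have h : \sum_(k < n) (2^-1 : R) ^+ k = 2 - 2 * 2^-1 ^+ n.
  elim: n => [|n IH]; first by rewrite big_ord0 expr0; lra.
  by rewrite big_ord_recr /= IH exprS; field.
by rewrite h gerBl mulr_ge0// exprn_ge0// invr_ge0.
Qed.

(* The net consists of the points of a grid of mesh 1 / (4 sqrt m) that lie in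
   the ball, a coordinate being coded by its absolute value and its sign. *)
Lemma ball_net m : (0 < m)%N -> exists N : seq 'cV[R]_m,
  [/\ (size N)%:R <= 2 ^+ (18 * m) :> R,
      forall v, v \in N -> sqn v <= 1 &
      forall u : 'cV[R]_m, sqn u <= 1 -> exists2 v, v \in N & sqn (u - v) <= 1 / 16].
Proof.
move=> m0.
pose C : finType := ('I_(4 * m).+1 * bool)%type.
pose good := [set f : {ffun 'I_m -> C} | (\sum_i (f i).1 ^ 2 <= 16 * m)%N]%SET.
pose h : R := (4 * Num.sqrt m%:R)^-1.
have sm0 : 0 < Num.sqrt m%:R :> R by rewrite sqrtr_gt0 ltr0n.
have sm2 : Num.sqrt m%:R ^+ 2 = m%:R :> R by rewrite sqr_sqrtr.
have h0 : 0 < h by rewrite invr_gt0 mulr_gt0.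
have h2 : 16 * m%:R * h ^+ 2 = 1.
  by rewrite -sm2 /h; field; rewrite gt_eqF.
pose vec (f : {ffun 'I_m -> C}) : 'cV[R]_m := \col_i ((-1) ^+ (f i).2 * ((f i).1%:R * h)).
exists [seq vec f | f <- enum good]; split.
- rewrite size_map -cardE.
  have -> : #|good|%:R = \sum_(f in good) 1 :> R by rewrite sumr_const.
  (* Weighted count: on [good] the product of the weights is at least 1, because the sum of the k_i
     is at most that of the k_i^2, hence at most 16 m. So the cardinality is at most the product
     over coordinates of the total weight, which is at most 2^16 times 2 (geometric series) times 2
     (signs). *)
  pose w (c : C) : R := 2 ^+ 16 * 2^-1 ^+ c.1.
  have w0 c : 0 <= w c by rewrite mulr_ge0 ?exprn_ge0 ?invr_ge0.
  have -> : 2 ^+ (18 * m) = \prod_(i < m) 2 ^+ 18 :> R.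
    by rewrite prodr_const card_ord -exprM.
  have h1 : \prod_(i < m) \sum_(c : C) w c <= \prod_(i < m) 2 ^+ 18.
    apply: ler_prod => i _; rewrite sumr_ge0//=.
    have -> : \sum_c w c = \sum_(k < (4 * m).+1) \sum_(b : bool) 2 ^+ 16 * (2^-1 : R) ^+ k.
      by rewrite pair_big.
    under eq_bigr do rewrite sumr_const card_bool.
    rewrite sumrMnl -mulr_sumr -mulrnAr (exprD 2 16 2) ler_wpM2l ?exprn_ge0//.
    by have := sum_geometric_le (4 * m).+1; rewrite expr2; lra.
  apply: le_trans h1; rewrite bigA_distr_bigA /=.
  rewrite [X in _ <= X](bigID (mem good))/= -[X in X <= _]addr0 lerD//; last first.
    by rewrite sumr_ge0// => f _; rewrite prodr_ge0.
  apply: ler_sum => f; rewrite inE => fg.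
  rewrite /w big_split /= prodr_const card_ord -exprM -(big_morph _ (exprD _) (expr0 _)).
  rewrite exprVn ler_pdivlMr ?exprn_gt0// mul1r ler_weXn2l//; first by lra.
  apply: leq_trans fg; apply: leq_sum => i _.
  by case: (nat_of_ord _) => // k; rewrite -mulnn leq_pmulr.
- move=> _ /mapP[f + ->]; rewrite mem_enum inE => fg.
  rewrite /sqn /dot -h2.
  under eq_bigr => i _.
    rewrite !mxE -expr2 exprMn sqrr_sign mul1r exprMn -natrX.
    over.
  rewrite -mulr_suml ler_pM2r ?exprn_gt0// -natr_sum -natrM ler_nat.
  exact: fg.
- move=> u u1.
  have ui i : u i 0 ^+ 2 <= 1.
    apply: le_trans u1; rewrite /sqn /dot (bigD1 i)//= -expr2 lerDl sumr_ge0// => j _.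
    by rewrite -expr2 sqr_ge0.
  (* Rounding towards 0 keeps the point in the ball; an error of at most [h] per coordinate adds up
     to m h^2 = 1/16. *)
  pose k i := Num.truncn (`|u i 0| / h).
  have uh i : 0 <= `|u i 0| / h by rewrite divr_ge0// ltW.
  have kle i : (k i)%:R * h <= `|u i 0|.
    by rewrite -ler_pdivlMr// truncn_le.
  have kgt i : `|u i 0| < (k i).+1%:R * h.
    by rewrite -ltr_pdivrMr// truncnS_gt.
  have k4 i : (k i < (4 * m).+1)%N.
    rewrite ltnS -(ler_nat R); apply: (@le_trans _ _ (`|u i 0| / h)).
      by rewrite truncn_le.
    have u1i : `|u i 0| <= 1 by rewrite -(@ler_pXn2r _ 2)// ?nnegrE// expr1n real_normK ?num_real.
    rewrite /h invrK natrM; apply: (@le_trans _ _ (4 * Num.sqrt m%:R)).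
      by rewrite -[X in _ <= X]mul1r ler_wpM2r// mulr_ge0// ltW.
    rewrite ler_wpM2l// -[X in _ <= X]sm2 expr2 -[X in X <= _]mulr1 ler_wpM2l ?(ltW sm0)//.
    by have := @ler_wsqrtr R 1 m%:R; rewrite sqrtr1 ler1n; apply.
  pose f : {ffun 'I_m -> C} := [ffun i => (Ordinal (k4 i), u i 0 < 0)].
  have fi i : vec f i 0 = (-1) ^+ (u i 0 < 0)%R * ((k i)%:R * h) by rewrite mxE ffunE.
  exists (vec f).
    apply: map_f; rewrite mem_enum inE -(ler_nat R) natrM natr_sum.
    rewrite -(ler_pM2r (exprn_gt0 2 h0)) h2 mulr_suml; apply: le_trans u1.
    apply: ler_sum => i _; rewrite ffunE /= natrX -exprMn -expr2.
    by rewrite -[X in _ <= X]real_normK ?num_real// ler_pXn2r ?nnegrE// mulr_ge0// ltW.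
  have -> : 1 / 16 = \sum_(i < m) h ^+ 2.
    by rewrite sumr_const card_ord -mulr_natl; move: h2; lra.
  apply: ler_sum => i _; rewrite -expr2 mxE mxE fi.
  have : `|u i 0 - (-1) ^+ (u i 0 < 0)%R * ((k i)%:R * h)| <= h.
    have := kle i; have := kgt i; rewrite -natr1 mulrDl mul1r.
    case: (ltrP (u i 0) 0) => [un|up]; rewrite ?(ltr0_norm un) ?(ger0_norm up) /= ?expr1 ?expr0 => a b;
      rewrite ler_norml; apply/andP; split; lra.
  by move=> h3; rewrite -[X in X <= _]real_normK ?num_real// ler_pXn2r ?nnegrE// ltW.
Qed.

(** Let s be the supremum of |q| on the ball. For a net point v near u, q u - q v = <u - v, M (u +
    v)> is at most 0.51 s in absolute value, whence s <= c + 0.51 s and s <= 3 c. *)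
Lemma quad_form_net m (N : seq 'cV[R]_m) (M : 'M[R]_m) c :
  M^T = M ->
  (forall u : 'cV[R]_m, sqn u <= 1 -> exists2 v, v \in N & sqn (u - v) <= 1 / 16) ->
  (forall v, v \in N -> sqn v <= 1) ->
  (forall v, v \in N -> `|dot v (M *m v)| <= c) ->
  forall u, `|dot u (M *m u)| <= 3 * c * sqn u.
Proof.
move=> Ms Ncov N1 Nc.
pose q u := dot u (M *m u).
have qD x y : dot x (M *m y) = (q (x + y) - q (x - y)) / 4.
  have xy : dot y (M *m x) = dot x (M *m y) by rewrite dot_mulmx Ms dotC.
  by rewrite /q mulmxDr mulmxBr !dotE xy; field.
pose A := [set `|q u| | u in [set u | sqn u <= 1]]%classic.
have ubA : has_sup A.
  split; first by exists `|q 0|, 0 => //; rewrite /= /sqn /dot big1// => i _; rewrite mxE mul0r.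
  exists (1 + fro M) => _ [u /= u1 <-].
  have h1 := dot_CS u (M *m u); have h2 := sqn_le_fro M u.
  have f0 := fro_ge0 M; have s0 := sqn_ge0 u; have s1 := sqn_ge0 (M *m u).
  rewrite -(@ler_pXn2r _ 2)// ?nnegrE ?addr_ge0// real_normK ?num_real// /q.
  apply: (le_trans h1).
  have h3 : sqn u * sqn (M *m u) <= 1 * (fro M * 1).
    by apply: ler_pM => //; apply: (le_trans h2); rewrite ler_wpM2l.
  apply: (le_trans h3); nra.
pose s := sup A.
have sup_le u : sqn u <= 1 -> `|q u| <= s.
  by move=> u1; apply: sup_upper_bound => //; exists u.
have scale u : `|q u| <= s * sqn u.
  have [/eqP u0|u0] := boolP (sqn u == 0).
    by rewrite /q (sqn_eq0 u0) mulmx0 /dot big1 ?normr0 ?/sqn ?/dot ?big1 ?mulr0// => i _; rewrite mxE mul0r.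
  have up : 0 < sqn u by rewrite lt_def u0 sqn_ge0.
  have sp : 0 < Num.sqrt (sqn u) by rewrite sqrtr_gt0.
  have s2 : Num.sqrt (sqn u) ^+ 2 = sqn u by rewrite sqr_sqrtr ?sqn_ge0.
  have := sup_le ((Num.sqrt (sqn u))^-1 *: u).
  rewrite sqnZ exprVn s2 mulVf// lexx => /(_ isT).
  rewrite /q -scalemxAr !dotE mulrA -expr2 exprVn s2 normrM ger0_norm ?invr_ge0 ?sqn_ge0//.
  by rewrite mulrC ler_pdivrMr.
have s0 : 0 <= s.
  have h0 : @sqn R m 0 = 0 by rewrite /sqn /dot big1// => i _; rewrite mxE mul0r.
  by apply: le_trans (sup_le 0 _); rewrite ?h0.
(* The weights balance |x|^2 <= 1/16 against |y|^2 <= 4, as 9/16 + 4/9 < 102/100. The optimal weight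
   is 8; 9 is a nearby square, so that x and y are scaled by 3 and 1/3. *)
have bil x y : `|dot x (M *m y)| <= s / 2 * (9 * sqn x + sqn y / 9).
  have -> : dot x (M *m y) = dot (3 *: x) (M *m (3^-1 *: y)).
    by rewrite -scalemxAr dotZl dotZr; field.
  rewrite qD normrM (ger0_norm (x := 4^-1)) ?invr_ge0//.
  have h1 := scale (3 *: x + 3^-1 *: y); have h2 := scale (3 *: x - 3^-1 *: y).
  have h3 := ler_normB (q (3 *: x + 3^-1 *: y)) (q (3 *: x - 3^-1 *: y)).
  rewrite !sqnD !sqnN !sqnZ !dotE in h1 h2; move: h1 h2 h3; rewrite !expr2; lra.
have key u : sqn u <= 1 -> `|q u| <= c + 51 / 100 * s.
  move=> u1; have [v vN uv] := Ncov u u1.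
  have qE : q u = q v + dot (u - v) (M *m (u + v)).
    have xy : dot v (M *m u) = dot u (M *m v) by rewrite dot_mulmx Ms dotC.
    by rewrite /q mulmxDr !dotE xy; ring.
  rewrite qE; apply: (le_trans (ler_normD _ _)); rewrite lerD ?Nc//.
  apply: (le_trans (bil _ _)).
  have h1 := sqn_add_le u v; have h2 := N1 v vN.
  have : 9 * sqn (u - v) + sqn (u + v) / 9 <= 102 / 100 by lra.
  by move=> /(ler_wpM2l s0); lra.
have sc : s <= c + 51 / 100 * s.
  apply: ge_sup; first by case: ubA.
  by move=> _ [u /= u1 <-]; exact: key.
move=> u; apply: (le_trans (scale u)); rewrite ler_wpM2r ?sqn_ge0//; lra.
Qed.

End BallNet.

(** * Moment generating functions of sub-exponential variables *)

Section SubExponential.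
Local Open Scope ereal_scope.
Context {disp : measure_display} {T : measurableType disp} {R : realType}.
Variable P : probability T R.

Definition independent_family n (q : 'I_n -> T -> R) : Prop :=
  forall B : 'I_n -> set R, (forall i, measurable (B i)) ->
    P (\bigcap_(i in [set: 'I_n]) (q i @^-1` B i)) =
    \prod_(i < n) P (q i @^-1` B i).

Lemma independent_family_comp n (q : 'I_n -> T -> R) (g : R -> R) :
  measurable_fun setT g -> independent_family q ->
  independent_family (fun i w => g (q i w)).
Proof.
move=> mg indq B mB.
apply: (indq (fun i => g @^-1` B i)) => i.
by rewrite -[_ @^-1` _]setTI; apply: mg.
Qed.

Lemma expR_le_quad (x : R) : (expR x <= 1 + x + x ^+ 2 * expR `|x|)%R.
Proof.
have h1 : (expR x - 1 <= x * expR x)%R.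
  have := expR_ge1Dx (- x)%R; rewrite expRN => h.
  have e0 := expR_gt0 x.
  have : ((1 + - x) * expR x <= 1)%R by rewrite -ler_pdivlMr// mul1r.
  lra.
have [x0|x0] := leP 0%R x.
  rewrite ger0_norm//; have := ler_wpM2l x0 h1; have := h1; rewrite expr2; lra.
have e1 : (1 <= expR `|x|)%R by rewrite -expR0 ler_expR.
have := ler_wpM2l (sqr_ge0 x) e1.
have h2 := expR_ge1Dx x; have : (0 <= - x)%R by lra.
move=> /ler_wpM2l /(_ _ _ h2); rewrite expr2; move: h1; nra.
Qed.

Lemma sqr_le_expR (y : R) : (0 <= y -> y ^+ 2 <= 4 * expR y)%R.
Proof.
move=> y0; have h := expR_ge1Dx (y / 2)%R.
have : ((y / 2) ^+ 2 <= expR (y / 2) ^+ 2)%R.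
  by rewrite ler_pXn2r ?nnegrE ?expR_ge0 ?divr_ge0//; lra.
rewrite expr2 expr2 -expRD -mulrDl; rewrite (_ : ((y + y) / 2 = y)%R); last by field.
rewrite expr2; lra.
Qed.

(** The right-hand side is affine in [q] plus a multiple of exp(q/K), so integrating it requires
    only E q = 1 and E exp(q/K) <= 2. With y = (q + 1) / (4K), the quadratic remainder is at most 64
    K^2 s^2 exp(2y), and exp(2y) <= exp(1/2) exp(q/K) doubles the constant. *)
Lemma mgf_pointwise (q K s : R) : (0 <= q -> 1 <= K -> `|s| <= 1 / (4 * K) ->
  expR (s * (q - 1)) <= (1 - s) + s * q + 128 * K ^+ 2 * s ^+ 2 * expR (q / K))%R.
Proof.
move=> q0 K1 sK; have K0 : (0 < K)%R by lra.
set x := (s * (q - 1))%R; set y := ((q + 1) / (4 * K))%R.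
have y0 : (0 <= y)%R by rewrite /y divr_ge0//; lra.
have xy : (`|x| <= y)%R.
  rewrite /x /y normrM mulrC; apply: ler_pM => //; first by rewrite ler_norml; apply/andP; split; lra.
  by move: sK; rewrite div1r.
have h1 := expR_le_quad x.
have h2 : (x ^+ 2 <= s ^+ 2 * (16 * K ^+ 2 * (4 * expR y)))%R.
  have e1 : (x ^+ 2 <= s ^+ 2 * (q + 1) ^+ 2)%R.
    by rewrite /x exprMn ler_wpM2l ?sqr_ge0// !expr2; nra.
  apply: (le_trans e1); rewrite ler_wpM2l ?sqr_ge0//.
  have -> : ((q + 1) ^+ 2 = 16 * K ^+ 2 * y ^+ 2)%R by rewrite /y; field; rewrite gt_eqF.
  by rewrite ler_wpM2l ?sqr_le_expR// mulr_ge0// sqr_ge0.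
have h3 : (x ^+ 2 * expR `|x| <= s ^+ 2 * (16 * K ^+ 2 * (4 * expR y)) * expR y)%R.
  by apply: ler_pM => //; rewrite ?sqr_ge0 ?expR_ge0// ler_expR.
have h4 : (expR y * expR y <= 2 * expR (q / K))%R.
  rewrite -expRD.
  have e2 : (expR (2^-1) <= 2 :> R)%R.
    have := expR_ge1Dx (- 2^-1 : R)%R; rewrite expRN => e.
    have e0 := @expR_gt0 R (2^-1)%R.
    have : ((1 + - 2^-1) * expR (2^-1) <= 1 :> R)%R by rewrite -ler_pdivlMr// mul1r.
    lra.
  apply: (@le_trans _ _ (expR (2^-1) * expR (q / K))%R); last by rewrite ler_wpM2r// expR_ge0.
  rewrite -expRD ler_expR /y.
  have iK : (K^-1 <= 1)%R by rewrite invf_le1.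
  have iK0 : (0 < K^-1)%R by rewrite invr_gt0.
  have -> : ((q + 1) / (4 * K) + (q + 1) / (4 * K) = (q * K^-1 + K^-1) / 2)%R by field; rewrite gt_eqF.
  have := mulr_ge0 q0 (ltW iK0); lra.
apply: (le_trans h1); rewrite /x.
have h5 := ler_wpM2l (mulr_ge0 (sqr_ge0 s) (sqr_ge0 K)) h4.
move: h3; rewrite /x; lra.
Qed.

Variable K : R.

(** Mean one and exponential Orlicz norm at most [K], the class to which squared unit-variance
    projections of the covariates belong. *)
Definition unit_subexp (q : T -> R) : Prop :=
  [/\ measurable_fun setT q, forall w, (0 <= q w)%R, \int[P]_w (q w)%:E = 1%:E &
      \int[P]_w (expR (q w / K))%:E <= 2%:E].

Lemma measurable_expR_comp (q : T -> R) : measurable_fun setT q ->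
  measurable_fun setT (fun w => expR (q w)).
Proof. by move=> mq; apply: measurableT_comp. Qed.

Lemma integrable_ge0_lty (f : T -> R) : measurable_fun setT f ->
  (forall w, 0 <= f w)%R -> \int[P]_w (f w)%:E < +oo -> P.-integrable setT (EFin \o f).
Proof.
move=> mf f0 fy; apply/integrableP; split; first exact/measurable_EFinP.
by under eq_integral do rewrite /= ger0_norm//.
Qed.

(** Integrate 1 + q/K <= exp(q/K) to get 1 + 1/K <= 2. *)
Lemma unit_subexp_ge1 (q : T -> R) : (0 < K)%R -> unit_subexp q -> (1 <= K)%R.
Proof.
move=> K0 [mq q0 q1 qK].
have h : \int[P]_w (1 + q w / K)%:E <= \int[P]_w (expR (q w / K))%:E.
  apply: ge0_le_integral => //.
  - by move=> w _; rewrite lee_fin addr_ge0// divr_ge0// ltW.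
  - by apply/measurable_EFinP; apply: measurable_funD => //; apply: measurable_funM.
  - by apply/measurable_EFinP; apply: measurable_expR_comp; apply: measurable_funM.
  - by move=> w _; rewrite lee_fin expR_ge1Dx.
have E : \int[P]_w (1 + q w / K)%:E = (1 + K^-1)%:E.
  under eq_integral do rewrite EFinD EFinM.
  rewrite ge0_integralD//.
  - rewrite integral_cst//= probability_setT mule1 ge0_integralZr//.
    + by rewrite q1 mul1e.
    + exact/measurable_EFinP.
    + by move=> w _; rewrite lee_fin.
    + by rewrite lee_fin invr_ge0 ltW.
  - by move=> w _; rewrite -EFinM lee_fin divr_ge0// ltW.
  - by under eq_fun do rewrite -EFinM; apply/measurable_EFinP; apply: measurable_funM.
rewrite E in h; have := le_trans h qK; rewrite lee_fin => h2.
by rewrite -invf_le1//; lra.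
Qed.

Lemma mgf_unit_subexp (q : T -> R) s : (0 < K)%R -> unit_subexp q ->
  (`|s| <= 1 / (4 * K))%R ->
  \int[P]_w (expR (s * (q w - 1)))%:E <= (expR (256 * K ^+ 2 * s ^+ 2))%:E.
Proof.
move=> K0 uq sK; have K1 := unit_subexp_ge1 K0 uq; case: uq => mq q0 q1 qK.
pose c := (128 * K ^+ 2 * s ^+ 2)%R.
have c0 : (0 <= c)%R by rewrite mulr_ge0 ?sqr_ge0// mulr_ge0 ?sqr_ge0.
have mqK : measurable_fun setT (fun w => expR (q w / K)) by apply: measurable_expR_comp; apply: measurable_funM.
have iq : P.-integrable setT (EFin \o q) by apply: integrable_ge0_lty => //; rewrite q1 ltry.
have ie : P.-integrable setT (EFin \o (fun w => expR (q w / K))).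
  apply: integrable_ge0_lty => //.
  exact: (le_lt_trans qK (ltry _)).
apply: (@le_trans _ _ (\int[P]_w ((1 - s) + s * q w + c * expR (q w / K))%:E)).
  apply: ge0_le_integral => //.
  - by apply/measurable_EFinP; apply: measurable_expR_comp; apply: measurable_funM => //; apply: measurable_funB.
  - apply/measurable_EFinP; apply: measurable_funD; first by apply: measurable_funD => //; apply: measurable_funM.
    exact: measurable_funM.
  - by move=> w _; rewrite lee_fin; apply: mgf_pointwise.
under eq_integral do rewrite EFinD EFinD !EFinM.
have i1 : P.-integrable setT (fun w => s%:E * (q w)%:E) by exact: (integrableZl measurableT s iq).
have i2 : P.-integrable setT (fun w => c%:E * (expR (q w / K))%:E) by exact: (integrableZl measurableT c ie).
have i0 : P.-integrable setT (fun w : T => (1 - s)%:E) by exact: finite_measure_integrable_cst.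
rewrite integralD//; last exact: integrableD.
rewrite integralD// integral_cst//= probability_setT mule1.
rewrite integralZl// q1 mule1 integralZl//.
apply: (@le_trans _ _ ((1 - s)%:E + s%:E + c%:E * 2%:E)).
  by rewrite leeD2l// lee_wpmul2l.
rewrite -EFinM -!EFinD lee_fin.
by apply: le_trans (expR_ge1Dx _); rewrite /c; lra.
Qed.

End SubExponential.

(** * Bernstein's inequality *)

Section Bernstein.
Local Open Scope ereal_scope.
Context {disp : measure_display} {T : measurableType disp} {R : realType}.
Variable P : probability T R.

Lemma markov_ge0 (Y : T -> R) (M a : R) : measurable_fun setT Y ->
  (forall w, 0 <= Y w)%R -> (0 < a)%R -> \int[P]_w (Y w)%:E <= M%:E ->
  P [set w | (a <= Y w)%R] <= (M / a)%:E.
Proof.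
move=> mY Y0 a0 YM.
have mA : measurable [set w | (a <= Y w)%R].
  have := @measurable_fun_ler _ _ R setT (cst a) Y (measurable_cst _) mY measurableT [set true] I.
  by rewrite setTI.
have h : a%:E * P [set w | (a <= Y w)%R] <= M%:E.
  apply: le_trans YM.
  rewrite -(setIT [set _ | _]) -integral_indic// -ge0_integralZl//; last first.
  - by rewrite lee_fin ltW.
  - by apply/measurable_EFinP; exact: measurable_indic.
  apply: ge0_le_integral => //.
  - by move=> w _; rewrite -EFinM lee_fin mulr_ge0// ltW.
  - under eq_fun do rewrite -EFinM; apply/measurable_EFinP.
    by apply: measurable_funM; [exact: measurable_cst|exact: measurable_indic].
  - exact/measurable_EFinP.
  - move=> w _; rewrite -EFinM lee_fin indicE; case: (boolP (w \in _)).
      by rewrite inE /= mulr1.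
    by rewrite mulr0.
rewrite -(@lee_pmul2l _ a%:E)//; apply: (le_trans h).
by rewrite -EFinM mulrC divfK// gt_eqF.
Qed.

Lemma expectation_prod_le n (q : 'I_n -> T -> R) (b : R) :
  (forall i, measurable_fun setT (q i)) -> (forall i w, 0 <= q i w)%R ->
  independent_family P q -> (forall i, \int[P]_w (q i w)%:E <= b%:E) ->
  \int[P]_w (\prod_(i < n) q i w)%:E <= (b ^+ n)%:E.
Proof.
move=> mq q0 indq qb.
have E0 i : 0 <= \int[P]_w (q i w)%:E by apply: integral_ge0 => w _; rewrite lee_fin.
have Efin i : \int[P]_w (q i w)%:E \is a fin_num.
  by rewrite ge0_fin_numE// (le_lt_trans (qb i))// ltry.
rewrite (@expectation_prod_indep _ _ _ P n q (fun i => fine (\int[P]_w (q i w)%:E)))//; last first.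
  by move=> i; rewrite fineK.
rewrite lee_fin -[n in (b ^+ n)%R]card_ord -prodr_const; apply: ler_prod => i _.
by rewrite fine_ge0//= -lee_fin fineK.
Qed.

Variable K : R.
Hypothesis K0 : (0 < K)%R.

Lemma bernstein_side n (q : 'I_n -> T -> R) (e sg : R) :
  independent_family P q -> (forall i, unit_subexp P K (q i)) ->
  (0 < e <= 1)%R -> (sg ^+ 2 = 1)%R -> (1 <= K)%R ->
  P [set w | (n%:R * e <= sg * \sum_(i < n) (q i w - 1))%R]
    <= (expR (- (e ^+ 2 * n%:R / (1024 * K ^+ 2))))%:E.
Proof.
move=> indq uq /andP[e0 e1] sg2 K1.
(* Up to the sign, the minimiser of 256 K^2 s^2 - s e; the minimum - e^2 / (1024 K^2) is the final
   exponent. *)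
pose s := (sg * e / (512 * K ^+ 2))%R.
have K20 : (0 < K ^+ 2)%R by rewrite exprn_gt0.
have sg1 : (`|sg| = 1)%R.
  by apply/eqP; rewrite -(@eqrXn2 _ 2)//; rewrite real_normK ?num_real// expr1n sg2.
have sK : (`|s| <= 1 / (4 * K))%R.
  rewrite div1r /s !normrM sg1 mul1r (ger0_norm (ltW e0)) ger0_norm; last by rewrite invr_ge0; lra.
  rewrite ler_pdivrMr; last by lra.
  have -> : ((4 * K)^-1 * (512 * K ^+ 2) = 128 * K)%R by field; rewrite gt_eqF.
  lra.
have mq i : measurable_fun setT (q i) by case: (uq i).
pose c := (e ^+ 2 / (512 * K ^+ 2))%R.
pose Y w : R := (\prod_(i < n) expR (s * (q i w - 1)))%R.
have mg : measurable_fun setT (fun x : R => expR (s * (x - 1))).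
  by apply: measurableT_comp => //; apply: measurable_funM => //; apply: measurable_funB.
have YE w : Y w = expR (s * \sum_(i < n) (q i w - 1)).
  by rewrite /Y mulr_sumr expR_sum.
have EY : \int[P]_w (Y w)%:E <= (expR (256 * K ^+ 2 * s ^+ 2) ^+ n)%:E.
  apply: expectation_prod_le => //.
  - by move=> i; apply: (measurableT_comp mg (mq i)).
  - exact: (independent_family_comp mg indq).
  - by move=> i; apply: mgf_unit_subexp.
have mY : measurable_fun setT Y.
  by apply: measurable_prod => i _; apply: (measurableT_comp mg (mq i)).
have Y0 w : (0 <= Y w)%R by rewrite YE expR_ge0.
have K512 : (0 < 512 * K ^+ 2)%R by lra.
have := markov_ge0 mY Y0 (expR_gt0 (c * n%:R)) EY.
have -> : [set w | (n%:R * e <= sg * \sum_(i < n) (q i w - 1))%R] =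
   [set w | (expR (c * n%:R) <= Y w)%R].
  apply/seteqP; split=> w /=; rewrite YE ler_expR /s /c => h.
    have := ler_wpM2l (ltW (divr_gt0 e0 K512)) h.
    move: (\sum_(i < n) _)%R => S.
    by rewrite expr2; move: ((512 * K ^+ 2)^-1)%R => k; lra.
  have k0 : (0 < e / (512 * K ^+ 2))%R by exact: divr_gt0.
  rewrite -(ler_pM2l k0); move: h; move: (\sum_(i < n) _)%R => S.
  by rewrite expr2; move: ((512 * K ^+ 2)^-1)%R => k; lra.
move=> /le_trans; apply; rewrite lee_fin -expRM_natl -expRN -expRD ler_expR.
rewrite /s /c !exprMn sg2 exprVn -mulr_natl le_eqVlt; apply/orP; left; apply/eqP.
by field; rewrite gt_eqF.
Qed.

Lemma bernstein n (q : 'I_n -> T -> R) (e : R) :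
  independent_family P q -> (forall i, unit_subexp P K (q i)) ->
  (0 < e <= 1)%R -> (0 < n)%N ->
  P [set w | (n%:R * e < `|\sum_(i < n) (q i w - 1)|)%R]
    <= (2 * expR (- (e ^+ 2 * n%:R / (1024 * K ^+ 2))))%:E.
Proof.
move=> indq uq e01 n0.
have K1 := unit_subexp_ge1 K0 (uq (Ordinal n0)).
have h1 := bernstein_side indq uq e01 (expr1n _ 2) K1.
have h2 := bernstein_side (sg := -1) indq uq e01 (etrans (sqrrN 1) (expr1n _ 2)) K1.
have mS : measurable_fun setT (fun w => \sum_(i < n) (q i w - 1))%R.
  by apply: measurable_sum => i; apply: measurable_funB => //; case: (uq i).
have mA (sg : R) : measurable [set w | (n%:R * e <= sg * \sum_(i < n) (q i w - 1))%R].
  have := @measurable_fun_ler _ _ R setT (cst (n%:R * e)%R) (fun w => sg * \sum_(i < n) (q i w - 1))%R (measurable_cst _).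
  move=> /(_ (measurable_funM (measurable_cst _) mS) measurableT [set true] I).
  by rewrite setTI.
apply: (@le_trans _ _ (P ([set w | (n%:R * e <= 1 * \sum_(i < n) (q i w - 1))%R] `|`
   [set w | (n%:R * e <= -1 * \sum_(i < n) (q i w - 1))%R]))).
  apply: le_measure; rewrite ?inE.
  - have := @measurable_fun_ltr _ _ R setT (cst (n%:R * e)%R) (fun w => `|\sum_(i < n) (q i w - 1)|)%R (measurable_cst _).
    move=> /(_ (measurableT_comp (@normr_measurable R setT) mS) measurableT [set true] I).
    by rewrite setTI.
  - exact: measurableU.
  - move=> w /=; rewrite lter_normr => /orP[h|h]; [left|right]; rewrite ?mul1r ?mulN1r ltW//.
apply: (le_trans (measureU2 _ (mA _) (mA _))).
rewrite mulr2n mulrDl mul1r EFinD; exact: leeD.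
Qed.

End Bernstein.

(** * The random design *)

Section BorelMx.
Context {R : realType}.

Definition coord_sets m n : set (set 'M[R]_(m, n)) :=
  [set A | exists (i : 'I_m) (j : 'I_n) (B : set R),
     measurable B /\ A = [set M : 'M[R]_(m, n) | B (M i j)]].

(* Its measurable sets are, definitionally, those of borel_mx. *)
Definition mxT m n := g_sigma_algebraType (@coord_sets m n).

Lemma measurable_coord m n i j : measurable_fun setT (fun M : mxT m n => M i j : R).
Proof.
move=> _ B mB; rewrite setTI; apply: sub_sigma_algebra.
by exists i, j, B.
Qed.

Context {disp : measure_display} {T : measurableType disp}.

Lemma random_mxP m n (Z : T -> 'M[R]_(m, n)) :
  random_mx Z <-> measurable_fun setT (Z : T -> mxT m n).
Proof.
split=> [h _ B mB|h _ [B mB <-]]; last exact: h.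
by apply: h; exists B.
Qed.

Lemma measurable_entry m n (Z : T -> 'M[R]_(m, n)) i j :
  random_mx Z -> measurable_fun setT (fun w => Z w i j).
Proof.
by move=> /random_mxP mZ; apply: (measurableT_comp (measurable_coord i j)).
Qed.

Lemma measurable_mx m n (Z : T -> 'M[R]_(m, n)) :
  (forall i j, measurable_fun setT (fun w => Z w i j)) ->
  measurable_fun setT (Z : T -> mxT m n).
Proof.
move=> mZ; apply: (@measurability _ _ _ (mxT m n) setT Z (@coord_sets m n)) => //.
move=> _ [_ [i [j [B [mB ->]]]] <-].
exact: mZ.
Qed.

End BorelMx.

(** * Second and exponential moments of projections of a covariate *)

Section ModelMoments.
Context {disp : measure_display} {T : measurableType disp} {R : realType}.
Variable P : probability T R.
Context {n p : nat}.
Variables (theta lam : 'cV[R]_p) (sigma sigma_x : R).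
Variables (x : 'I_n -> T -> 'cV[R]_p) (eps y : 'I_n -> T -> R).
Hypothesis model : regression_model P theta lam sigma sigma_x x eps y.
Hypothesis lam0 : forall j, 0 < lam j 0.

Lemma model_mxj i j : measurable_fun setT (fun w => x i w j 0).
Proof. by apply: measurable_entry; apply: (model_x_measurable model). Qed.

Lemma measurable_dot_mx p' (a : 'cV[R]_p') :
  measurable_fun setT (fun M : mxT p' 1 => dot a M : R).
Proof.
rewrite /dot; apply: measurable_sum => j.
by apply: measurable_funM => //; exact: measurable_coord.
Qed.

Lemma model_mdot i (a : 'cV[R]_p) : measurable_fun setT (fun w => dot a (x i w)).
Proof.
apply: (measurableT_comp (measurable_dot_mx a)).
by apply/random_mxP; apply: (model_x_measurable model).
Qed.

Lemma model_x_second i j k :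
  (\int[P]_w (x i w j 0 * x i w k 0)%:E = (if j == k then lam j 0 else 0)%:E)%E.
Proof.
have := model_x_var model i j k; rewrite unlock !(model_x_mean model) /= unlock.
rewrite mxE mxE => h.
have -> : (if j == k then lam j 0 else 0) = lam j 0 *+ (j == k) by case: eqP.
rewrite -h; apply: eq_integral => w _; congr EFin.
by rewrite /= /cst !fctE/= !subr0.
Qed.

Lemma model_x_sqr_integrable i j : P.-integrable setT (EFin \o (fun w => x i w j 0 ^+ 2)).
Proof.
apply: integrable_ge0_lty.
- by apply: measurable_funX; exact: model_mxj.
- by move=> w; rewrite sqr_ge0.
- under eq_integral do rewrite expr2.
  by rewrite model_x_second eqxx ltry.
Qed.

Lemma model_x_mul_integrable i j k :
  P.-integrable setT (EFin \o (fun w => x i w j 0 * x i w k 0)).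
Proof.
apply: (@le_integrable _ _ _ _ setT _ _ (EFin \o (fun w => x i w j 0 ^+ 2 + x i w k 0 ^+ 2))) => //.
- by apply/measurable_EFinP; apply: measurable_funM; exact: model_mxj.
- move=> w _ /=; rewrite lee_fin normrM.
  rewrite (ger0_norm (addr_ge0 (sqr_ge0 _) (sqr_ge0 _))).
  rewrite -(real_normK (num_real (x i w j 0))) -(real_normK (num_real (x i w k 0))).
  have := sqr_ge0 (`|x i w j 0| - `|x i w k 0|); have := normr_ge0 (x i w j 0); have := normr_ge0 (x i w k 0); nra.
- rewrite (_ : EFin \o _ = (EFin \o (fun w => x i w j 0 ^+ 2)%R) \+ (EFin \o (fun w => x i w k 0 ^+ 2)%R))%E.
    by apply: integrableD => //; exact: model_x_sqr_integrable.
  by apply/funext => w /=; rewrite EFinD.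
Qed.

(** The form a^T Sigma a, that is, the variance of <a, x_i>. *)
Definition cov_form (a : 'cV[R]_p) : R := \sum_j lam j 0 * a j 0 ^+ 2.

Lemma model_dot_sqr i a : (\int[P]_w (dot a (x i w) ^+ 2)%:E = (cov_form a)%:E)%E.
Proof.
have E w : ((dot a (x i w) ^+ 2)%:E =
    \sum_(j < p) \sum_(k < p) (a j 0 * a k 0)%R%:E * (x i w j 0 * x i w k 0)%R%:E)%E.
  rewrite expr2 {1}/dot mulr_suml -sumEFin; apply: eq_bigr => j _.
  rewrite /dot mulr_sumr -sumEFin; apply: eq_bigr => k _.
  by rewrite -EFinM; congr EFin; ring.
under eq_integral do rewrite E.
have ijk j k : P.-integrable setT (fun w => (a j 0 * a k 0)%R%:E * (x i w j 0 * x i w k 0)%R%:E)%E.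
  by apply: (integrableZl measurableT _ (model_x_mul_integrable i j k)).
rewrite integral_sum//; last by move=> j; apply: integrable_sum => // k _; exact: ijk.
rewrite /cov_form -sumEFin; apply: eq_bigr => j _.
rewrite integral_sum//.
rewrite (bigD1 j)//= big1 ?adde0 => [|k kj]; rewrite (integralZl measurableT (model_x_mul_integrable i _ _)) model_x_second.
  by rewrite eqxx -EFinM; congr EFin; ring.
by rewrite eq_sym (negPf kj) mule0.
Qed.

Let z i w := Diag (map_mx (fun l => (Num.sqrt l)^-1) lam) *m x i w.

Let zE i w j : z i w j 0 = (Num.sqrt (lam j 0))^-1 * x i w j 0.
Proof. by rewrite /z /Diag mul_diag_mx !mxE. Qed.

Lemma sigma_x_ge0 (i0 : 'I_n) (j0 : 'I_p) : 0 <= sigma_x.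
Proof.
rewrite -lee_fin -(model_subgaussian model i0).
apply: (@le_trans _ _ (psi2_norm P (fun w => (((delta_mx j0 0 : 'cV[R]_p)^T *m z i0 w) 0 0 / enorm (delta_mx j0 0 : 'cV[R]_p))))).
  by apply: le_ereal_inf_tmp => _ [t [t0 _] <-]; rewrite lee_fin ltW.
apply: ereal_sup_ubound; exists (delta_mx j0 0) => //=.
apply/eqP => /matrixP /(_ j0 0); rewrite !mxE !eqxx => /eqP.
by rewrite oner_eq0.
Qed.

Hypothesis sigma_x_gt0 : 0 < sigma_x.

Let K : R := 4 * sigma_x ^+ 2.
Let K0 : 0 < K. Proof. by rewrite mulr_gt0// exprn_gt0. Qed.

(** The level 2 sigma_x exceeds the infimum defining the norm, so some admissible t lies below it;
    replacing t^2 by K = (2 sigma_x)^2 only lowers the exponent. *)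
Lemma model_exp_unit i (s : 'cV[R]_p) : s != 0 ->
  (\int[P]_w (expR (((s^T *m z i w) 0 0 / enorm s) ^+ 2 / K))%:E <= 2%:E)%E.
Proof.
move=> s0; pose q w := (s^T *m z i w) 0 0 / enorm s.
have h : (psi2_norm P q < (2 * sigma_x)%:E)%E.
  apply: (@le_lt_trans _ _ sigma_x%:E); last by rewrite lte_fin; move: sigma_x_gt0; lra.
  rewrite -(model_subgaussian model i); apply: ereal_sup_ubound.
  by exists s.
have mq : measurable_fun setT q.
  apply: measurable_funM => //.
  rewrite (_ : (fun w => _) = fun w => \sum_j s j 0 * ((Num.sqrt (lam j 0))^-1 * x i w j 0)).
    by apply: measurable_sum => j; do 2 apply: measurable_funM => //; exact: model_mxj.
  by apply/funext => w; rewrite mxE; apply: eq_bigr => j _; rewrite mxE zE.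
move: h; rewrite /psi2_norm => /ereal_inf_lt [_ [t [t0 tq] <-]] tK.
apply: le_trans tq; rewrite unlock; apply: ge0_le_integral => //.
- by apply/measurable_EFinP; apply: measurable_expR_comp; apply: measurable_funM => //; exact: measurable_funX.
- by apply/measurable_EFinP; apply: measurable_expR_comp; apply: measurable_funM => //; exact: measurable_funX.
- move=> w _; rewrite lee_fin ler_expR ler_wpM2l ?sqr_ge0// lef_pV2 ?posrE ?exprn_gt0//.
  rewrite /K (_ : 4 * _ = (2 * sigma_x) ^+ 2); last by ring.
  by rewrite ler_pXn2r ?nnegrE ?(ltW t0) ?mulr_ge0 ?(ltW sigma_x_gt0)// -lee_fin ltW.
Qed.

(** In whitened coordinates <a, x> is <s, z> with s = Sigma^(1/2) a and |s|^2 = cov_form a <= 1, so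
    it is dominated by the normalised projection <s, z> / |s|. *)
Lemma model_exp_le i a : cov_form a <= 1 ->
  (\int[P]_w (expR (dot a (x i w) ^+ 2 / K))%:E <= 2%:E)%E.
Proof.
move=> a1; pose s : 'cV[R]_p := \col_j (Num.sqrt (lam j 0) * a j 0).
have sl j : Num.sqrt (lam j 0) != 0 by rewrite gt_eqF// sqrtr_gt0.
have sz w : (s^T *m z i w) 0 0 = dot a (x i w).
  by rewrite mxE; apply: eq_bigr => j _; rewrite zE !mxE; field.
have [/eqP s0|s0] := boolP (s == 0).
  under eq_integral => w _ do rewrite -sz s0 trmx0 mul0mx mxE expr0n /= mul0r expR0.
  by rewrite integral_cst//= probability_setT mule1 lee_fin; lra.
apply: le_trans (model_exp_unit i s0).
have es2 : enorm s ^+ 2 = cov_form a.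
  rewrite sqr_sqrtr; last by apply: sumr_ge0 => j _; rewrite sqr_ge0.
  by apply: eq_bigr => j _; rewrite mxE exprMn sqr_sqrtr// ltW.
have es0 : 0 < enorm s.
  rewrite lt_def sqrtr_ge0 andbT; apply: contra s0 => /eqP e0.
  have : cov_form a = 0 by rewrite -es2 e0 expr0n.
  move=> /eqP; rewrite psumr_eq0; last by move=> j _; rewrite mulr_ge0 ?sqr_ge0 ?(ltW (lam0 j)).
  move=> /allP h; apply/eqP/colP => j; rewrite !mxE.
  have := h j (mem_index_enum _); rewrite mulf_eq0 gt_eqF//= sqrf_eq0 => /eqP ->.
  by rewrite mulr0.
have mm c : measurable_fun setT (fun w => expR ((dot a (x i w) / c) ^+ 2 / K)).
  apply: measurable_expR_comp; apply: measurable_funM => //; apply: measurable_funX.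
  by apply: measurable_funM => //; exact: model_mdot.
apply: ge0_le_integral => //.
- by apply/measurable_EFinP; under eq_fun do rewrite -[dot a _]divr1; exact: mm.
- by under eq_fun do rewrite sz; apply/measurable_EFinP; exact: mm.
- move=> w _; rewrite lee_fin ler_expR ler_wpM2r ?invr_ge0 ?(ltW K0)// sz expr_div_n es2.
  by rewrite ler_pdivlMr ?ler_piMr ?sqr_ge0// -es2 exprn_gt0.
Qed.

End ModelMoments.

(** * Whitened blocks and mixtures of squared projections *)

Section Events.
Context {disp : measure_display} {T : measurableType disp} {R : realType}.
Variable P : probability T R.
Context {n p : nat}.
Variables (theta lam : 'cV[R]_p) (sigma sigma_x : R).
Variables (x : 'I_n -> T -> 'cV[R]_p) (eps y : 'I_n -> T -> R).
Hypothesis model : regression_model P theta lam sigma sigma_x x eps y.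
Hypothesis lam0 : forall j, 0 < lam j 0.
Hypothesis sigma_x_gt0 : 0 < sigma_x.

Let K : R := 4 * sigma_x ^+ 2.
Let K0 : 0 < K. Proof. by rewrite mulr_gt0// exprn_gt0. Qed.

Lemma measurable_dsubmx m1 m2 :
  measurable_fun setT ((fun M : mxT (m1 + m2) 1 => dsubmx M) : _ -> @mxT R m2 1).
Proof.
apply: measurable_mx => i j.
under eq_fun do rewrite mxE.
exact: measurable_coord.
Qed.

(** The model makes the stacked pairs independent; [dsubmx] recovers the covariate from a pair. *)
Lemma model_independent (g : 'cV[R]_p -> R) :
  measurable_fun setT (g : mxT p 1 -> R) ->
  independent_family P (fun i w => g (x i w)).
Proof.
move=> mg B mB.
have dE i w : g (dsubmx (datum x y i w)) = g (x i w) by rewrite /datum col_mxKd.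
have := model_indep model (A := fun i => [set M | B i (g (dsubmx M))]).
have h i : borel_mx [set M : 'cV[R]_(1 + p) | B i (g (dsubmx M))].
  have := measurableT_comp mg (@measurable_dsubmx 1 p) measurableT (mB i).
  by rewrite setTI.
move=> /(_ h) e.
rewrite (_ : \bigcap_(i in _) _ = \bigcap_(i in [set: 'I_n]) (datum x y i @^-1` [set M | B i (g (dsubmx M))])).
  rewrite e; apply: eq_bigr => i _; congr (P _).
  by apply/seteqP; split=> w /=; rewrite dE.
by apply: eq_bigcapr => i _; apply/seteqP; split=> w /=; rewrite dE.
Qed.

Lemma integral_scale (c : R) (f : T -> R) : 0 <= c -> measurable_fun setT f ->
  (forall w, 0 <= f w) -> (\int[P]_w (c * f w)%:E = c%:E * \int[P]_w (f w)%:E)%E.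
Proof.
move=> c0 mf f0; under eq_integral do rewrite EFinM.
apply: ge0_integralZl => //; first exact/measurable_EFinP.
by move=> w _; rewrite lee_fin.
Qed.

Lemma integral_sum_ge0 (J : finType) (f : J -> T -> R) :
  (forall j, measurable_fun setT (f j)) -> (forall j w, 0 <= f j w) ->
  (\int[P]_w (\sum_j f j w)%:E = \sum_j \int[P]_w (f j w)%:E)%E.
Proof.
move=> mf f0; under eq_integral do rewrite -sumEFin.
apply: ge0_integral_sum => //; first by move=> j; apply/measurable_EFinP.
by move=> j w _; rewrite lee_fin.
Qed.

(** With convex weights, Jensen's inequality passes the exponential bound from the terms to the sum.
    The same Bernstein bound thus serves a single direction ([J] is [unit]) and the trace of the
    tail. *)
Definition mix_form (J : finType) (al : J -> R) (a : J -> 'cV[R]_p) (v : 'cV[R]_p) : R :=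
  \sum_j al j * dot (a j) v ^+ 2.

Lemma measurable_mix_form (J : finType) (al : J -> R) a :
  measurable_fun setT (mix_form al a : mxT p 1 -> R).
Proof.
apply: measurable_sum => j; apply: measurable_funM => //; apply: measurable_funX.
exact: measurable_dot_mx.
Qed.

(** Average the tangent inequality of the exponential at the mean [a]. *)
Lemma jensen_expR (J : finType) (al yy : J -> R) : (forall j, 0 <= al j) ->
  \sum_j al j = 1 -> expR (\sum_j al j * yy j) <= \sum_j al j * expR (yy j).
Proof.
move=> al0 al1; set a := \sum_j al j * yy j.
have h j : al j * (expR a * (1 + (yy j - a))) <= al j * expR (yy j).
  have -> : expR (yy j) = expR a * expR (yy j - a) by rewrite -expRD addrC subrK.
  by rewrite ler_wpM2l// ler_wpM2l ?expR_ge0// expR_ge1Dx.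
apply: (@le_trans _ _ (\sum_j al j * (expR a * (1 + (yy j - a))))); last first.
  by apply: ler_sum => j _; exact: h.
have -> : \sum_j al j * (expR a * (1 + (yy j - a))) = expR a * (\sum_j al j * (1 - a) + a).
  rewrite /a mulrDr !mulr_sumr -big_split /=; apply: eq_bigr => j _; ring.
by rewrite -mulr_suml al1; rewrite mul1r subrK mulr1.
Qed.

Lemma mix_unit_subexp i (J : finType) (al : J -> R) a : (forall j, 0 <= al j) ->
  \sum_j al j = 1 -> (forall j, cov_form lam (a j) = 1) ->
  unit_subexp P K (fun w => mix_form al a (x i w)).
Proof.
move=> al0 al1 a1.
have mx w : measurable_fun setT (x i : T -> mxT p 1).
  by apply/random_mxP; apply: (model_x_measurable model).
have msq j : measurable_fun setT (fun w => dot (a j) (x i w) ^+ 2).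
  by apply: measurable_funX; exact: (model_mdot model).
split.
- apply: (measurableT_comp (measurable_mix_form al a)).
  by apply/random_mxP; apply: (model_x_measurable model).
- by move=> w; apply: sumr_ge0 => j _; rewrite mulr_ge0 ?sqr_ge0.
- rewrite integral_sum_ge0.
  + rewrite -al1 -sumEFin; apply: eq_bigr => j _.
    rewrite integral_scale// => [|w]; last by rewrite sqr_ge0.
    by rewrite (model_dot_sqr model) a1 mule1.
  + by move=> j; apply: measurable_funM.
  + by move=> j w; rewrite mulr_ge0 ?sqr_ge0.
- have me j : measurable_fun setT (fun w => expR (dot (a j) (x i w) ^+ 2 / K)).
    by apply: measurable_expR_comp; apply: measurable_funM.
  apply: (@le_trans _ _ (\int[P]_w (\sum_j al j * expR (dot (a j) (x i w) ^+ 2 / K))%:E)%E).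
    apply: ge0_le_integral => //.
    + apply/measurable_EFinP; apply: measurable_expR_comp; apply: measurable_funM => //.
      apply: (measurableT_comp (measurable_mix_form al a)).
      by apply/random_mxP; apply: (model_x_measurable model).
    + apply/measurable_EFinP; apply: measurable_sum => j.
      exact: measurable_funM.
    + move=> w _; rewrite lee_fin /mix_form mulr_suml.
      under eq_bigr do rewrite -mulrA.
      exact: jensen_expR.
  rewrite integral_sum_ge0.
  + have -> : 2%:E = (\sum_j (al j)%:E * 2%:E)%E :> \bar R.
      by rewrite -[LHS]mul1e -al1 -sumEFin ge0_sume_distrl// => j _; rewrite lee_fin.
    apply: lee_sum => j _.
    rewrite integral_scale//.
    by rewrite lee_wpmul2l ?lee_fin// (model_exp_le model)// a1.
  + by move=> j; apply: measurable_funM.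
  + by move=> j w; rewrite mulr_ge0 ?expR_ge0.
Qed.

Lemma mix_bernstein (J : finType) (al : J -> R) a e : (0 < n)%N -> 0 < e <= 1 ->
  (forall j, 0 <= al j) ->
  \sum_j al j = 1 -> (forall j, cov_form lam (a j) = 1) ->
  (P [set w | (n%:R * e < `|\sum_(i < n) (mix_form al a (x i w) - 1)|)%R]
    <= (2 * expR (- (e ^+ 2 * n%:R / (1024 * K ^+ 2))))%R%:E)%E.
Proof.
move=> n0 e01 al0 al1 a1.
apply: (@bernstein _ _ _ P K K0 n (fun i w => mix_form al a (x i w))) => //.
- exact: (model_independent (measurable_mix_form al a)).
- by move=> i; apply: mix_unit_subexp.
Qed.

Definition whiten (v : 'cV[R]_p) : 'cV[R]_p := \col_j (v j 0 / Num.sqrt (lam j 0)).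

(** As [entry] vanishes beyond p, a block that overruns the last coordinate has zero columns
    there. *)
Definition block (o m : nat) (w : T) : 'M[R]_(n, m) :=
  \matrix_(i, r) entry (whiten (x i w)) (o + r).+1.

(** The vector [v] on coordinates o+1, ..., o+m carried back to unwhitened coordinates. The inner
    sum has at most one term, and entries of [v] falling beyond p are lost. *)
Definition block_dir (o m : nat) (v : 'cV[R]_m) : 'cV[R]_p :=
  \col_j ((\sum_(r < m | (o + r)%N == j) v r 0) / Num.sqrt (lam j 0)).

Lemma block_mulmx o m w (v : 'cV[R]_m) i :
  (block o m w *m v) i 0 = dot (block_dir o v) (x i w).
Proof.
rewrite mxE /dot.
under eq_bigr => r _ do rewrite mxE /entry mulr_suml big_mkcond.
rewrite exchange_big; apply: eq_bigr => j _ /=.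
rewrite !mxE mulrAC mulr_suml mulr_suml [RHS]big_mkcond; apply: eq_bigr => r _.
rewrite eqSS eq_sym; case: ifP => // _; rewrite ?mxE; ring.
Qed.

Lemma cov_form_block_dir o m (v : 'cV[R]_m) :
  cov_form lam (block_dir o v) = \sum_(r < m | (o + r < p)%N) v r 0 ^+ 2.
Proof.
rewrite /cov_form.
transitivity (\sum_(j < p) \sum_(r < m | (o + r)%N == j) v r 0 ^+ 2).
  apply: eq_bigr => j _; rewrite mxE expr_div_n sqr_sqrtr ?(ltW (lam0 j))//.
  rewrite mulrC divfK ?gt_eqF//.
  case: (pickP [pred r : 'I_m | (o + r)%N == j]) => [r /= rj|none].
    have e : forall r' : 'I_m, ((o + r')%N == j) = (r' == r).
      by move=> r'; rewrite -(eqP rj) eqn_add2l.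
    by rewrite !(eq_bigl _ _ e) !big_pred1_eq.
  by rewrite !big_pred0// expr0n.
rewrite [RHS]big_mkcond; under [LHS]eq_bigr => j _ do rewrite big_mkcond.
rewrite exchange_big; apply: eq_bigr => r _ /=; rewrite -big_mkcond.
case: ifP => h.
  by rewrite (big_pred1 (Ordinal h))// => j; rewrite /= eq_sym -val_eqE.
rewrite big_pred0// => j; apply/negbTE; apply: contraFN h => /eqP ->.
exact: ltn_ord.
Qed.

Lemma cov_form_block_dir_le o m (v : 'cV[R]_m) : cov_form lam (block_dir o v) <= sqn v.
Proof.
rewrite cov_form_block_dir big_mkcond; apply: ler_sum => r _.
by case: ifP => _; rewrite -expr2 ?sqr_ge0.
Qed.

Lemma cov_form_block_dir_eq o m (v : 'cV[R]_m) : (o + m <= p)%N ->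
  cov_form lam (block_dir o v) = sqn v.
Proof.
move=> omp; rewrite cov_form_block_dir; apply: eq_big => [r|r _]; last exact: expr2.
by rewrite (leq_trans _ omp)// ltn_add2l.
Qed.

Lemma measurable_sqn_block o m (v : 'cV[R]_m) :
  measurable_fun setT (fun w => sqn (block o m w *m v)).
Proof.
rewrite /sqn /dot; apply: measurable_sum => i.
under eq_fun do rewrite block_mulmx.
by apply: measurable_funM; exact: (model_mdot model).
Qed.

(** The n rows are independent and each contributes a factor of at most 2. *)
Lemma exp_block_le o m (v : 'cV[R]_m) : sqn v <= 1 ->
  (\int[P]_w (expR (sqn (block o m w *m v) / K))%:E <= (2 ^+ n)%:E)%E.
Proof.
move=> v1.
have E w : expR (sqn (block o m w *m v) / K) =
    \prod_(i < n) expR (dot (block_dir o v) (x i w) ^+ 2 / K).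
  have -> : sqn (block o m w *m v) = \sum_(i < n) dot (block_dir o v) (x i w) ^+ 2.
    by apply: eq_bigr => i _; rewrite block_mulmx expr2.
  by rewrite mulr_suml expR_sum.
under eq_integral do rewrite E.
have mg : measurable_fun setT (fun v' : mxT p 1 => expR (dot (block_dir o v) v' ^+ 2 / K)).
  apply: measurableT_comp => //; apply: measurable_funM => //; apply: measurable_funX.
  exact: measurable_dot_mx.
apply: expectation_prod_le.
- move=> i; apply: (measurableT_comp mg).
  by apply/random_mxP; apply: (model_x_measurable model).
- by move=> i w; rewrite expR_ge0.
- exact: (model_independent mg).
- move=> i; apply: (model_exp_le model lam0 sigma_x_gt0).
  exact: le_trans (cov_form_block_dir_le _ _) v1.
Qed.

End Events.

Lemma entryE (R : realType) p (v : 'cV[R]_p) (j : 'I_p) : entry v j.+1 = v j 0.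
Proof. by rewrite /entry (big_pred1 j)// => i; rewrite eqSS. Qed.

Lemma entry_out (R : realType) p (v : 'cV[R]_p) j : (p < j)%N -> entry v j = 0.
Proof.
move=> pj; rewrite /entry big_pred0// => i; apply/negbTE.
by apply: contraTneq pj => <-; rewrite -leqNgt ltn_ord.
Qed.

Lemma sum_tail (R : realType) p (d : nat) (F : nat -> R) : (d <= p)%N ->
  \sum_(t < p - d) F (d + t)%N = \sum_(j < p | (d <= j)%N) F j.
Proof.
move=> dp; rewrite -(big_mkord xpredT (fun t => F (d + t)%N)) -(big_mkord (fun j => d <= j)%N F).
under eq_bigr do rewrite addnC.
rewrite -(big_addn 0 p d xpredT F) add0n.
rewrite (big_nat_widenl d 0)//=.
Qed.

Lemma sum_head (R : realType) p (d : nat) (F : nat -> R) : (d <= p)%N ->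
  \sum_(k < d) F k = \sum_(j < p | (j < d)%N) F j.
Proof. by move=> dp; rewrite (big_ord_widen _ _ dp). Qed.

(** * Head Gram matrix, tail trace and tail signal *)

Section GoodDirections.
Context {disp : measure_display} {T : measurableType disp} {R : realType}.
Variable P : probability T R.
Context {n p : nat}.
Variables (theta lam : 'cV[R]_p) (sigma sigma_x : R).
Variables (x : 'I_n -> T -> 'cV[R]_p) (eps y : 'I_n -> T -> R).
Hypothesis model : regression_model P theta lam sigma sigma_x x eps y.
Hypothesis lam0 : forall j, 0 < lam j 0.
Hypothesis sigma_x_gt0 : 0 < sigma_x.
Hypothesis n0 : (0 < n)%N.
Variable d : nat.
Hypothesis d0 : (0 < d)%N.
Hypothesis dp : (d < p)%N.

Let K : R := 4 * sigma_x ^+ 2.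
Let K0 : 0 < K. Proof. by rewrite mulr_gt0// exprn_gt0. Qed.
Let N : R := n%:R.
Let N0 : 0 < N. Proof. by rewrite ltr0n. Qed.
(** The tolerance is 1/30 because [quad_form_net] loses a factor 3 and the resolvent estimates allow
    1/10. *)
Let rate : R := expR (- ((30^-1) ^+ 2 * n%:R / (1024 * K ^+ 2))).
Let e01 : 0 < (30^-1 : R) <= 1. Proof. by apply/andP; split; lra. Qed.

Definition bad_dir (J : finType) (al : J -> R) (a : J -> 'cV[R]_p) : set T :=
  [set w | n%:R * 30^-1 < `|\sum_(i < n) (mix_form al a (x i w) - 1)|].

Lemma measurable_bad_dir (J : finType) (al : J -> R) a : measurable (@bad_dir J al a).
Proof.
have mm i : measurable_fun setT (fun w => mix_form al a (x i w)).
  apply: (measurableT_comp (measurable_mix_form al a)).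
  by apply/random_mxP; apply: (model_x_measurable model).
have mS : measurable_fun setT (fun w => \sum_(i < n) (mix_form al a (x i w) - 1)).
  by apply: measurable_sum => i; apply: measurable_funB.
have := @measurable_fun_ltr _ _ R setT (cst (n%:R * 30^-1)) _ (measurable_cst _)
  (measurableT_comp (@normr_measurable R setT) mS) measurableT [set true] I.
by rewrite setTI.
Qed.

Lemma bad_dir_le (J : finType) (al : J -> R) a : (forall j, 0 <= al j) ->
  \sum_j al j = 1 -> (forall j, cov_form lam (a j) = 1) ->
  (P (bad_dir al a) <= (2 * rate)%:E)%E.
Proof. by move=> al0 al1 a1; apply: (mix_bernstein model lam0 sigma_x_gt0 n0 e01). Qed.

Lemma good_dir (J : finType) (al : J -> R) a w c Q : 0 <= c ->
  Q = c * \sum_(i < n) mix_form al a (x i w) -> ~ bad_dir al a w ->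
  `|Q - N * c| <= N * c / 30.
Proof.
move=> c0 -> /negP; rewrite -leNgt sumrB sumr_const card_ord => h.
rewrite (mulrC N) -mulrBr normrM ger0_norm// -mulrA.
by apply: ler_wpM2l.
Qed.

Lemma mix_unit (a : 'cV[R]_p) v : mix_form (fun _ : unit => 1) (fun=> a) v = dot a v ^+ 2.
Proof. by rewrite /mix_form (big_pred1 tt)// ?mul1r// => -[]. Qed.

(** A union bound over the net, followed by [quad_form_net] for Z^T Z - n. *)
Lemma gram_head : exists Bad : set T, [/\ measurable Bad,
  (P Bad <= (2 ^+ (18 * d) * (2 * rate))%:E)%E &
  forall w, ~ Bad w -> forall u,
    9 / 10 * N * sqn u <= sqn (block lam x 0 d w *m u) <= 11 / 10 * N * sqn u].
Proof.
have [Net [Nsize Nball Ncov]] := @ball_net R d d0.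
pose dir (v : 'cV[R]_d) := block_dir lam 0 ((Num.sqrt (sqn v))^-1 *: v).
(* The origin may be a net point; it has no direction and its form is 0, so it gets the empty
   event. *)
pose B (v : 'cV[R]_d) : set T := if v == 0 then set0 else bad_dir (fun _ : unit => 1) (fun=> dir v).
have mB v : measurable (B v) by rewrite /B; case: ifP => // _; exact: measurable_bad_dir.
have rate0 : 0 <= 2 * rate by rewrite mulr_ge0// expR_ge0.
have PB v : (P (B v) <= (2 * rate)%:E)%E.
  rewrite /B; case: ifPn => [_|v0]; first by rewrite measure0 lee_fin.
  apply: bad_dir_le => //; first by rewrite (big_pred1 tt)// => -[].
  move=> _; rewrite cov_form_block_dir_eq//; last exact: ltnW.
  have s0 : sqn v != 0 by apply: contra v0 => /eqP/sqn_eq0 ->.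
  by rewrite sqnZ exprVn sqr_sqrtr ?sqn_ge0// mulVf.
exists (\big[setU/set0]_(i < size Net) B (nth 0 Net i)); split.
- exact: bigsetU_measurable.
- have := @Boole_inequality _ _ _ P (fun i => B (nth 0 Net i)) (size Net) (fun i _ => mB _).
  move=> /le_trans; apply.
  apply: (@le_trans _ _ (\sum_(i < size Net) (2 * rate)%:E)%E); first by apply: lee_sum => i _; exact: PB.
  by rewrite sumEFin lee_fin sumr_const card_ord -(mulr_natl (2 * rate)) ler_wpM2r.
- move=> w wB u; set Z := block lam x 0 d w.
  pose M := Z^T *m Z - N%:M.
  have ME v : dot v (M *m v) = sqn (Z *m v) - N * sqn v.
    by rewrite /M mulmxBl !dotE mul_scalar_mx dotZr -mulmxA dot_trmx.
  have := @quad_form_net R d Net M (N / 30) _ Ncov Nball _ u.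
  rewrite /M linearB /= trmx_mul trmxK tr_scalar_mx -/M => /(_ erefl).
  rewrite ME => h.
  have {h} : `|sqn (Z *m u) - N * sqn u| <= 3 * (N / 30) * sqn u.
    apply: h => v vN; rewrite ME.
    have v1 := Nball v vN.
    have [/eqP v0|v0] := boolP (v == 0).
      by rewrite v0 mulmx0 /sqn /dot !big1 ?mulr0 ?subrr ?normr0 ?divr_ge0 ?(ltW N0)// => i _; rewrite mxE mul0r.
    have s0 : 0 < sqn v.
      by rewrite lt_def sqn_ge0 andbT; apply: contra v0 => /eqP/sqn_eq0 ->.
    have wBv : ~ bad_dir (fun _ : unit => 1) (fun=> dir v) w.
      move=> h; apply: wB; rewrite -(bigcup_mkord (size Net) (fun i => B (nth 0 Net i))).
      exists (index v Net); rewrite /= ?index_mem// nth_index// /B (negPf v0).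
      exact: h.
    have := good_dir (ltW s0) _ wBv => /(_ (sqn (Z *m v))) h.
    apply: (@le_trans _ _ (N * sqn v / 30)).
      apply: h; rewrite mulr_sumr; apply: eq_bigr => i _.
      have scE c (A : 'cV[R]_n) : (c *: A) i 0 = c * A i 0 by rewrite mxE.
      rewrite mix_unit /dir -block_mulmx -scalemxAr scE exprMn exprVn sqr_sqrtr ?ltW//.
      by rewrite mulrA mulfV ?gt_eqF// mul1r expr2.
    by have := ler_wpM2l (ltW N0) v1; lra.
  rewrite ler_norml => /andP[h1 h2]; apply/andP; split; lra.
Qed.

Definition tail_design (w : T) : 'M[R]_(n, p - d) :=
  \matrix_(i, t) entry (x i w) (d + t).+1.

Let L : R := \sum_(j < p | (d <= j)%N) lam j 0.
Let L0 : 0 < L.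
Proof.
rewrite /L (bigD1 (Ordinal dp))//=; rewrite ltr_pwDl//.
by apply: sumr_ge0 => j _; rewrite ltW.
Qed.

Lemma trace_tail : exists Bad : set T, [/\ measurable Bad,
  (P Bad <= (2 * rate)%:E)%E &
  forall w, ~ Bad w -> 9 / 10 * (N * L) <= fro (tail_design w) <= 11 / 10 * (N * L)].
Proof.
(* These weights with the directions e_j / sqrt lambda_j make L times the mixture equal to the sum
   of the squared tail coordinates. *)
pose al (j : 'I_p) : R := if (d <= j)%N then lam j 0 / L else 0.
pose a (j : 'I_p) : 'cV[R]_p := (Num.sqrt (lam j 0))^-1 *: delta_mx j 0.
exists (bad_dir al a); split; first exact: measurable_bad_dir.
- apply: bad_dir_le.
  + by move=> j; rewrite /al; case: ifP => // _; rewrite divr_ge0// ltW.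
  + by rewrite /al -big_mkcond -mulr_suml mulfV// gt_eqF.
  + move=> j; rewrite /cov_form (bigD1 j)//= big1 ?addr0 => [|k kj].
      by rewrite !mxE !eqxx mulr1 exprVn sqr_sqrtr ?(ltW (lam0 j))// mulfV// gt_eqF.
    by rewrite !mxE (negPf kj) mulr0 expr0n mulr0.
- move=> w wB.
  have := good_dir (ltW L0) (erefl _) wB.
  have -> : L * \sum_(i < n) mix_form al a (x i w) = fro (tail_design w).
    rewrite mulr_sumr /fro; apply: eq_bigr => i _.
    rewrite (eq_bigr (fun t : 'I_(p - d) => entry (x i w) (d + t).+1 ^+ 2)); last by move=> t _; rewrite mxE.
    rewrite (sum_tail (fun j => entry (x i w) j.+1 ^+ 2) (ltnW dp)).
    rewrite /mix_form mulr_sumr [RHS]big_mkcond; apply: eq_bigr => j _.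
    rewrite /al entryE; case: ifP => _; last by rewrite mul0r mulr0.
    have -> : dot (a j) (x i w) = x i w j 0 / Num.sqrt (lam j 0).
      rewrite /a dotZl /dot (bigD1 j)//= big1 ?addr0 => [|k kj].
        by rewrite mxE !eqxx mul1r mulrC.
      by rewrite mxE (negPf kj) mul0r.
    rewrite expr_div_n sqr_sqrtr ?(ltW (lam0 j))//.
    by field; rewrite !gt_eqF.
  by rewrite ler_norml => /andP[h1 h2]; apply/andP; split; have := mulr_gt0 N0 L0; lra.
Qed.

Lemma signal_tail (th : 'cV[R]_p) : exists Bad : set T, [/\ measurable Bad,
  (P Bad <= (2 * rate)%:E)%E &
  forall w, ~ Bad w -> sqn (tail_design w *m tail_part d th)
    <= 11 / 10 * N * \sum_(j < p | (d <= j)%N) lam j 0 * th j 0 ^+ 2].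
Proof.
set V := \sum_(j < p | _) _.
have V0 : 0 <= V by apply: sumr_ge0 => j _; rewrite mulr_ge0 ?sqr_ge0// ltW.
pose th2 : 'cV[R]_p := \col_j (if (d <= j)%N then th j 0 else 0).
have tE w i : (tail_design w *m tail_part d th) i 0 = dot th2 (x i w).
  rewrite mxE (eq_bigr (fun t : 'I_(p - d) => entry (x i w) (d + t).+1 * entry th (d + t).+1)); last first.
    by move=> t _; rewrite !mxE.
  rewrite (sum_tail (fun j => entry (x i w) j.+1 * entry th j.+1) (ltnW dp)).
  rewrite big_mkcond; apply: eq_bigr => j _; rewrite !entryE mxE.
  by case: ifP => _; [rewrite mulrC|rewrite mul0r].
have covth : cov_form lam th2 = V.
  rewrite /cov_form /V [RHS]big_mkcond; apply: eq_bigr => j _; rewrite mxE.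
  by case: ifP => // _; rewrite expr0n mulr0.
(* A vanishing tail signal cannot be normalised, but then the tail of [th] is 0 and the empty event
   will do. *)
have [/eqP Vz|Vnz] := boolP (V == 0).
  exists set0; split=> //; first by rewrite measure0 lee_fin mulr_ge0// expR_ge0.
  move=> w _; rewrite Vz mulr0 /sqn /dot big1// => i _; rewrite tE.
  have -> : th2 = 0.
    apply/colP => j; rewrite [RHS]mxE.
    move: covth; rewrite Vz /cov_form => /eqP; rewrite psumr_eq0; last first.
      by move=> k _; rewrite mulr_ge0 ?sqr_ge0// ltW.
    move=> /allP /(_ j (mem_index_enum _)); rewrite mulf_eq0 gt_eqF//= sqrf_eq0.
    by move=> /eqP.
  by rewrite /dot [X in X * _]big1 ?mul0r// => k _; rewrite mxE mul0r.
have Vp : 0 < V by rewrite lt_def Vnz.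
pose a := (Num.sqrt V)^-1 *: th2.
exists (bad_dir (fun _ : unit => 1) (fun=> a)); split; first exact: measurable_bad_dir.
- apply: bad_dir_le => //; first by rewrite (big_pred1 tt)// => -[].
  move=> _; rewrite -[RHS](mulVf Vnz) -{2}covth /cov_form mulr_sumr.
  by apply: eq_bigr => j _; rewrite mxE exprMn exprVn sqr_sqrtr//; ring.
- move=> w wB.
  have := good_dir V0 (erefl _) wB.
  have -> : V * \sum_(i < n) mix_form (fun _ : unit => 1) (fun=> a) (x i w) = sqn (tail_design w *m tail_part d th).
    rewrite mulr_sumr; apply: eq_bigr => i _.
    by rewrite mix_unit tE /a dotZl exprMn exprVn sqr_sqrtr// mulrA mulfV// mul1r expr2.
  by rewrite ler_norml => /andP[h1 h2]; have := mulr_gt0 N0 Vp; lra.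
Qed.

End GoodDirections.

(** * Operator norm of the tail design *)

Lemma sum_blocks (R : realType) (h : nat -> R) k n :
  \sum_(t < k * n) h t = \sum_(j < k) \sum_(r < n) h (j * n + r)%N.
Proof.
elim: k => [|k IH]; first by rewrite mul0n !big_ord0.
rewrite big_ord_recr /= -IH mulSnr big_split_ord /=.
by congr (_ + _); apply: eq_bigr => r _.
Qed.

Section TailOp.
Context {disp : measure_display} {T : measurableType disp} {R : realType}.
Variable P : probability T R.
Context {n p : nat}.
Variables (theta lam : 'cV[R]_p) (sigma sigma_x : R).
Variables (x : 'I_n -> T -> 'cV[R]_p) (eps y : 'I_n -> T -> R).
Hypothesis model : regression_model P theta lam sigma sigma_x x eps y.
Hypothesis lam0 : forall j, 0 < lam j 0.
Hypothesis lam_dec : forall i j : 'I_p, (i <= j)%N -> lam j 0 <= lam i 0.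
Hypothesis sigma_x_gt0 : 0 < sigma_x.
Hypothesis n0 : (0 < n)%N.
Variable d : nat.
Hypothesis dp : (d < p)%N.

Let K : R := 4 * sigma_x ^+ 2.
Let K0 : 0 < K. Proof. by rewrite mulr_gt0// exprn_gt0. Qed.
Let N : R := n%:R.
Let N0 : 0 < N. Proof. by rewrite ltr0n. Qed.
(** Tail eigenvalues counted from 0 and continued by 0, so that q blocks of length n cover the tail
    without truncation. *)
Let ell (t : nat) : R := entry lam (d + t).+1.
Let L : R := \sum_(j < p | (d <= j)%N) lam j 0.
Let q := (p - d)%N.
Let Lam := \sum_(k < q) ell (k * n).

Let q0 : (0 < q)%N. Proof. by rewrite subn_gt0. Qed.

Let ell_lt t (tq : (d + t < p)%N) : ell t = lam (Ordinal tq) 0.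
Proof. by rewrite /ell -[(d + t).+1]/((Ordinal tq).+1) entryE. Qed.

Let ell_ge t : (p <= d + t)%N -> ell t = 0.
Proof. by move=> h; rewrite /ell entry_out. Qed.

Let ell_ge0 t : 0 <= ell t.
Proof. by case: (ltnP (d + t) p) => h; [rewrite ell_lt ltW|rewrite ell_ge]. Qed.

Let ell_dec s t : (s <= t)%N -> ell t <= ell s.
Proof.
move=> st; case: (ltnP (d + t) p) => h; last by rewrite ell_ge// ell_ge0.
have h' : (d + s < p)%N by apply: leq_ltn_trans h; rewrite leq_add2l.
by rewrite !ell_lt lam_dec//= leq_add2l.
Qed.

Let qqn : (q <= q * n)%N. Proof. by rewrite leq_pmulr. Qed.

Let sum_ell : \sum_(t < q * n) ell t = L.
Proof.
rewrite /L -(eq_bigr _ (fun j _ => entryE lam j)) -(sum_tail (fun j => entry lam j.+1) (ltnW dp)) -/q.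
rewrite (big_ord_widen _ (fun t => entry lam (d + t).+1) qqn) [RHS]big_mkcond /=; apply: eq_bigr => t _.
by case: ifPn => //; rewrite -leqNgt leq_subLR => h; rewrite ell_ge.
Qed.

(** By monotonicity n ell((k+1) n) is at most the sum of [ell] over block k, and only [ell 0] is
    left over. The norm bound becomes a multiple of lambda_{d+1} (1 + r_d / n), free of the number
    of blocks. *)
Lemma Lam_le : Lam <= ell 0 + L / N.
Proof.
have h : N * Lam <= N * ell 0 + L.
  rewrite -sum_ell sum_blocks /Lam.
  apply: (@le_trans _ _ (N * (ell 0 + \sum_(k < q) ell (k.+1 * n)))).
    rewrite ler_wpM2l ?(ltW N0)//; move: q0; case: q => // Q _.
    rewrite big_ord_recl mul0n lerD2l big_ord_recr /=.
    by rewrite (eq_bigr (fun k : 'I_Q => ell (k.+1 * n)))// lerDl.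
  rewrite mulrDr lerD2l mulr_sumr; apply: ler_sum => k _.
  rewrite /N mulr_natl -[n in X in X <= _]card_ord -sumr_const; apply: ler_sum => r _.
  by apply: ell_dec; rewrite card_ord mulSnr leq_add2l ltnW.
by rewrite -(ler_pM2l N0) mulrDr (mulrCA N) divff ?gt_eqF// mulr1.
Qed.

Let Lam0 : 0 < Lam.
Proof.
rewrite /Lam; move: q0 (ell_lt (t := 0)); case: q => // Q _ e0.
rewrite big_ord_recl mul0n ltr_pwDl ?sumr_ge0//.
have h : (d + 0 < p)%N by rewrite addn0.
by rewrite (e0 h).
Qed.

Lemma tail_design_blocks w (u : 'cV[R]_n) :
  sqn ((tail_design x d w)^T *m u) <=
  \sum_(k < q) ell (k * n) * sqn ((block lam x (d + k * n) n w)^T *m u).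
Proof.
pose c t := \sum_i entry (whiten lam (x i w)) (d + t).+1 * u i 0.
pose h t := ell t * c t ^+ 2.
have h0 t : 0 <= h t by rewrite mulr_ge0 ?sqr_ge0.
have -> : sqn ((tail_design x d w)^T *m u) = \sum_(t < q) h t.
  apply: eq_bigr => t _.
  have tp : (d + t < p)%N by have := ltn_ord t; rewrite /q ltn_subRL.
  rewrite -expr2 /h -[ell t]sqr_sqrtr// -exprMn; congr (_ ^+ 2).
  rewrite mxE /c mulr_sumr; apply: eq_bigr => i _; rewrite !mxE mulrA.
  congr (_ * _); rewrite -[(d + t).+1]/((Ordinal tp).+1) !entryE mxE ell_lt.
  by rewrite mulrC divfK// gt_eqF// sqrtr_gt0.
apply: (@le_trans _ _ (\sum_(t < q * n) h t)).
  rewrite (big_ord_widen _ h qqn) [X in X <= _]big_mkcond /=; apply: ler_sum => t _.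
  by case: ifP.
rewrite sum_blocks; apply: ler_sum => k _.
rewrite mulr_sumr; apply: ler_sum => r _; rewrite -expr2 /h.
have -> : ((block lam x (d + k * n) n w)^T *m u) r 0 = c (k * n + r)%N.
  by rewrite mxE; apply: eq_bigr => i _; rewrite !mxE addnA.
by rewrite ler_wpM2r ?sqr_ge0// ell_dec// leq_addr.
Qed.

(* The tail is cut into blocks of n consecutive coordinates.  By monotonicity
   block k contributes at most ell (k n) times a whitened block, and the weights
   ell (k n) / Lam turn the whole into a mixture to which Jensen applies. *)
Lemma tail_op : exists Bad : set T, [/\ measurable Bad,
  (P Bad <= (expR (- N))%:E)%E &
  forall w, ~ Bad w -> forall u,
    sqn ((tail_design x d w)^T *m u) <= N * (60 * K * (ell 0 + L / N)) * sqn u].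
Proof.
have [Net [Nsize Nball Ncov]] := @ball_net R n n0.
pose al (k : 'I_q) := ell (k * n) / Lam.
have al0 k : 0 <= al k by rewrite divr_ge0// ltW.
have al1 : \sum_k al k = 1 by rewrite -mulr_suml mulfV// gt_eqF.
pose Z k w := block lam x (d + k * n) n w.
(* Summing over the net replaces a maximum, and the average [G] replaces a union over the blocks,
   whose number is not controlled by n. *)
pose g k w : R := \sum_(j < size Net) expR (sqn (Z k w *m nth 0 Net j) / K).
pose G w : R := \sum_(k < q) al k * g k w.
have mexp k v : measurable_fun setT (fun w => expR (sqn (Z k w *m v) / K)).
  apply: measurable_expR_comp; apply: measurable_funM => //.
  exact: (measurable_sqn_block model).
have mg k : measurable_fun setT (g k) by apply: measurable_sum => j; exact: mexp.
have g0 k w : 0 <= g k w by apply: sumr_ge0 => j _; rewrite expR_ge0.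
have mG : measurable_fun setT G.
  by apply: measurable_sum => k; apply: measurable_funM.
have G0 w : 0 <= G w by apply: sumr_ge0 => k _; rewrite mulr_ge0.
have Eg k : (\int[P]_w (g k w)%:E <= (2 ^+ (19 * n))%:E)%E.
  rewrite integral_sum_ge0//.
  apply: (@le_trans _ _ (\sum_(j < size Net) (2 ^+ n)%:E)%E).
    apply: lee_sum => j _; apply: (exp_block_le model lam0 sigma_x_gt0).
    by apply: Nball; rewrite mem_nth.
  rewrite sumEFin lee_fin sumr_const card_ord -(mulr_natl (2 ^+ n)).
  have -> : (19 * n = 18 * n + n)%N by rewrite -mulSnr.
  by rewrite exprD ler_wpM2r ?exprn_ge0.
have EG : (\int[P]_w (G w)%:E <= (2 ^+ (19 * n))%:E)%E.
  rewrite integral_sum_ge0//; first last.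
  - by move=> k w; rewrite mulr_ge0.
  - by move=> k; apply: measurable_funM.
  apply: (@le_trans _ _ (\sum_(k < q) (al k * 2 ^+ (19 * n))%:E)%E).
    apply: lee_sum => k _; rewrite integral_scale// [X in (_ <= X)%E]EFinM.
    by rewrite lee_wpmul2l ?lee_fin//; exact: Eg.
  by rewrite sumEFin -mulr_suml al1 mul1r.
(* The mean of [G] is at most 2^(19 n): 18 n from the net and n from [exp_block_le]. The factor exp
   N is the probability gained by Markov's inequality. *)
pose a : R := 2 ^+ (19 * n) * expR N.
have a0 : 0 < a by rewrite mulr_gt0 ?exprn_gt0 ?expR_gt0.
exists [set w | a <= G w]; split.
- have := @measurable_fun_ler _ _ R setT (cst a) G (measurable_cst _) mG measurableT [set true] I.
  by rewrite setTI.
- apply: (le_trans (markov_ge0 mG G0 a0 EG)).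
  by rewrite lee_fin /a expRN invfM mulrA mulfV ?mul1r.
- move=> w /negP; rewrite -ltNge => Gw u.
  have gp k : 0 < g k w.
    have [v vN _] : exists2 v, v \in Net & sqn (0 - v) <= 1 / 16.
      by apply: Ncov; rewrite /sqn /dot big1// => i _; rewrite mxE mul0r.
    have vi : (index v Net < size Net)%N by rewrite index_mem.
    rewrite /g (bigD1 (Ordinal vi))//=.
    by rewrite ltr_pwDl ?expR_gt0// sumr_ge0// => j _; rewrite expR_ge0.
  have netle k v : v \in Net -> sqn (Z k w *m v) <= K * ln (g k w).
    move=> vN; rewrite mulrC -ler_pdivrMr// -ler_expR lnK ?posrE//.
    have vi : (index v Net < size Net)%N by rewrite index_mem.
    by rewrite /g (bigD1 (Ordinal vi))//= nth_index// lerDl sumr_ge0.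
  have zle k u' : sqn (Z k w *m u') <= 3 * (K * ln (g k w)) * sqn u'.
    have := @quad_form_net R n Net ((Z k w)^T *m Z k w) (K * ln (g k w)) _ Ncov Nball _ u'.
    rewrite trmx_mul trmxK => /(_ erefl).
    have ME v : dot v ((Z k w)^T *m Z k w *m v) = sqn (Z k w *m v).
      by rewrite -mulmxA dot_trmx.
    rewrite ME ger0_norm ?sqn_ge0//; apply => v vN.
    by rewrite ME ger0_norm ?sqn_ge0// netle.
  have y0 k : 0 <= 3 * (K * ln (g k w)).
    have [v vN _] : exists2 v, v \in Net & sqn (0 - v) <= 1 / 16.
      by apply: Ncov; rewrite /sqn /dot big1// => i _; rewrite mxE mul0r.
    by rewrite mulr_ge0// (le_trans _ (netle k v vN))// sqn_ge0.
  have ztle k : sqn ((Z k w)^T *m u) <= 3 * (K * ln (g k w)) * sqn u.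
    exact: sqn_mulmx_trmx.
  (* Jensen bounds the exponential of the left-hand side by G < 2^(19 n) e^n <= e^(20 n). With the
     factor 3 K of [zle] this yields the 60 K of the statement. *)
  have yle : \sum_k al k * ln (g k w) <= 20 * N.
    rewrite -ler_expR; apply: (le_trans (jensen_expR _ al0 al1)).
    have -> : \sum_j al j * expR (ln (g j w)) = G w.
      by apply: eq_bigr => k _; rewrite lnK ?posrE.
    apply: (le_trans (ltW Gw)); rewrite /a.
    have -> : 20 * N = (19 * n)%:R * 1 + N by rewrite natrM; ring.
    rewrite expRD expRM_natl ler_wpM2r ?expR_ge0// ler_pXn2r ?nnegrE ?expR_ge0 ?muln_gt0//.
    by have := @expR_ge1Dx R 1; lra.
  apply: (le_trans (tail_design_blocks w u)).
  apply: (@le_trans _ _ (3 * K * Lam * (\sum_k al k * ln (g k w)) * sqn u)).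
    rewrite mulr_sumr mulr_suml; apply: ler_sum => k _.
    have := ler_wpM2l (ell_ge0 (k * n)) (ztle k); rewrite -/(Z k w) => /le_trans; apply.
    rewrite /al le_eqVlt; apply/orP; left; apply/eqP; field.
    by rewrite gt_eqF.
  rewrite ler_wpM2r ?sqn_ge0//.
  have KL0 : 0 <= 3 * K * Lam by rewrite mulr_ge0 ?(ltW Lam0)// mulr_ge0 ?(ltW K0).
  apply: (le_trans (ler_wpM2l KL0 yle)).
  have NK : 0 <= 60 * N * K by rewrite mulr_ge0 ?(ltW K0)// mulr_ge0 ?(ltW N0).
  by have := ler_wpM2l NK Lam_le; move: (L / N) => LN; lra.
Qed.

End TailOp.

(** * The conditional expectation *)

Section MeasurableMatrix.
Context {disp : measure_display} {T : measurableType disp} {R : realType}.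

Lemma measurable_det n (A : T -> 'M[R]_n) :
  (forall i j, measurable_fun setT (fun w => A w i j)) ->
  measurable_fun setT (fun w => \det (A w)).
Proof.
move=> mA; apply: measurable_sum => s; apply: measurable_funM => //.
by apply: measurable_prod => i _; exact: mA.
Qed.

(** The inverse is written as f * exp(- ln(f^2)), a composition of measurable functions valid for
    either sign of f. *)
Lemma measurable_funV (f : T -> R) : measurable_fun setT f ->
  (forall w, f w != 0) -> measurable_fun setT (fun w => (f w)^-1).
Proof.
move=> mf f0.
have -> : (fun w => (f w)^-1) = fun w => f w * expR (- ln (f w ^+ 2)).
  apply/funext => w; have f2 : 0 < f w ^+ 2 by rewrite lt_def sqrf_eq0 f0 sqr_ge0.
  by rewrite expRN lnK ?posrE// expr2 invfM mulrA mulfV// mul1r.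
apply: measurable_funM => //; apply: measurableT_comp => //.
apply: measurableT_comp => //; apply: (measurableT_comp (@measurable_ln R)).
exact: measurable_funX.
Qed.

Lemma measurable_mulmx m n k (A : T -> 'M[R]_(m, n)) (B : T -> 'M[R]_(n, k)) :
  (forall i j, measurable_fun setT (fun w => A w i j)) ->
  (forall i j, measurable_fun setT (fun w => B w i j)) ->
  forall i j, measurable_fun setT (fun w => (A w *m B w) i j).
Proof.
move=> mA mB i j; under eq_fun do rewrite mxE.
by apply: measurable_sum => l; apply: measurable_funM.
Qed.

Lemma measurable_invmx n (A : T -> 'M[R]_n) :
  (forall i j, measurable_fun setT (fun w => A w i j)) ->
  (forall w, A w \in unitmx) ->
  forall i j, measurable_fun setT (fun w => invmx (A w) i j).
Proof.
move=> mA uA i j.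
have -> : (fun w => invmx (A w) i j) =
    (fun w => (\det (A w))^-1 * ((-1) ^+ (j + i) * \det (row' j (col' i (A w))))).
  by apply/funext => w; rewrite /invmx uA !mxE.
apply: measurable_funM.
  apply: measurable_funV; first exact: measurable_det.
  by move=> w; have := uA w; rewrite unitmxE unitfE.
apply: measurable_funM => //; apply: measurable_det => k l.
by under eq_fun do rewrite !mxE; exact: mA.
Qed.

End MeasurableMatrix.

(** * Independence of the noise vector and the design *)

Section IndepNoise.
Context {disp : measure_display} {T : measurableType disp} {R : realType}.
Variable P : probability T R.
Context {n p : nat}.
Variables (theta lam : 'cV[R]_p) (sigma sigma_x : R).
Variables (x : 'I_n -> T -> 'cV[R]_p) (eps y : 'I_n -> T -> R).
Hypothesis model : regression_model P theta lam sigma sigma_x x eps y.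

Let X := design x.
Let meps i : measurable_fun setT (eps i). Proof. exact: (model_eps_measurable model). Qed.

Lemma measurable_design : measurable_fun setT (X : T -> mxT n p).
Proof.
apply: measurable_mx => i j; under eq_fun do rewrite mxE.
exact: (model_mxj model).
Qed.

Let mpre (A : set (mxT n p)) : measurable A -> measurable (X @^-1` A).
Proof. by move=> mA; rewrite -[_ @^-1` _]setTI; exact: measurable_design. Qed.

Let mepspre i (B : set R) : measurable B -> measurable (eps i @^-1` B).
Proof. by move=> mB; rewrite -[_ @^-1` _]setTI; exact: meps. Qed.

(** The noise is y - <x, theta>, so a condition on (eps_i, x_i) is one on the i-th datum:
    [model_indep] factors over i and [model_eps_x] within each i. *)
Lemma indep_rectangle (B : 'I_n -> set R) (A : 'I_n -> set (mxT p 1)) :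
  (forall i, measurable (B i)) -> (forall i, measurable (A i)) ->
  (P (\bigcap_(i in [set: 'I_n]) (eps i @^-1` B i `&` x i @^-1` A i)) =
   \prod_(i < n) (P (eps i @^-1` B i) * P (x i @^-1` A i)))%E.
Proof.
move=> mB mA.
pose C i := [set M : 'cV[R]_(1 + p) | B i (M (lshift p ord0) 0 - dot (dsubmx M) theta) /\ A i (dsubmx M)].
have mC i : borel_mx (C i).
  have mf : measurable_fun setT (fun M : mxT (1 + p) 1 => M (lshift p ord0) 0 - dot (dsubmx M) theta : R).
    apply: measurable_funB; first exact: measurable_coord.
    under eq_fun do rewrite dotC.
    exact: (measurableT_comp (measurable_dot_mx theta) (@measurable_dsubmx R 1 p)).
  have h1 := mf measurableT _ (mB i).
  have h2 := @measurable_dsubmx R 1 p measurableT _ (mA i).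
  by have := measurableI _ _ h1 h2; rewrite !setTI.
have yE i w : y i w = dot (x i w) theta + eps i w.
  by rewrite (model_eq model) mxE /dot; congr (_ + _); apply: eq_bigr => j _; rewrite mxE.
have dE i w : C i (datum x y i w) = (B i (eps i w) /\ A i (x i w)).
  by rewrite /C /= /datum col_mxKd col_mxEu mxE /= mulr1n yE addrAC subrr add0r.
have pE i : datum x y i @^-1` C i = eps i @^-1` B i `&` x i @^-1` A i.
  by apply/seteqP; split=> w /=; rewrite dE.
have := model_indep model mC.
under eq_bigcapr do rewrite pE.
move=> ->; apply: eq_bigr => i _; rewrite pE.
have h : independent_rv_vec P (eps i) (x i) by exact: (model_eps_x model).
by apply: h; [exact: mB|exact: mA].
Qed.

Lemma eps_independent (B : 'I_n -> set R) : (forall i, measurable (B i)) ->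
  (P (\bigcap_(i in [set: 'I_n]) (eps i @^-1` B i)) =
   \prod_(i < n) P (eps i @^-1` B i))%E.
Proof.
move=> mB; have := indep_rectangle mB (fun=> measurableT).
under eq_bigcapr do rewrite preimage_setT setIT.
by move=> ->; apply: eq_bigr => i _; rewrite preimage_setT probability_setT mule1.
Qed.

(** Conditions on each row separately form a generating family stable under intersection, to which
    [indep_rectangle] applies. *)
Definition rectangles : set (set (@mxT R n p)) :=
  [set C : set 'M[R]_(n, p) | exists A : 'I_n -> set (@mxT R p 1), (forall i, measurable (A i)) /\
     C = [set M : 'M[R]_(n, p) | forall i, A i (row i M)^T]].

Lemma rectangles_generate : @measurable _ (mxT n p) = <<s rectangles >>.
Proof.
apply/seteqP; split.
  apply: smallest_sub; first exact: smallest_sigma_algebra.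
  move=> _ [i [j [B [mB ->]]]]; apply: sub_sigma_algebra.
  exists (fun k => if k == i then [set v : mxT p 1 | B (v j 0)] else setT); split.
    move=> k; case: ifP => // _.
    rewrite -[X in measurable X]setTI.
    exact: (@measurable_coord R p 1 j 0 measurableT B mB).
  apply/seteqP; split=> M /=.
    by move=> h k; case: eqP => // ->; rewrite /= !mxE.
  by move=> /(_ i); rewrite eqxx /= !mxE.
apply: smallest_sub; first exact: sigma_algebra_measurable.
move=> _ [A [mA ->]].
have -> : [set M : mxT n p | forall i, A i (row i M)^T] =
    \bigcap_(i in [set: 'I_n]) ((fun M : mxT n p => (row i M)^T : mxT p 1) @^-1` A i).
  by apply/seteqP; split=> M /= h i; [move=> _; exact: h|exact: (h i I)].
apply: fin_bigcap_measurable => // i _.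
have mr : measurable_fun setT ((fun M : mxT n p => (row i M)^T) : _ -> @mxT R p 1).
  by apply: measurable_mx => k l; under eq_fun do rewrite !mxE; exact: measurable_coord.
by have := mr measurableT _ (mA i); rewrite setTI.
Qed.

(* The model provides independence of eps_i and x_i for each i and of the data;
   together they make the noise vector independent of the design. *)
Lemma indep_design (B : 'I_n -> set R) (A : set (mxT n p)) :
  (forall i, measurable (B i)) -> measurable A ->
  (P (\bigcap_(i in [set: 'I_n]) (eps i @^-1` B i) `&` X @^-1` A) =
   P (\bigcap_(i in [set: 'I_n]) (eps i @^-1` B i)) * P (X @^-1` A))%E.
Proof.
move=> mB mA; set E0 := \bigcap_(i in _) _.
have mE0 : measurable E0 by apply: fin_bigcap_measurable => // i _; exact: mepspre.
have c0 : 0 <= fine (P E0) by rewrite fine_ge0.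
have cE : (P E0 = (fine (P E0))%:E)%E by rewrite fineK// fin_num_measure.
have mX := measurable_design.
pose G := preimage_set_system setT (X : T -> mxT n p) rectangles.
have GE : <<s G >> (X @^-1` A).
  rewrite /G g_sigma_preimageE; exists A; last by rewrite setTI.
  by move: mA; rewrite rectangles_generate.
(* The finite measures C |-> P(C and E0) and P(E0) P agree on preimages of [rectangles], hence on
   the sigma-algebra generated by the design. *)
pose m1 := mrestr P mE0.
pose m2 := mscale (NngNum c0) P.
have Gm : G `<=` measurable.
  move=> _ [C rC <-]; rewrite setTI; apply: mpre; rewrite rectangles_generate.
  exact: sub_sigma_algebra.
have m1m2 C : G C -> m1 C = m2 C.
  move=> [_ [A' [mA' ->]] <-]; rewrite setTI /m1 /m2 /mrestr /mscale /= -cE.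
  have rE : X @^-1` [set M | forall i, A' i (row i M)^T] =
      \bigcap_(i in [set: 'I_n]) (x i @^-1` A' i).
    have rX i w : (row i (X w))^T = x i w by apply/colP => j; rewrite !mxE.
    by apply/seteqP; split=> w /= h i; [move=> _|]; have := h i; rewrite rX //; apply.
  rewrite rE setIC -bigcapI indep_rectangle//.
  have := indep_rectangle (fun=> measurableT) mA'.
  under eq_bigcapr do rewrite preimage_setT setTI.
  move=> ->; rewrite eps_independent// -big_split /=.
  by apply: eq_bigr => i _; rewrite preimage_setT probability_setT mul1e.
rewrite setIC; transitivity (m1 (X @^-1` A)) => //.
rewrite cE -[RHS]/(m2 (X @^-1` A)).
apply: (@g_sigma_algebra_measure_unique _ R T G Gm (fun=> setT)) => //.
- move=> _; exists setT; last by rewrite setTI preimage_setT.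
  by exists (fun=> setT); split=> //; apply/seteqP; split.
- by rewrite bigcup_const//; exists 0%N.
- move=> _ _ [C1 [A1 [mA1 ->]] <-] [C2 [A2 [mA2 ->]] <-]; rewrite !setTI.
  exists [set M | forall i, (A1 i `&` A2 i) (row i M)^T].
    by exists (fun i => A1 i `&` A2 i); split=> // i; exact: measurableI.
  rewrite setTI; apply/seteqP; split=> w /=.
    by move=> h; split=> i; case: (h i).
  by move=> [h1 h2] i; split.
- by move=> _; rewrite /= /mrestr setTI; apply: (le_lt_trans (probability_le1 P mE0)); exact: ltry.
Qed.

End IndepNoise.

Lemma max_pos_neg (R : realType) (r : R) : Num.max (1 * r) 0 - Num.max (-1 * r) 0 = r.
Proof.
rewrite mul1r mulN1r; case/orP: (le_total 0 r) => h.
  by rewrite (max_l h) max_r ?subr0// oppr_le0.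
by rewrite (max_r h) max_l ?sub0r ?opprK// oppr_ge0.
Qed.

(** * Calculus of integrable real functions *)

Section RealIntegral.
Context {disp : measure_display} {T : measurableType disp} {R : realType}.
Variable P : probability T R.

(** Integrability and a real value travel together, so linear combinations need no separate
    finiteness argument. *)
Definition has_int (f : T -> R) (v : R) : Prop :=
  P.-integrable setT (EFin \o f) /\ (\int[P]_w (f w)%:E = v%:E)%E.

Lemma has_int_measurable f v : has_int f v -> measurable_fun setT f.
Proof. by move=> [/measurable_int /measurable_EFinP]. Qed.

Lemma has_intD f g u v : has_int f u -> has_int g v ->
  has_int (fun w => f w + g w) (u + v).
Proof.
move=> [fi fu] [gi gv]; split.
  rewrite (_ : EFin \o _ = (EFin \o f) \+ (EFin \o g))%E; first exact: integrableD.
  by apply/funext => w /=; rewrite EFinD.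
by under eq_integral do rewrite EFinD; rewrite integralD//= fu gv.
Qed.

Lemma has_intZ c f u : has_int f u -> has_int (fun w => c * f w) (c * u).
Proof.
move=> [fi fu]; split.
  rewrite (_ : EFin \o _ = (fun w => c%:E * (EFin \o f) w))%E; first exact: integrableZl.
  by apply/funext => w /=; rewrite EFinM.
by under eq_integral do rewrite EFinM; rewrite (integralZl measurableT fi) fu.
Qed.

Lemma has_intB f g u v : has_int f u -> has_int g v ->
  has_int (fun w => f w - g w) (u - v).
Proof.
move=> hf hg; have := has_intD hf (has_intZ (-1) hg).
by rewrite mulN1r; under eq_fun do rewrite mulN1r.
Qed.

Lemma has_int0 : has_int (fun=> 0) 0.
Proof. by split; [exact: integrable0|rewrite integral_cst//= mul0e]. Qed.

Lemma has_int_sum (J : finType) (f : J -> T -> R) v :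
  (forall j, has_int (f j) (v j)) -> has_int (fun w => \sum_j f j w) (\sum_j v j).
Proof.
move=> h; elim: (index_enum J) => [|j s IH].
  by rewrite big_nil; under eq_fun do rewrite big_nil; exact: has_int0.
by rewrite big_cons; under eq_fun do rewrite big_cons; exact: has_intD.
Qed.

Lemma has_int_eq f g u v : f =1 g -> u = v -> has_int f u -> has_int g v.
Proof. by move=> /funext -> ->. Qed.

Lemma has_int_ge0 (f : T -> R) v : measurable_fun setT f -> (forall w, 0 <= f w) ->
  (\int[P]_w (f w)%:E = v%:E)%E -> has_int f v.
Proof. by move=> mf f0 fv; split=> //; apply: integrable_ge0_lty; rewrite ?fv ?ltry. Qed.

Lemma has_int_bounded (f : T -> R) C : measurable_fun setT f -> (forall w, `|f w| <= C) ->
  exists v, has_int f v.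
Proof.
move=> mf fC.
have fi : P.-integrable setT (EFin \o f).
  apply: (@le_integrable _ _ _ _ setT _ _ (EFin \o (fun=> C))) => //.
  - exact/measurable_EFinP.
  - by move=> w _ /=; rewrite lee_fin (le_trans (fC w))// ler_norm.
  - exact: finite_measure_integrable_cst.
exists (fine (\int[P]_w (f w)%:E)); split=> //.
by rewrite fineK//; exact: integrable_fin_num fi.
Qed.

Lemma has_int_integrable (f : T -> R) : P.-integrable setT (EFin \o f) -> exists v, has_int f v.
Proof.
move=> fi; exists (fine (\int[P]_w (f w)%:E)); split=> //.
by rewrite fineK//; exact: integrable_fin_num fi.
Qed.

(** Signed version of [integral_mul_indep], applied to the positive and the negative part of [q]. *)
Lemma has_int_mul_indep (q H : T -> R) (c e : R) :
  has_int q e -> measurable_fun setT H -> (forall w, 0 <= H w) -> 0 <= c ->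
  (forall B : set R, measurable B ->
     (\int[P]_(w in q @^-1` B) (H w)%:E = c%:E * P (q @^-1` B))%E) ->
  has_int (fun w => q w * H w) (c * e).
Proof.
move=> qe mH H0 c0 qH.
have mq := has_int_measurable qe.
have part (s : R) : `|s| = 1 -> exists v, has_int (fun w => Num.max (s * q w) 0) v /\
    has_int (fun w => Num.max (s * q w) 0 * H w) (c * v).
  move=> s1; pose g r := Num.max (s * r) 0 : R.
  have mg : measurable_fun setT g.
    by apply: measurable_maxr => //; apply: measurable_funM.
  have mgq : measurable_fun setT (fun w => g (q w)) by apply: measurableT_comp.
  have gi : P.-integrable setT (EFin \o (fun w => g (q w))).
    apply: (@le_integrable _ _ _ _ setT _ _ (EFin \o q)) => //; last by case: qe.
      exact/measurable_EFinP.
    move=> w _ /=; rewrite lee_fin -[leRHS]mul1r -s1 -normrM /g.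
    by rewrite /Num.max; case: ifP => _; rewrite ?normr0.
  have [v gv] := has_int_integrable gi.
  exists v; split=> //; apply: has_int_ge0.
  - exact: measurable_funM.
  - by move=> w; rewrite mulr_ge0// le_max lexx orbT.
  - rewrite (integral_mul_indep (c := c))//.
    + by case: gv => _ ->; rewrite -EFinM.
    + by move=> w; rewrite le_max lexx orbT.
    + move=> B mB; apply: (qH (g @^-1` B)).
      by rewrite -[_ @^-1` _]setTI; apply: mg.
have [vp [qp hp]] := part 1 (normr1 _).
have [vn [qn hn]] := part (-1) (normrN1 _).
have qE w : Num.max (1 * q w) 0 - Num.max (-1 * q w) 0 = q w.
  exact: max_pos_neg.
have ve : vp - vn = e.
  have := has_intB qp qn; under eq_fun do rewrite qE.
  by move=> [_ h]; apply: EFin_inj; rewrite -h; case: qe.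
apply: has_int_eq (has_intB hp hn).
  by move=> w /=; rewrite -mulrBl qE.
by rewrite -mulrBr ve.
Qed.

End RealIntegral.

(** * Noise moments against a weight depending on the design *)

Section CrossMoments.
Context {disp : measure_display} {T : measurableType disp} {R : realType}.
Variable P : probability T R.
Context {n p : nat}.
Variables (theta lam : 'cV[R]_p) (sigma sigma_x : R).
Variables (x : 'I_n -> T -> 'cV[R]_p) (eps y : 'I_n -> T -> R).
Hypothesis model : regression_model P theta lam sigma sigma_x x eps y.

Let X := design x.
Let meps i : measurable_fun setT (eps i). Proof. exact: (model_eps_measurable model). Qed.
Let mepspre i (B : set R) : measurable B -> measurable (eps i @^-1` B).
Proof. by move=> mB; rewrite -[_ @^-1` _]setTI; exact: meps. Qed.

Lemma has_int_eps_sqr k : has_int P (fun w => eps k w ^+ 2) (sigma ^+ 2).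
Proof.
apply: has_int_ge0; first exact: measurable_funX.
  by move=> w; rewrite sqr_ge0.
have := model_eps_var model k; rewrite /variance unlock (model_eps_mean model) unlock => <-.
by apply: eq_integral => w _; rewrite !fctE /= subr0 expr2.
Qed.

(** Integrability comes from the second moment through |a| <= 1 + a^2. *)
Lemma has_int_eps k : has_int P (eps k) 0.
Proof.
split; last by have := model_eps_mean model k; rewrite unlock.
apply: (@le_integrable _ _ _ _ setT _ _ (EFin \o (fun w => 1 + eps k w ^+ 2))) => //.
- exact/measurable_EFinP.
- move=> w _ /=; rewrite lee_fin (ger0_norm (addr_ge0 ler01 (sqr_ge0 _))).
  rewrite -(real_normK (num_real (eps k w))); move: `|_| => a.
  by have := sqr_ge0 (a - 1); have := sqr_ge0 a; rewrite !expr2; lra.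
- rewrite (_ : EFin \o _ = (EFin \o (fun=> 1%R)) \+ (EFin \o (fun w => eps k w ^+ 2)%R))%E.
    apply: integrableD => //; first exact: finite_measure_integrable_cst.
    by case: (has_int_eps_sqr k).
  by apply/funext => w /=; rewrite EFinD.
Qed.

Section Weight.
Variable c : 'M[R]_(n, p) -> R.
Hypothesis mc : measurable_fun setT (c : mxT n p -> R).

Section Nonneg.
Hypothesis c0 : forall M, 0 <= c M.
Variable e : R.
Hypothesis ce : has_int P (fun w => c (X w)) e.

Let mcX : measurable_fun setT (fun w => c (X w)).
Proof. by have := measurableT_comp mc (measurable_design model). Qed.

Let e0 : 0 <= e.
Proof. by rewrite -lee_fin -(proj2 ce); apply: integral_ge0 => w _; rewrite lee_fin. Qed.

(** In [integral_mul_indep] the weight c(X) is the variable [q] and the indicator of the noise event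
    is [H]; [indep_design] supplies the product rule. *)
Lemma weight_eps_event (B : 'I_n -> set R) : (forall i, measurable (B i)) ->
  (\int[P]_(w in \bigcap_(i in [set: 'I_n]) (eps i @^-1` B i)) (c (X w))%:E =
   e%:E * P (\bigcap_(i in [set: 'I_n]) (eps i @^-1` B i)))%E.
Proof.
move=> mB; set E0 := \bigcap_(i in _) _.
have mE0 : measurable E0 by apply: fin_bigcap_measurable => // i _; exact: mepspre.
have PE0 : P E0 \is a fin_num by rewrite fin_num_measure.
have := @integral_mul_indep _ _ _ P (fun w => c (X w)) \1_E0 (fine (P E0)) mcX
  (measurable_indic mE0) (fun w => c0 (X w)) (fun w => _) _ _.
rewrite (proj2 ce) fineK// muleC => <-.
- by rewrite integral_mkcond; apply: eq_integral => w _; rewrite epatch_indic EFinM.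
- by move=> w; rewrite indicE.
- by rewrite fine_ge0.
- move=> B' mB'.
  have mA : measurable (c @^-1` B' : set (mxT n p)) by rewrite -[_ @^-1` _]setTI; apply: mc.
  have := indep_design model mB mA; rewrite -/E0 => h.
  rewrite integral_indic ?fineK//.
  by rewrite -[_ @^-1` _]setTI; apply: mcX.
Qed.

Lemma weight_eps1 k (B : set R) : measurable B ->
  (\int[P]_(w in eps k @^-1` B) (c (X w))%:E = e%:E * P (eps k @^-1` B))%E.
Proof.
move=> mB.
have := @weight_eps_event (fun i => if i == k then B else setT).
rewrite (_ : \bigcap_(i in _) _ = eps k @^-1` B); last first.
  apply/seteqP; split=> w /=; first by move=> /(_ k I) /=; rewrite eqxx.
  by move=> h i _ /=; case: eqP => [->|].
by apply=> i; case: ifP.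
Qed.

Lemma weight_eps2 k l (B C : set R) : k != l -> measurable B -> measurable C ->
  (\int[P]_(w in eps k @^-1` B `&` eps l @^-1` C) (c (X w))%:E =
    e%:E * (P (eps k @^-1` B) * P (eps l @^-1` C)))%E.
Proof.
move=> kl mB mC.
pose D i := if i == k then B else if i == l then C else setT.
have mD i : measurable (D i) by rewrite /D; case: ifP => // _; case: ifP.
have := weight_eps_event mD; rewrite (eps_independent model mD).
rewrite (_ : \bigcap_(i in _) _ = eps k @^-1` B `&` eps l @^-1` C); last first.
  apply/seteqP; split=> w /=.
    move=> h; split; first by have := h k I; rewrite /D /= eqxx.
    by have := h l I; rewrite /D /= eq_sym (negPf kl) eqxx.
  by move=> [h1 h2] i _ /=; rewrite /D; case: eqP => [->//|_]; case: eqP => [->|].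
move=> ->; congr (_ * _)%E; rewrite (bigD1 k)//= (bigD1 l)//=; last by rewrite eq_sym.
rewrite {1}/D eqxx {1}/D eq_sym (negPf kl) eqxx big1 ?mule1// => i /andP[ik il].
by rewrite /D (negPf ik) (negPf il) preimage_setT probability_setT.
Qed.

Lemma has_int_weight_eps k : has_int P (fun w => c (X w) * eps k w) 0.
Proof.
apply: (has_int_eq _ _ (has_int_mul_indep (has_int_eps k) mcX (fun w => c0 (X w)) e0 (@weight_eps1 k))).
  by move=> w /=; rewrite mulrC.
by rewrite mulr0.
Qed.

Lemma has_int_weight_eps_sqr k : has_int P (fun w => c (X w) * eps k w ^+ 2) (e * sigma ^+ 2).
Proof.
apply: (has_int_eq _ _ (has_int_mul_indep (has_int_eps_sqr k) mcX (fun w => c0 (X w)) e0 _)) => //.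
  by move=> w /=; rewrite mulrC.
move=> B mB; apply: (@weight_eps1 k ((fun r => r ^+ 2) @^-1` B)).
by rewrite -[_ @^-1` _]setTI; apply: exprn_measurable.
Qed.

(** The positive and negative parts of [eps l] are absorbed in turn into the non-negative weight;
    the enlarged weight still obeys the product rule with events of [eps k], whose mean is 0. *)
Lemma has_int_weight_eps2 k l : k != l -> has_int P (fun w => c (X w) * (eps k w * eps l w)) 0.
Proof.
move=> kl.
have part (s : R) : has_int P (fun w => eps k w * (Num.max (s * eps l w) 0 * c (X w))) 0.
  pose g r := Num.max (s * r) 0 : R.
  have mg : measurable_fun setT g.
    by apply: measurable_maxr => //; apply: measurable_funM.
  have mge : measurable_fun setT (fun w => g (eps l w)) by apply: measurableT_comp.
  have g0 r : 0 <= g r by rewrite le_max lexx orbT.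
  have gi : P.-integrable setT (EFin \o (fun w => g (eps l w))).
    apply: (@le_integrable _ _ _ _ setT _ _ (EFin \o (fun w => s * eps l w))) => //.
    - exact/measurable_EFinP.
    - move=> w _ /=; rewrite lee_fin /g /Num.max; case: ifP => _; rewrite ?normr0//.
    - by case: (has_intZ s (has_int_eps l)).
  have [v [_ gv]] := has_int_integrable gi.
  have v0 : 0 <= v.
    by rewrite -lee_fin -gv; apply: integral_ge0 => w _; rewrite lee_fin g0.
  have gc B : measurable B -> (\int[P]_(w in eps k @^-1` B) (g (eps l w) * c (X w))%:E =
      (v * e)%:E * P (eps k @^-1` B))%E.
    move=> mB.
    have mk := mepspre k mB.
    have Pk : P (eps k @^-1` B) \is a fin_num by rewrite fin_num_measure.
    have := @integral_mul_indep _ _ _ P (fun w => g (eps l w)) (fun w => c (X w) * \1_(eps k @^-1` B) w)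
      (e * fine (P (eps k @^-1` B))) mge _ (fun w => g0 _) _ _ _.
    rewrite gv => h.
    transitivity (\int[P]_w (g (eps l w) * (c (X w) * \1_(eps k @^-1` B) w))%:E)%E.
      rewrite integral_mkcond; apply: eq_integral => w _.
      by rewrite epatch_indic -EFinM mulrA.
    rewrite h.
    - by rewrite -[in RHS](fineK Pk) -!EFinM; congr EFin; ring.
    - by apply: measurable_funM => //; exact: measurable_indic.
    - by move=> w; rewrite mulr_ge0// indicE.
    - by rewrite mulr_ge0// fine_ge0.
    - move=> B' mB'; have mgB : measurable (g @^-1` B') by rewrite -[_ @^-1` _]setTI; apply: mg.
      have := weight_eps2 kl mB mgB; rewrite setIC => h2.
      rewrite EFinM fineK// -muleA -h2 [RHS]integral_mkcond [LHS]integral_mkcond.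
      apply: eq_integral => w _.
      by rewrite !epatch_indic indicI -!EFinM; congr EFin; rewrite /=; ring.
  apply: (has_int_eq _ _ (has_int_mul_indep (has_int_eps k) _ _ _ gc)).
  - by [].
  - by rewrite mulr0.
  - exact: measurable_funM.
  - by move=> w; rewrite mulr_ge0.
  - by rewrite mulr_ge0.
apply: (has_int_eq _ _ (has_intB (part 1) (part (-1)))); last by rewrite subr0.
move=> w /=; rewrite -mulrBr -mulrBl.
have -> : Num.max (1 * eps l w) 0 - Num.max (-1 * eps l w) 0 = eps l w.
  exact: max_pos_neg.
by ring.
Qed.

End Nonneg.
End Weight.
End CrossMoments.

(** * Ridge residual and bounds uniform in the design *)

Section RidgeAlgebra.
Context {R : realFieldType} {n p : nat}.
Variables (X : 'M[R]_(n, p)) (t : R).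
Hypothesis t0 : 0 < t.

Let S := X *m X^T.
Let G : 'M[R]_n := invmx (S + t%:M).
Let S0 u : 0 <= dot u (S *m u). Proof. by rewrite /S dot_gram sqn_ge0. Qed.
Let S_sym : S^T = S. Proof. by rewrite /S trmx_mul trmxK. Qed.

Lemma hatE : S *m G = 1%:M - t *: G.
Proof.
have u := ridge_unit t0 S0 S_sym.
by rewrite -(mulmxV u) mulmxDl mul_scalar_mx addrK.
Qed.

Lemma ridge_pos_residual (theta : 'cV[R]_p) (e : 'cV[R]_n) :
  X *m (X^T *m G *m (X *m theta + e) - theta) = - t *: (G *m (X *m theta)) + S *m G *m e.
Proof.
rewrite mulmxBr.
have -> : X *m (X^T *m G *m (X *m theta + e)) = S *m G *m (X *m theta + e).
  by rewrite /S !mulmxA.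
move: (X *m theta) => v; rewrite mulmxDr addrAC; congr (_ + _).
by rewrite hatE mulmxBl mul1mx -scalemxAl addrAC subrr add0r scaleNr.
Qed.

(** With u = G X theta, expand 0 <= |X^T u - theta|^2 using <u, X theta> = |X^T u|^2 + t |u|^2. The
    bound is uniform in [X], as [condE_quadratic] requires. *)
Lemma bias_bounded (theta : 'cV[R]_p) : t * sqn (G *m (X *m theta)) <= sqn theta.
Proof.
have h := invmx_ridgeP (X *m theta) t0 S0 S_sym.
set u := invmx _ *m _ in h; rewrite -/S -/G -/u.
have e : dot u (X *m theta) = sqn (X^T *m u) + t * sqn u.
  by rewrite -h dotDr dotZr /S dot_gram.
rewrite dot_mulmx in e.
have := sqn_ge0 (X^T *m u - theta); rewrite sqnD sqnN dotNr e.
have := sqn_ge0 (X^T *m u); have := mulr_ge0 (ltW t0) (sqn_ge0 u); lra.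
Qed.

Lemma hat_bounded (e : 'cV[R]_n) : sqn (S *m G *m e) <= sqn e.
Proof.
have h := invmx_ridgeP e t0 S0 S_sym.
rewrite -mulmxA -/S -/G; set u := G *m e; rewrite -/S -/G -/u in h.
rewrite -h sqnD dotZr sqnZ (dotC (S *m u)).
have := mulr_ge0 (ltW t0) (S0 u); have := mulr_ge0 (sqr_ge0 t) (sqn_ge0 u); lra.
Qed.

End RidgeAlgebra.

(** * Quadratic functions of the noise with bounded coefficients *)

Section Quadratic.
Context {disp : measure_display} {T : measurableType disp} {R : realType}.
Variable P : probability T R.
Context {n p : nat}.
Variables (theta lam : 'cV[R]_p) (sigma sigma_x : R).
Variables (x : 'I_n -> T -> 'cV[R]_p) (eps y : 'I_n -> T -> R).
Hypothesis model : regression_model P theta lam sigma sigma_x x eps y.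

Let X := design x.

Section Weight.
Variables (c : 'M[R]_(n, p) -> R) (C : R).
Hypothesis mc : measurable_fun setT (c : @mxT R n p -> R).
Hypothesis cC : forall M, `|c M| <= C.

Let C0 : 0 <= C. Proof. exact: le_trans (normr_ge0 _) (cC 0). Qed.
(** Adding the bound [C] makes the weight non-negative; the identities for the constant weight [C]
    are subtracted afterwards. *)
Let c1 M := c M + C.
Let mc1 : measurable_fun setT (c1 : @mxT R n p -> R).
Proof. exact: measurable_funD. Qed.
Let c10 M : 0 <= c1 M.
Proof. by rewrite /c1 -lerBlDr sub0r; have := cC M; rewrite ler_norml => /andP[]. Qed.
Let c1C M : `|c1 M| <= C + C.
Proof. by rewrite ger0_norm// /c1 lerD2r (le_trans (ler_norm _)). Qed.

Lemma has_int_weight : exists v, has_int P (fun w => c (X w)) v.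
Proof.
apply: (@has_int_bounded _ _ _ P _ C) => [|w]; last exact: cC.
by have := measurableT_comp mc (measurable_design model).
Qed.

Let mCst : measurable_fun setT ((fun=> C) : @mxT R n p -> R).
Proof. exact: measurable_cst. Qed.

Let c1_int : exists v, has_int P (fun w => c1 (X w)) v.
Proof.
apply: (@has_int_bounded _ _ _ P _ (C + C)) => [|w]; last exact: c1C.
by have := measurableT_comp mc1 (measurable_design model).
Qed.

Let C_int : has_int P (fun w : T => C) C.
Proof.
split; first exact: finite_measure_integrable_cst.
by rewrite integral_cst//= probability_setT mule1.
Qed.

Lemma bounded_eps k : has_int P (fun w => c (X w) * eps k w) 0.
Proof.
have [v v1] := c1_int.
have h1 := has_int_weight_eps model mc1 c10 v1 k.
have h2 := has_int_weight_eps model (c := fun=> C) mCst (fun=> C0) C_int k.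
apply: has_int_eq (has_intB h1 h2); last by rewrite subr0.
by move=> w /=; rewrite /c1 -/X; ring.
Qed.

Lemma bounded_eps2 k l : k != l -> has_int P (fun w => c (X w) * (eps k w * eps l w)) 0.
Proof.
move=> kl; have [v v1] := c1_int.
have h1 := has_int_weight_eps2 model mc1 c10 v1 kl.
have h2 := has_int_weight_eps2 model (c := fun=> C) mCst (fun=> C0) C_int kl.
apply: has_int_eq (has_intB h1 h2); last by rewrite subr0.
by move=> w /=; rewrite /c1 -/X; ring.
Qed.

Lemma bounded_eps_sqr k v : has_int P (fun w => c (X w)) v ->
  has_int P (fun w => c (X w) * (eps k w * eps k w)) (v * sigma ^+ 2).
Proof.
move=> cv; have v1 := has_intD cv C_int.
have h1 := has_int_weight_eps_sqr model mc1 c10 v1 k.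
have h2 := has_int_weight_eps_sqr model (c := fun=> C) mCst (fun=> C0) C_int k.
apply: has_int_eq (has_intB h1 h2); last by ring.
by move=> w /=; rewrite /c1 -/X; ring.
Qed.

End Weight.

(* The noise has only two moments, so conditional expectations are handled by
   testing against a bounded weight a, with bounded b and H. *)
Lemma condE_quadratic (a : 'M[R]_(n, p) -> R) (b : 'M[R]_(n, p) -> 'cV[R]_n)
    (H : 'M[R]_(n, p) -> 'M[R]_n) C :
  measurable_fun setT (a : @mxT R n p -> R) -> (forall M, `|a M| <= 1) ->
  (forall r, measurable_fun setT ((fun M => b M r 0) : @mxT R n p -> R)) ->
  (forall M r, `|b M r 0| <= C) ->
  (forall r k, measurable_fun setT ((fun M => H M r k) : @mxT R n p -> R)) ->
  (forall M r k, `|H M r k| <= 1) ->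
  exists v,
    has_int P (fun w => a (X w) * sqn (b (X w) + H (X w) *m (\col_i eps i w))) v /\
    has_int P (fun w => a (X w) * (sqn (b (X w)) + sigma ^+ 2 * fro (H (X w)))) v.
Proof.
move=> ma a1 mb bC mH H1.
have C0 (r : 'I_n) : 0 <= C by exact: le_trans (normr_ge0 _) (bC 0 r).
pose cb r M := a M * (b M r 0 * b M r 0).
have mcb r : measurable_fun setT (cb r : @mxT R n p -> R).
  by apply: measurable_funM => //; apply: measurable_funM.
have cbC r M : `|cb r M| <= 1 * (C * C) by rewrite !normrM !ler_pM// mulr_ge0.
pose c1 r k M := a M * (2 * (b M r 0 * H M r k)).
have mc1 r k : measurable_fun setT (c1 r k : @mxT R n p -> R).
  by apply: measurable_funM => //; apply: measurable_funM => //; apply: measurable_funM.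
have c1C r k M : `|c1 r k M| <= 1 * (2 * (C * 1)).
  by rewrite !normrM (ger0_norm (x := 2))// !ler_pM// !mulr_ge0.
pose c2 r k l M := a M * (H M r k * H M r l).
have mc2 r k l : measurable_fun setT (c2 r k l : @mxT R n p -> R).
  by apply: measurable_funM => //; apply: measurable_funM.
have c2C r k l M : `|c2 r k l M| <= 1 * (1 * 1) by rewrite !normrM !ler_pM// mulr_ge0.
have hb r := has_int_weight (mcb r) (cbC r).
have h2 r k := has_int_weight (mc2 r k k) (c2C r k k).
have [vb hvb] := choice hb.
have [v2 hv2] : exists v2, forall r k, has_int P (fun w => c2 r k k (X w)) (v2 r k).
  have [f hf] := choice (fun rk : 'I_n * 'I_n => h2 rk.1 rk.2).
  by exists (fun r k => f (r, k)) => r k; exact: (hf (r, k)).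
exists (\sum_r (vb r + \sum_k v2 r k * sigma ^+ 2)); split.
  have hs r : has_int P (fun w => cb r (X w) + (\sum_k c1 r k (X w) * eps k w
      + \sum_k \sum_l c2 r k l (X w) * (eps k w * eps l w))) (vb r + \sum_k v2 r k * sigma ^+ 2).
    apply: has_intD => //.
    rewrite -[X in has_int _ _ X]add0r; apply: has_intD.
      apply: (has_int_eq (fun w => erefl) _ (has_int_sum (fun k => bounded_eps (mc1 r k) (c1C r k) k))).
      by rewrite big1.
    apply: has_int_sum => k.
    have hk l : has_int P (fun w => c2 r k l (X w) * (eps k w * eps l w)) (if l == k then v2 r k * sigma ^+ 2 else 0).
      case: eqP => [->|/eqP lk]; first exact: (bounded_eps_sqr (mc2 r k k) (c2C r k k)).
      by apply: (bounded_eps2 (mc2 r k l) (c2C r k l)); rewrite eq_sym.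
    apply: (has_int_eq (fun w => erefl) _ (has_int_sum hk)).
    by rewrite -big_mkcond big_pred1_eq.
  apply: (has_int_eq _ erefl (has_int_sum hs)) => w /=.
  rewrite /sqn /dot mulr_sumr; apply: eq_bigr => r _.
  set M := X w; rewrite /cb /c1 /c2.
  have -> : (b M + H M *m (\col_i eps i w)) r 0 = b M r 0 + \sum_k H M r k * eps k w.
    by rewrite mxE mxE; congr (_ + _); apply: eq_bigr => k _; rewrite mxE.
  set s := \sum_k H M r k * eps k w.
  have -> : \sum_k a M * (2 * (b M r 0 * H M r k)) * eps k w = a M * (2 * b M r 0 * s).
    by rewrite /s !mulr_sumr; apply: eq_bigr => k _; ring.
  have -> : \sum_k \sum_l a M * (H M r k * H M r l) * (eps k w * eps l w) = a M * (s * s).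
    rewrite {1}/s mulr_suml mulr_sumr; apply: eq_bigr => k _.
    by rewrite /s !mulr_sumr; apply: eq_bigr => l _; ring.
  by ring.
have hs r : has_int P (fun w => cb r (X w) + \sum_k sigma ^+ 2 * c2 r k k (X w)) (vb r + \sum_k v2 r k * sigma ^+ 2).
  apply: has_intD => //; apply: has_int_sum => k; rewrite mulrC.
  exact: has_intZ.
apply: (has_int_eq _ erefl (has_int_sum hs)) => w /=.
rewrite /sqn /dot /fro mulrDr !mulr_sumr -big_split /=; apply: eq_bigr => r _.
congr (_ + _); rewrite !mulr_sumr; apply: eq_bigr => k _.
by rewrite /c2 expr2; ring.
Qed.

End Quadratic.

(** * Identification of a conditional expectation *)

Section CondExpectation.
Context {disp : measure_display} {T : measurableType disp} {R : realType}.
Variable P : probability T R.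

Lemma has_int0_ae (f : T -> R) : (forall w, 0 <= f w) -> has_int P f 0 ->
  {ae P, forall w, f w = 0}.
Proof.
move=> f0 [fi fz].
have mf : measurable_fun setT (EFin \o f) by exact: measurable_int fi.
have h : (\int[P]_w `|(EFin \o f) w| = 0)%E.
  apply: (etrans _ fz); apply: eq_integral => w _; rewrite gee0_abs// lee_fin.
  exact: f0.
have := (ae_eq_integral_abs P measurableT mf).1 h.
by apply: filterS => w /(_ I) /= [].
Qed.

Lemma condE_ae_eq m n (X : T -> 'M[R]_(m, n)) (Z W : T -> R) (F : 'M[R]_(m, n) -> R) :
  measurable_fun setT (X : T -> mxT m n) ->
  is_condE P (sigma_gen X) Z W -> (forall w, 0 <= Z w) ->
  measurable_fun setT (F : mxT m n -> R) ->
  (forall A : set (mxT m n), measurable A -> exists v,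
     has_int P (fun w => \1_A (X w) * Z w) v /\
     has_int P (fun w => \1_A (X w) * F (X w)) v) ->
  {ae P, forall w, W w = F (X w)}.
Proof.
move=> mX [mW iW WZ] Z0 mF h.
pose TX := g_sigma_algebra_preimageType (X : T -> mxT m n).
have mWX : measurable_fun setT (W : TX -> R).
  by move=> _ B mB; rewrite setTI; exact: (mW B mB).
have mFX : measurable_fun setT ((fun w => F (X w)) : TX -> R).
  move=> _ B mB; rewrite setTI; exists (F @^-1` B); last by rewrite setTI.
  by rewrite -[_ @^-1` _]setTI; apply: mF.
have side (s : R) : {ae P, forall w, ~ (0 < s * (W w - F (X w)))}.
  (* [D] lies in the sigma-algebra of [X], hence is X^-1(A), and both [WZ] and [h] can be tested on
     it. The integral of s (W - F) over [D] is then 0 although the integrand is positive there, so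
     [D] is null. *)
  pose D := [set w : TX | 0 < s * (W w - F (X w))].
  have mD : measurable D.
    have := @measurable_fun_ltr _ TX R setT (cst 0) (fun w => s * (W w - F (X w))) (measurable_cst _).
    move=> /(_ (measurable_funM (measurable_cst _) (measurable_funB mWX mFX)) measurableT [set true] I).
    by rewrite setTI.
  have [A mA DA] := mD; rewrite setTI in DA.
  have DAw w : \1_A (X w) = \1_(D : set T) w :> R by rewrite -DA.
  have [v [hZ hF]] := h A mA.
  have mDT : measurable (D : set T).
    by rewrite -DA -[_ @^-1` _]setTI; exact: mX.
  have patchE (f : T -> R) : (\int[P]_w (\1_A (X w) * f w)%:E = \int[P]_(w in (D : set T)) (f w)%:E)%E.
    rewrite [RHS]integral_mkcond; apply: eq_integral => w _.
    by rewrite epatch_indic DAw -EFinM mulrC.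
  have hW : has_int P (fun w => \1_A (X w) * W w) v.
    split.
      have := integrableS measurableT mDT (@subsetT _ _) iW.
      move=> /(integrable_mkcond _ mDT).
      apply: eq_integrable => // w _.
      by rewrite epatch_indic /= DAw -EFinM mulrC.
    by rewrite -(proj2 hZ) !patchE; exact: WZ.
  have hd : has_int P (fun w => s * (\1_A (X w) * W w - \1_A (X w) * F (X w))) 0.
    by apply: has_int_eq (has_intZ s (has_intB hW hF)); rewrite ?subrr ?mulr0.
  have := has_int0_ae _ hd.
  have nn w : 0 <= s * (\1_A (X w) * W w - \1_A (X w) * F (X w)).
    rewrite -mulrBr DAw indicE; case: (boolP (w \in _)) => wD; last by rewrite mul0r mulr0.
    by rewrite mul1r ltW//; move: wD; rewrite inE.
  move=> /(_ nn); apply: filterS => w; rewrite -mulrBr DAw indicE => e wD.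
  by move: e; rewrite mem_set//= mul1r => e; rewrite e ltxx in wD.
apply: filterS2 (side 1) (side (-1)) => w h1 h2; rewrite mul1r mulN1r in h1 h2.
apply/eqP; rewrite -subr_eq0; apply/eqP; move: h1 h2 => /negP h1 /negP h2.
by apply/le_anti; move: h1 h2; rewrite -!leNgt oppr_le0 => -> ->.
Qed.

End CondExpectation.

(** * The in-sample error at a fixed positive tau *)

Section RidgeRisk.
Context {disp : measure_display} {T : measurableType disp} {R : realType}.
Variable P : probability T R.
Context {n p : nat}.
Variables (theta lam : 'cV[R]_p) (sigma sigma_x : R).
Variables (x : 'I_n -> T -> 'cV[R]_p) (eps y : 'I_n -> T -> R).
Hypothesis model : regression_model P theta lam sigma sigma_x x eps y.
Variable m : 'M[R]_(n, p) -> R -> R.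
Hypothesis mse : in_sample_mse P theta (design x) (response y) m.
Hypothesis n0 : (0 < n)%N.
Variable tau : R.
Hypothesis tau0 : 0 < tau.

Let t := n%:R * tau.
Let t0 : 0 < t. Proof. by rewrite mulr_gt0// ltr0n. Qed.
Let G (M : 'M[R]_(n, p)) : 'M[R]_n := invmx (M *m M^T + t%:M).
Let b (M : 'M[R]_(n, p)) : 'cV[R]_n := - t *: (G M *m (M *m theta)).
Let H (M : 'M[R]_(n, p)) : 'M[R]_n := M *m M^T *m G M.

Let mid i j : measurable_fun setT ((fun M : 'M[R]_(n, p) => M i j) : @mxT R n p -> R).
Proof. exact: measurable_coord. Qed.

Let mtr i j : measurable_fun setT ((fun M : 'M[R]_(n, p) => M^T i j) : @mxT R n p -> R).
Proof. by under eq_fun do rewrite mxE; exact: mid. Qed.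

Let mG i j : measurable_fun setT ((fun M => G M i j) : @mxT R n p -> R).
Proof.
apply: (@measurable_invmx _ (@mxT R n p) R n (fun M : 'M[R]_(n, p) => M *m M^T + t%:M)).
  move=> k l; under eq_fun do rewrite mxE; apply: measurable_funD => //.
  by apply: (@measurable_mulmx _ (@mxT R n p) R _ _ _ (fun M : 'M[R]_(n, p) => M) (fun M : 'M[R]_(n, p) => M^T)).
move=> M; apply: ridge_unit => //; last by rewrite trmx_mul trmxK.
by move=> u; rewrite dot_gram sqn_ge0.
Qed.

Let mH i j : measurable_fun setT ((fun M => H M i j) : @mxT R n p -> R).
Proof.
apply: (@measurable_mulmx _ (@mxT R n p) R _ _ _ (fun M : 'M[R]_(n, p) => M *m M^T) G) => //.
by apply: (@measurable_mulmx _ (@mxT R n p) R _ _ _ (fun M : 'M[R]_(n, p) => M) (fun M : 'M[R]_(n, p) => M^T)).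
Qed.

Let mb i : measurable_fun setT ((fun M => b M i 0) : @mxT R n p -> R).
Proof.
under eq_fun do rewrite mxE; apply: measurable_funM => //.
apply: (@measurable_mulmx _ (@mxT R n p) R _ _ _ G (fun M : 'M[R]_(n, p) => M *m theta)) => //.
by apply: (@measurable_mulmx _ (@mxT R n p) R _ _ _ (fun M : 'M[R]_(n, p) => M) (fun M : 'M[R]_(n, p) => theta)).
Qed.

Let coord_le k (v : 'cV[R]_k) i : v i 0 ^+ 2 <= sqn v.
Proof.
rewrite /sqn /dot (bigD1 i)//= -expr2 lerDl sumr_ge0// => j _.
by rewrite -expr2 sqr_ge0.
Qed.

Let abs_le1 (r c : R) : 0 <= c -> r ^+ 2 <= c -> `|r| <= 1 + c.
Proof.
move=> c0 rc; rewrite -(@ler_pXn2r _ 2)// ?nnegrE ?addr_ge0// real_normK ?num_real//.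
by apply: (le_trans rc); rewrite sqrrD; have := sqr_ge0 c; lra.
Qed.

Let risk (M : 'M[R]_(n, p)) : R := ridge_risk M theta sigma tau.

Let riskE M : risk M = (sqn (b M) + sigma ^+ 2 * fro (H M)) / n%:R.
Proof. by rewrite /risk /ridge_risk /b /H sqnZ sqrrN. Qed.

Let residualE w :
  enorm (design x w *m (ridge (design x w) (response y w) tau - theta)) ^+ 2 / n%:R =
  (n%:R)^-1 * sqn (b (design x w) + H (design x w) *m (\col_i eps i w)).
Proof.
have enE k (v : 'cV[R]_k) : enorm v ^+ 2 = sqn v.
  rewrite /enorm sqr_sqrtr; last by apply: sumr_ge0 => j _; rewrite sqr_ge0.
  by apply: eq_bigr => j _; rewrite expr2.
rewrite enE mulrC /ridge tau0 /ridge_pos.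
have -> : response y w = design x w *m theta + \col_i eps i w.
  apply/colP => i; rewrite !mxE (model_eq model) mxE; congr (_ + _).
  by apply: eq_bigr => j _; rewrite !mxE.
by rewrite ridge_pos_residual.
Qed.

Lemma mse_ae : {ae P, forall w, m (design x w) tau = ridge_risk (design x w) theta sigma tau}.
Proof.
have mX := measurable_design model.
apply: (@condE_ae_eq _ _ _ P n p (design x) _ _ risk mX (mse_condE mse (ltW tau0))).
- by move=> w; rewrite divr_ge0// sqr_ge0.
- have -> : risk = fun M => (\sum_r (b M r 0 * b M r 0) + sigma ^+ 2 * \sum_i \sum_j (H M i j) ^+ 2) / n%:R.
    by apply/funext => M; rewrite riskE.
  apply: measurable_funM => //; apply: measurable_funD.
    by apply: measurable_sum => r; apply: measurable_funM.
  apply: measurable_funM => //; apply: measurable_sum => i; apply: measurable_sum => j.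
  exact: measurable_funX.
- move=> A mA.
  have ma : measurable_fun setT (\1_A : @mxT R n p -> R) by exact: measurable_indic.
  have a1 M : `|\1_A M : R| <= 1 by rewrite indicE; case: (_ \in _); rewrite ?normr1 ?normr0.
  have bC M r : `|b M r 0| <= 1 + t * sqn theta.
    apply: abs_le1; first by rewrite mulr_ge0 ?(ltW t0) ?sqn_ge0.
    apply: (le_trans (coord_le _ _)); rewrite /b sqnZ sqrrN expr2 -mulrA.
    by rewrite ler_wpM2l ?(ltW t0)//; exact: bias_bounded.
  have H1 M r k : `|H M r k| <= 1.
    rewrite -(@ler_pXn2r _ 2)// ?nnegrE// expr1n real_normK ?num_real//.
    have := hat_bounded M t0 (delta_mx k 0); rewrite sqn_delta; apply: le_trans.
    have := coord_le (M *m M^T *m invmx (M *m M^T + t%:M) *m delta_mx k 0) r.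
    by rewrite -colE mxE.
  have [v [h1 h2]] := condE_quadratic model ma a1 mb bC mH H1.
  exists ((n%:R)^-1 * v); split.
    apply: has_int_eq (has_intZ (n%:R)^-1 h1) => // w /=.
    by rewrite residualE mulrCA.
  apply: has_int_eq (has_intZ (n%:R)^-1 h2) => // w /=.
  by rewrite riskE; move: (sqn _ + _) => Q; rewrite mulrCA (mulrC Q).
Qed.

End RidgeRisk.

(** * The theorem *)

Lemma qnorm_sqr (R : realType) p (M : 'M[R]_p) b : 0 <= dot b (M *m b) ->
  qnorm M b ^+ 2 = dot b (M *m b).
Proof.
have -> : dot b (M *m b) = (b^T *m M *m b) 0 0.
  by rewrite -mulmxA [RHS]mxE; apply: eq_bigr => i _; rewrite [b^T _ _]mxE.
by move=> h; rewrite sqr_sqrtr.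
Qed.

Lemma invmx_diag (R : realType) d (l : 'cV[R]_d) : (forall k, l k 0 != 0) ->
  invmx (Diag l) = Diag (\col_k (l k 0)^-1).
Proof.
move=> l0; have h : Diag l *m Diag (\col_k (l k 0)^-1) = 1%:M.
  rewrite /Diag mulmx_diag -diag_const_mx; congr diag_mx; apply/rowP => k.
  by rewrite !mxE mulfV.
have [u _] := mulmx1_unit h.
by rewrite -[LHS]mulmx1 -h mulmxA mulVmx// mul1mx.
Qed.

(** * Head and tail decomposition of design and signal *)

Section Split.
Context {R : realType} {n p : nat}.
Variables (lam : 'cV[R]_p) (d : nat).
Hypothesis dp : (d < p)%N.
Hypothesis lam0 : forall j, 0 < lam j 0.

Lemma head_ltp (k : 'I_d) : (k < p)%N. Proof. exact: ltn_trans (ltn_ord k) dp. Qed.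

Lemma head_part_gt0 k : 0 < head_part d lam k 0.
Proof. by rewrite mxE -[k.+1]/((Ordinal (head_ltp k)).+1) entryE. Qed.

(** The head of the design is Z D^(1/2), so it maps theta_{1:d} to Z D v with v = D^(-1/2)
    theta_{1:d}. *)
Definition head_signal (theta : 'cV[R]_p) : 'cV[R]_d :=
  \col_k (entry theta k.+1 / Num.sqrt (entry lam k.+1)).

Lemma bias_eq theta :
  qnorm (invmx (Diag (head_part d lam))) (head_part d theta) ^+ 2 = sqn (head_signal theta).
Proof.
have e : dot (head_part d theta) (invmx (Diag (head_part d lam)) *m head_part d theta) =
    sqn (head_signal theta).
  rewrite invmx_diag => [|k]; last by rewrite gt_eqF// head_part_gt0.
  apply: eq_bigr => k _; rewrite /Diag mul_diag_mx mxE mxE mxE !mxE.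
  have := head_part_gt0 k; rewrite mxE; move: (entry lam _) (entry theta _) => a b a0.
  have s0 : Num.sqrt a != 0 by rewrite gt_eqF// sqrtr_gt0.
  rewrite -{1}(sqr_sqrtr (ltW a0)); field.
  exact: s0.
by rewrite qnorm_sqr e// sqn_ge0.
Qed.

Lemma tail_eq theta :
  qnorm (Diag (tail_part d lam)) (tail_part d theta) ^+ 2 =
  \sum_(j < p | (d <= j)%N) lam j 0 * theta j 0 ^+ 2.
Proof.
have e : dot (tail_part d theta) (Diag (tail_part d lam) *m tail_part d theta) =
    \sum_(j < p | (d <= j)%N) lam j 0 * theta j 0 ^+ 2.
  transitivity (\sum_(t < p - d) entry lam (d + t).+1 * entry theta (d + t).+1 ^+ 2).
    by apply: eq_bigr => t _; rewrite /Diag mul_diag_mx !mxE; ring.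
  rewrite (sum_tail (fun j => entry lam j.+1 * entry theta j.+1 ^+ 2) (ltnW dp)).
  by apply: eq_bigr => j _; rewrite !entryE.
rewrite qnorm_sqr e//; apply: sumr_ge0 => j _.
by rewrite mulr_ge0 ?sqr_ge0// ltW.
Qed.

Lemma eff_rankE : entry lam d.+1 * eff_rank lam d = \sum_(j < p | (d <= j)%N) lam j 0.
Proof.
have l0 : entry lam d.+1 != 0.
  by rewrite -[d.+1]/((Ordinal dp).+1) entryE gt_eqF.
rewrite /eff_rank mulrC divfK//.
rewrite big_add1 /=.
have -> : \sum_(d <= j < p) entry lam j.+1 = \sum_(t < p - d) entry lam (d + t).+1.
  by rewrite -{1}[d]add0n big_addn big_mkord; apply: eq_bigr => t _; rewrite addnC.
rewrite (sum_tail (fun j => entry lam j.+1) (ltnW dp)).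
by apply: eq_bigr => j _; rewrite entryE.
Qed.

Context {disp : measure_display} {T : measurableType disp}.
Variable x : 'I_n -> T -> 'cV[R]_p.

Lemma sum_split (F : nat -> R) :
  \sum_(j < p) F j = \sum_(k < d) F k + \sum_(t < p - d) F (d + t)%N.
Proof.
rewrite (sum_tail F (ltnW dp)) (sum_head F (ltnW dp)) (bigID (fun j : 'I_p => (j < d)%N)) /=.
by congr (_ + _); apply: eq_bigl => j; rewrite -leqNgt.
Qed.

Let blockE w i (k : 'I_d) :
  block lam x 0 d w i k = entry (x i w) k.+1 / Num.sqrt (entry lam k.+1).
Proof. by rewrite mxE add0n -[k.+1]/((Ordinal (head_ltp k)).+1) !entryE mxE. Qed.

Let sqrt_head (k : 'I_d) : Num.sqrt (entry lam k.+1) != 0.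
Proof. by rewrite gt_eqF// sqrtr_gt0 -[k.+1]/((Ordinal (head_ltp k)).+1) entryE. Qed.

Let sqrt_sqr (k : 'I_d) : Num.sqrt (entry lam k.+1) ^+ 2 = entry lam k.+1.
Proof. by rewrite sqr_sqrtr// -[k.+1]/((Ordinal (head_ltp k)).+1) entryE ltW. Qed.

Lemma gram_split w : design x w *m (design x w)^T =
  block lam x 0 d w *m diag_mx (head_part d lam)^T *m (block lam x 0 d w)^T
  + tail_design x d w *m (tail_design x d w)^T.
Proof.
apply/matrixP => i k; rewrite mxE [RHS]mxE.
transitivity (\sum_(j < p) entry (x i w) j.+1 * entry (x k w) j.+1).
  by apply: eq_bigr => j _; rewrite !mxE !entryE.
rewrite (sum_split (fun j => entry (x i w) j.+1 * entry (x k w) j.+1)); congr (_ + _).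
  rewrite mxE; apply: eq_bigr => j _.
  transitivity (block lam x 0 d w i j * head_part d lam j 0 * block lam x 0 d w k j).
    rewrite !blockE mxE -{2}(sqrt_sqr j); field.
    exact: sqrt_head.
  rewrite mul_mx_diag; congr (_ * _); last by rewrite [RHS]mxE.
  by rewrite [RHS]mxE; congr (_ * _); rewrite [RHS]mxE.
by rewrite mxE; apply: eq_bigr => t _; rewrite !mxE.
Qed.

Lemma signal_split w theta : design x w *m theta =
  block lam x 0 d w *m (diag_mx (head_part d lam)^T *m head_signal theta)
  + tail_design x d w *m tail_part d theta.
Proof.
apply/colP => i; rewrite mxE [RHS]mxE.
transitivity (\sum_(j < p) entry (x i w) j.+1 * entry theta j.+1).
  by apply: eq_bigr => j _; rewrite !mxE !entryE.
rewrite (sum_split (fun j => entry (x i w) j.+1 * entry theta j.+1)); congr (_ + _).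
  rewrite mxE; apply: eq_bigr => j _.
  transitivity (block lam x 0 d w i j * (head_part d lam j 0 * head_signal theta j 0)).
    rewrite !blockE !mxE -{2}(sqrt_sqr j); field.
    exact: sqrt_head.
  rewrite mul_diag_mx; congr (_ * _).
  by rewrite [RHS]mxE; congr (_ * _); rewrite [RHS]mxE.
by rewrite mxE; apply: eq_bigr => t _; rewrite !mxE.
Qed.

End Split.

(** * From rational tau to real tau *)

Section Limits.
Context {R : realType}.

(** Rationals are taken to the right of [tau] so that [tau = 0] is covered; the window [e] admits
    bounds valid only near [tau]. *)
Lemma rational_right_limit_ge (f : R -> R) a tau e : 0 <= tau -> 0 < e ->
  {within `[0, +oo[, continuous f} ->
  (forall q : rat, tau < ratr q < tau + e -> a <= f (ratr q)) -> a <= f tau.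
Proof.
move=> tau0 e0 /continuous_within_itvcyP [cf f0] fa.
have fr : f z @[z --> tau^'+] --> f tau.
  move: tau0; rewrite le_eqVlt => /orP[/eqP <-//|tp].
  by apply: cvg_at_right_filter; apply: cf; rewrite in_itv/= tp.
rewrite leNgt; apply/negP => fta.
have : \forall z \near tau^'+, f z < a by exact: (cvgr_lt _ fr).
rewrite near_withinE => /nbhs_ballP[r /= r0 h].
have me0 : 0 < Num.min r e by rewrite lt_min r0.
have lt_me : tau < tau + Num.min r e by rewrite ltrDl.
have [q] := rat_in_itvoo lt_me.
rewrite in_itv/= => /andP[q1 q2].
have qe : ratr q < tau + e by apply: (lt_le_trans q2); rewrite lerD2l ge_min lexx orbT.
have qr : ratr q < tau + r by apply: (lt_le_trans q2); rewrite lerD2l ge_min lexx.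
have := fa q; rewrite q1 qe => /(_ isT); rewrite leNgt h//=.
by rewrite /ball/= ltr0_norm ?subr_lt0// opprB ltrBlDl.
Qed.

Lemma rational_right_limit_le (f : R -> R) a tau e : 0 <= tau -> 0 < e ->
  {within `[0, +oo[, continuous f} ->
  (forall q : rat, tau < ratr q < tau + e -> f (ratr q) <= a) -> f tau <= a.
Proof.
move=> tau0 e0 cf fa; rewrite -lerN2.
apply: (@rational_right_limit_ge (fun z => - f z) _ _ _ tau0 e0) => [|q qe].
  by move=> z; apply: continuousN; exact: cf.
by rewrite lerN2 fa.
Qed.

End Limits.

(* 2 ^ (18 k) is the cardinality of the net. *)
Lemma prob_bound (R : realType) (C0 nu s N D : R) :
  9 <= C0 -> 0 < nu <= 1 / 4 -> 0 < s -> 1 <= D -> 4 * C0 ^+ 2 * s ^+ 4 * D < N ->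
  forall k : nat, k%:R = D ->
  2 ^+ (18 * k) * (2 * expR (- (N / (C0 * s ^+ 4)))) + 2 * expR (- (N / (C0 * s ^+ 4)))
   + 2 * expR (- (N / (C0 * s ^+ 4))) + expR (- N) <=
  2 * expR (- (nu ^+ 2 * N / (C0 ^+ 2 * s ^+ 4)))
        + 2 * expR (- (nu ^+ 2 * N / (C0 * s ^+ 4)))
        + 8 * expR (- (N / C0)).
Proof.
move=> C9 /andP[nu0 nu1] s0 D1 DN k kD.
have C0p : 0 < C0 by lra.
have s4 : 0 < s ^+ 4 by rewrite exprn_gt0.
have Cs : 0 < C0 * s ^+ 4 by rewrite mulr_gt0.
set r := N / (C0 * s ^+ 4).
have rD : 4 * C0 * D <= r.
  rewrite /r ler_pdivlMr// (_ : 4 * C0 * D * (C0 * s ^+ 4) = 4 * C0 ^+ 2 * s ^+ 4 * D); last by ring.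
  exact: ltW.
(* 36 = 2 * 18: half of [r] absorbs 2^(18 k) <= e^(18 D), and the other half dominates both
   exponents containing [nu], as nu^2 <= 1/16. *)
have r36 : 36 * D <= r.
  have : 0 <= (C0 - 9) * D by rewrite mulr_ge0; lra.
  by move: rD; lra.
have nu2 : nu ^+ 2 <= 1 / 16 by rewrite expr2; nra.
have e1 : nu ^+ 2 * N / (C0 ^+ 2 * s ^+ 4) <= r / 2.
  have -> : nu ^+ 2 * N / (C0 ^+ 2 * s ^+ 4) = nu ^+ 2 / C0 * r.
    by rewrite /r; field; rewrite !gt_eqF.
  rewrite mulrC ler_wpM2l//; first by lra.
  by rewrite ler_pdivrMr//; lra.
have e2 : nu ^+ 2 * N / (C0 * s ^+ 4) <= r / 2.
  have -> : nu ^+ 2 * N / (C0 * s ^+ 4) = nu ^+ 2 * r by rewrite /r mulrA.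
  have r0 : 0 <= r by lra.
  by have := ler_wpM2r r0 nu2; lra.
have h2 : 2 <= expR (r / 2) by apply: le_trans (expR_ge1Dx _); lra.
have T1 : 2 ^+ (18 * k) * expR (- r) <= expR (- (nu ^+ 2 * N / (C0 ^+ 2 * s ^+ 4))).
  apply: (@le_trans _ _ (expR (- (r / 2)))); last by rewrite ler_expR lerN2.
  have -> : - r = - (r / 2) + - (r / 2) by field.
  rewrite expRD mulrA -[X in _ <= X]mul1r ler_wpM2r ?expR_ge0//.
  rewrite expRN ler_pdivrMr ?expR_gt0// mul1r.
  apply: (@le_trans _ _ (expR ((18 * k)%:R * 1))).
    rewrite expRM_natl; apply: lerXn2r; rewrite ?nnegrE ?expR_ge0//.
    by apply: le_trans (expR_ge1Dx _); lra.
  by rewrite ler_expR natrM kD; lra.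
have T2 : 2 * expR (- r) <= expR (- (nu ^+ 2 * N / (C0 * s ^+ 4))).
  apply: (@le_trans _ _ (expR (- (r / 2)))); last by rewrite ler_expR lerN2.
  have -> : - r = - (r / 2) + - (r / 2) by field.
  rewrite expRD mulrA -[X in _ <= X]mul1r ler_wpM2r ?expR_ge0//.
  by rewrite expRN ler_pdivrMr ?expR_gt0// mul1r.
have N0 : 0 < N.
  by apply: le_lt_trans DN; rewrite mulr_ge0 ?(ltW s4)//; first rewrite mulr_ge0 ?(ltW s4)// mulr_ge0 ?sqr_ge0//; lra.
have T3 : expR (- N) <= expR (- (N / C0)).
  by rewrite ler_expR lerN2 ler_pdivrMr// -[X in X <= _]mulr1 ler_wpM2l ?(ltW N0)//; lra.
have := expR_ge0 (- (N / C0)); lra.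
Qed.

(** If [kappa1] is positive, each non-negative term subtracted from 1 is at most 1. The term 64 q
    even gives sqrt delta <= 1/65; the bound 1/5 is what makes the tail signal at most 1/20 in
    [risk_ge_bias]. *)
Lemma kappa1_cases (R : realType) (C0 sx C1 delta lam tau : R) :
  0 < C0 -> 0 < C1 -> 0 < delta < 1 -> 0 < lam -> 0 < tau ->
  kappa1 C0 sx C1 delta lam tau = 0 \/
  [/\ 0 <= kappa1 C0 sx C1 delta lam tau <= 1,
      2 * C0 * sx ^+ 2 * (2 + C1) * lam <= tau & delta <= 1 / 5].
Proof.
move=> C00 C10 /andP[d0 d1] l0 t0; rewrite /kappa1.
set q := Num.sqrt delta / _.
have sd0 : 0 < Num.sqrt delta by rewrite sqrtr_gt0.
have sd2 : Num.sqrt delta ^+ 2 = delta by rewrite sqr_sqrtr// ltW.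
have sd1 : Num.sqrt delta < 1.
  by rewrite -(@ltr_pXn2r _ 2)// ?nnegrE ?(ltW sd0)// sd2 expr1n.
have q0 : 0 < q by rewrite divr_gt0// subr_gt0.
set Y := 2 * C0 * sx ^+ 2 * (2 + C1) * lam / tau.
have s20 := sqr_ge0 sx.
have Y0 : 0 <= Y.
  rewrite /Y divr_ge0 ?(ltW t0)// mulr_ge0 ?(ltW l0)// mulr_ge0 ?addr_ge0 ?(ltW C10)//.
  by rewrite mulr_ge0// mulr_ge0 ?(ltW C00).
set Wd := 16 * (2 * C0 * sx ^+ 2 + 1) * (1 + C1) * q.
have W0 : 0 <= Wd.
  rewrite /Wd mulr_ge0 ?(ltW q0)// mulr_ge0 ?addr_ge0 ?(ltW C10)// mulr_ge0// addr_ge0//.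
  by rewrite mulr_ge0// mulr_ge0 ?(ltW C00).
have YW : 0 <= Y * Wd by rewrite mulr_ge0.
set E := 1 - _.
case/orP: (le_total E 0) => [E0|E0]; [left; exact: max_r|right].
rewrite (max_l E0).
have E1 : Y + Y * Wd + 64 * q <= 1 by move: E0; rewrite /E; lra.
split.
- by rewrite E0 /E; lra.
- have : Y <= 1 by lra.
  by rewrite /Y ler_pdivrMr// mul1r.
- have : q <= 1 / 64 by lra.
  rewrite /q ler_pdivrMr ?subr_gt0// => h.
  have : Num.sqrt delta <= 1 / 65 by lra.
  by rewrite -sd2 expr2 => h2; nra.
Qed.

(** * The three ranges of tau on the good event *)

Section Deterministic.
Context {R : realType}.
Variables (f F : R -> R) (A0 Kd Ld lam1 r N dn s2 bias delta C0 sx C1 : R).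
Hypothesis A01 : 1 <= A0.
Hypothesis Kd0 : 0 <= Kd.
Hypothesis lam10 : 0 < lam1.
Hypothesis lamL : lam1 <= Ld.
Hypothesis r0 : 0 <= r.
Hypothesis N0 : 0 < N.
Hypothesis dn0 : 0 <= dn.
Hypothesis s20 : 0 <= s2.
Hypothesis bias0 : 0 <= bias.
Hypothesis C00 : 0 < C0.
Hypothesis C10 : 0 < C1.
Hypothesis delta01 : 0 < delta < 1.
Hypothesis KdC0 : 10 * Kd <= 2 * C0 * sx ^+ 2 * (2 + C1).
Hypothesis C0sx : 1 <= 2 * C0 * sx ^+ 2 * (2 + C1).
Hypothesis f_cont : {within `[0, +oo[, continuous f}.
Hypothesis fF : forall q : rat, 0 < (ratr q : R) -> f (ratr q) = F (ratr q).
Hypothesis F_head : forall tau, 0 < tau ->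
  9 / 11 * (1 + tau / (9 / 10 * Ld))^-1 ^+ 2 * (s2 * dn) <= F tau.
Hypothesis F_tail : forall tau, 0 < tau ->
  s2 * (9 / 10 * (lam1 * r) / (N * (Kd * lam1 + tau))) ^+ 2 <= F tau.
Hypothesis F_bias : forall tau mu, 0 < tau -> 10 * (Kd * lam1) <= tau ->
  lam1 <= mu -> mu <= tau -> mu <= Ld -> delta <= 1 / 5 ->
  1 / 40 * (mu ^+ 2 * bias) <= F tau.
Hypothesis F_upper : forall tau, 0 < tau ->
  F tau <= 3 * ((Kd * lam1 + tau) ^+ 2 * bias) + 3 * (lam1 ^+ 2 * bias)
     + s2 * (3 * ((Kd * lam1 + tau) ^+ 2 / tau ^+ 2) * dn
         + 22 / 10 * Kd * (lam1 ^+ 2 / tau ^+ 2 * (r / N))).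

(** Bounds (Kd lam1 + u) / c for u in the window to the right of [tau], where c is lam1 for small
    tau and tau otherwise. *)
Let W := Kd * A0 + 2.
Let L0 : 0 < Ld. Proof. exact: lt_le_trans lamL. Qed.
Let A00 : 0 < A0. Proof. exact: lt_le_trans A01. Qed.
Let W2 : 2 <= W. Proof. by rewrite /W; have := mulr_ge0 Kd0 (ltW A00); lra. Qed.
Let W0 : 0 < W. Proof. exact: lt_le_trans W2. Qed.
Let KdA : Kd <= Kd * A0. Proof. by have := ler_wpM2l Kd0 A01; lra. Qed.

(** A lower bound has at most three terms, each kept below F / 3. This costs 96 A0^2 (head), 100/27
    W^2 (tail) and 120 A0^2 (bias), all at most 200 A0^2 W^2. *)
Definition lower_const := (200 * A0 ^+ 2 * (Kd * A0 + 2) ^+ 2)^-1.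
Definition upper_const := 3 * (Kd * A0 + 2) ^+ 2 + 3 * A0 ^+ 2 + 3 * Kd.

Let M0 : 0 < 200 * A0 ^+ 2 * W ^+ 2.
Proof. by apply: mulr_gt0; [apply: mulr_gt0 => //|]; exact: exprn_gt0. Qed.

Let A2 : 1 <= A0 ^+ 2. Proof. exact: exprn_ege1. Qed.
Let WW : 4 <= W ^+ 2.
Proof. by have := ler_pM (ler0n R 2) (ler0n R 2) W2 W2; rewrite -natrM -expr2. Qed.

Let lower_le c a : 0 <= a -> 0 < c -> c <= 200 * A0 ^+ 2 * W ^+ 2 -> lower_const * a <= a / c.
Proof.
by move=> a0 c0 cM; rewrite mulrC ler_wpM2l// /lower_const -/W lef_pV2 ?posrE.
Qed.

Let F_head' tau : 0 < tau <= 2 * A0 * Ld -> s2 * dn / (32 * A0 ^+ 2) <= F tau.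
Proof.
move=> /andP[t0 tA]; apply: le_trans (F_head t0).
have sd : 0 <= s2 * dn by rewrite mulr_ge0.
rewrite [X in X <= _]mulrC ler_wpM2r//.
have L9 : 0 < 9 / 10 * Ld by move: L0; lra.
have h : 1 + tau / (9 / 10 * Ld) <= 4 * A0.
  have : tau / (9 / 10 * Ld) <= 20 / 9 * A0 by rewrite ler_pdivrMr//; lra.
  by move: A01; lra.
have p : 0 < 1 + tau / (9 / 10 * Ld) by rewrite addr_gt0// divr_gt0.
have h2 : (1 + tau / (9 / 10 * Ld)) ^+ 2 <= 16 * A0 ^+ 2.
  rewrite (_ : 16 * A0 ^+ 2 = (4 * A0) ^+ 2); last by ring.
  by rewrite ler_pXn2r// nnegrE ltW//; lra.
have h3 : (16 * A0 ^+ 2)^-1 <= (1 + tau / (9 / 10 * Ld)) ^- 2.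
  by rewrite lef_pV2 ?posrE ?exprn_gt0// mulr_gt0// exprn_gt0.
rewrite exprVn; apply: (@le_trans _ _ (9 / 11 * (16 * A0 ^+ 2)^-1)); last by rewrite ler_pM2l//; lra.
rewrite (_ : (32 * A0 ^+ 2)^-1 = 1 / 2 * (16 * A0 ^+ 2)^-1); last by field; rewrite gt_eqF.
by rewrite ler_wpM2r ?invr_ge0 ?mulr_ge0 ?sqr_ge0//; lra.
Qed.

Let F_tail' tau c : 0 < tau -> Kd * lam1 + tau <= W * c -> 0 < c ->
  s2 * (lam1 ^+ 2 / c ^+ 2 * (r ^+ 2 / N ^+ 2)) * (81 / 100) / W ^+ 2 <= F tau.
Proof.
move=> t0 tc c0; apply: le_trans (F_tail t0).
have K0' : 0 < Kd * lam1 + tau by rewrite ltr_wpDl// mulr_ge0// ltW.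
rewrite [X in X <= _](_ : _ = s2 * (9 / 10 * (lam1 * r) / (N * (W * c))) ^+ 2); last first.
  by field; rewrite !gt_eqF.
rewrite ler_wpM2l//.
have a0 : 0 <= 9 / 10 * (lam1 * r) by have := mulr_ge0 (ltW lam10) r0; lra.
have p1 : 0 < N * (W * c) by rewrite !mulr_gt0.
have p2 : 0 < N * (Kd * lam1 + tau) by rewrite mulr_gt0.
rewrite ler_pXn2r ?nnegrE ?divr_ge0 ?(ltW p1) ?(ltW p2)//.
by rewrite ler_wpM2l// lef_pV2 ?posrE// ler_pM2l.
Qed.

Let sd0 : 0 <= s2 * dn. Proof. exact: mulr_ge0. Qed.
Let A20 : 0 < A0 ^+ 2. Proof. exact: exprn_gt0. Qed.
Let W20 : 0 < W ^+ 2. Proof. exact: exprn_gt0. Qed.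

Let F_ge0 u : 0 < u -> 0 <= F u.
Proof. by move=> u0; apply: le_trans (F_tail u0); rewrite mulr_ge0// sqr_ge0. Qed.

Let lower_head u : 0 < u <= 2 * A0 * Ld -> lower_const * (s2 * dn) <= 1 / 3 * F u.
Proof.
move=> hu; have h := F_head' hu.
have := @lower_le (96 * A0 ^+ 2) _ sd0.
rewrite mulr_gt0// => /(_ isT); have := ler_wpM2l (ltW A20) WW => g /(_ _)/le_trans; apply.
  by move: g; have := A20; move: (A0 ^+ 2) (W ^+ 2) => a b; lra.
rewrite (_ : s2 * dn / (96 * A0 ^+ 2) = 1 / 3 * (s2 * dn / (32 * A0 ^+ 2))); last first.
  by field; rewrite gt_eqF.
by rewrite ler_pM2l.
Qed.

Let lower_tail u c : 0 < u -> Kd * lam1 + u <= W * c -> 0 < c ->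
  lower_const * (s2 * (lam1 ^+ 2 / c ^+ 2 * (r ^+ 2 / N ^+ 2))) <= 1 / 3 * F u.
Proof.
move=> u0 uc c0; have h := F_tail' u0 uc c0.
set q := s2 * _ in h *.
have q0 : 0 <= q by rewrite mulr_ge0// mulr_ge0// divr_ge0 ?sqr_ge0.
have := @lower_le (100 / 27 * W ^+ 2) _ q0.
have g := ler_wpM2r (ltW W20) A2; rewrite mul1r in g.
have W2p := W20.
have -> : 0 < 100 / 27 * W ^+ 2 by rewrite mulr_gt0.
move=> /(_ isT _)/le_trans; apply.
  by move: g W2p; rewrite -[200 * _ * _]mulrA; move: (A0 ^+ 2 * W ^+ 2) (W ^+ 2) => a b; lra.
rewrite (_ : q / (100 / 27 * W ^+ 2) = 1 / 3 * (q * (81 / 100) / W ^+ 2)); last first.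
  by field; rewrite gt_eqF.
by rewrite ler_pM2l.
Qed.

Let kap := kappa1 C0 sx C1 delta lam1.

(* kappa1 > 0 forces lam1 <= tau, so F_bias applies with mu = min tau Ld. *)
Let lower_bias tau u c : 0 < tau -> tau < u -> 0 <= c -> c <= A0 * tau -> c <= A0 * Ld ->
  lower_const * (kap tau * bias * c ^+ 2) <= 1 / 3 * F u.
Proof.
move=> t0 tu c0 cA cL; have u0 := lt_trans t0 tu.
have [k0|[/andP[k0 k1] kt d5]] := kappa1_cases sx C00 C10 delta01 lam10 t0.
  by rewrite /kap k0 mul0r mul0r mulr0 mulr_ge0 ?F_ge0.
have lt : lam1 <= tau.
  by apply: le_trans kt; rewrite -[X in X <= _]mul1r ler_wpM2r// ltW.
pose mu := Num.min tau Ld.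
have mu0 : 0 <= mu by rewrite le_min !ltW.
have cmu : c <= A0 * mu by rewrite /mu /Num.min; case: ifP.
have ku : 10 * (Kd * lam1) <= u.
  apply: le_trans (ltW tu); apply: le_trans kt; rewrite mulrA.
  by rewrite ler_wpM2r// ltW.
have h : 1 / 40 * (mu ^+ 2 * bias) <= F u.
  apply: F_bias => //; first by rewrite le_min lt.
    by rewrite ge_min ltW.
  by rewrite ge_min lexx orbT.
have q0 : 0 <= kap tau * bias * c ^+ 2 by rewrite mulr_ge0 ?sqr_ge0// mulr_ge0.
have := @lower_le (120 * A0 ^+ 2) _ q0.
rewrite mulr_gt0// => /(_ isT); have := ler_wpM2l (ltW A20) WW => g /(_ _)/le_trans; apply.
  by move: g; have := A20; move: (A0 ^+ 2) (W ^+ 2) => a b; lra.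
apply: (@le_trans _ _ (1 / 3 * (1 / 40 * (mu ^+ 2 * bias)))); last by rewrite ler_pM2l.
rewrite ler_pdivrMr ?mulr_gt0//.
rewrite [X in _ <= X](_ : _ = bias * (A0 * mu) ^+ 2); last by field.
apply: (@le_trans _ _ (bias * c ^+ 2)).
  by rewrite -mulrA -[X in _ <= X]mul1r ler_wpM2r// mulr_ge0// sqr_ge0.
by rewrite ler_wpM2l// ler_pXn2r// nnegrE// mulr_ge0// ltW.
Qed.

Lemma lower_small tau : 0 <= tau -> tau <= A0^-1 * lam1 ->
  lower_const * (s2 * (dn + r ^+ 2 / N ^+ 2)) <= f tau.
Proof.
move=> t0 tl.
have tl1 : tau <= lam1.
  apply: (le_trans tl); rewrite -[X in _ <= X]mul1r ler_wpM2r ?(ltW lam10)//.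
  by rewrite invf_le1.
(* As [tau] may be 0, the window has width [lam1] here, and every u in it is below 2 lam1. *)
apply: (rational_right_limit_ge t0 lam10 f_cont) => q /andP[q1 q2].
have q0 : 0 < (ratr q : R) by apply: le_lt_trans q1.
rewrite fF//; set u : R := ratr q in q0 q1 q2 *.
have uA : 0 < u <= 2 * A0 * Ld.
  rewrite q0 /=; have := ler_wpM2r (ltW L0) A01; have := lamL; lra.
have h1 := lower_head uA.
have uc : Kd * lam1 + u <= W * lam1.
  by rewrite /W; have := ler_wpM2r (ltW lam10) KdA; lra.
have := lower_tail q0 uc lam10.
rewrite divff ?expf_neq0 ?gt_eqF// mul1r => h2.
have := F_ge0 q0; rewrite mulrDr mulrDr; lra.
Qed.

Lemma lower_moderate tau : A0^-1 * lam1 <= tau <= A0 * Ld ->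
  lower_const * (kap tau * bias * tau ^+ 2
    + s2 * (dn + lam1 ^+ 2 / tau ^+ 2 * (r ^+ 2 / N ^+ 2))) <= f tau.
Proof.
move=> /andP[lt tL].
have t0 : 0 < tau by apply: lt_le_trans lt; rewrite mulr_gt0// invr_gt0.
have {}lt : lam1 <= A0 * tau by rewrite mulrC -ler_pdivrMr// mulrC.
apply: (rational_right_limit_ge (ltW t0) t0 f_cont) => q /andP[q1 q2].
have q0 : 0 < (ratr q : R) by apply: lt_trans q1.
rewrite fF//; set u : R := ratr q in q0 q1 q2 *.
have uA : 0 < u <= 2 * A0 * Ld by rewrite q0 /= -mulrA; move: tL q2; lra.
have h1 := lower_head uA.
have uc : Kd * lam1 + u <= W * tau.
  by rewrite /W; have := ler_wpM2l Kd0 lt; lra.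
have h2 := lower_tail q0 uc t0.
have tA : tau <= A0 * tau by rewrite -[X in X <= _]mul1r ler_wpM2r// ltW.
have h3 := lower_bias t0 q1 (ltW t0) tA tL.
rewrite mulrDr [s2 * _]mulrDr mulrDr; lra.
Qed.

Lemma lower_large tau : A0 * Ld <= tau ->
  lower_const * (kap tau * bias * Ld ^+ 2
    + s2 * (lam1 ^+ 2 / tau ^+ 2 * (r ^+ 2 / N ^+ 2))) <= f tau.
Proof.
move=> tL; have LA : Ld <= A0 * Ld by rewrite -[X in X <= _]mul1r ler_wpM2r// ltW.
have Lt := le_trans LA tL.
have t0 : 0 < tau by apply: lt_le_trans Lt.
have tA : tau <= A0 * tau by rewrite -[X in X <= _]mul1r ler_wpM2r// ltW.
apply: (rational_right_limit_ge (ltW t0) t0 f_cont) => q /andP[q1 q2].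
have q0 : 0 < (ratr q : R) by apply: lt_trans q1.
rewrite fF//; set u : R := ratr q in q0 q1 q2 *.
have uc : Kd * lam1 + u <= W * tau.
  have lt : lam1 <= A0 * tau by apply: le_trans tA; exact: le_trans Lt.
  by rewrite /W; have := ler_wpM2l Kd0 lt; lra.
have h2 := lower_tail q0 uc t0.
have h3 := lower_bias t0 q1 (ltW L0) (le_trans Lt tA) LA.
have := F_ge0 q0; rewrite mulrDr; lra.
Qed.

Lemma upper_moderate tau : A0^-1 * lam1 <= tau ->
  f tau <= upper_const * (bias * tau ^+ 2
    + s2 * (dn + lam1 ^+ 2 / tau ^+ 2 * (r / N))).
Proof.
move=> lt.
have t0 : 0 < tau by apply: lt_le_trans lt; rewrite mulr_gt0// invr_gt0.
have {}lt : lam1 <= A0 * tau by rewrite mulrC -ler_pdivrMr// mulrC.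
apply: (rational_right_limit_le (ltW t0) t0 f_cont) => q /andP[q1 q2].
have q0 : 0 < (ratr q : R) by apply: lt_trans q1.
rewrite fF//; move: (ratr q : R) q0 q1 q2 => u q0 q1 q2; apply: (le_trans (F_upper q0)).
have KA : Kd * lam1 <= Kd * A0 * tau by rewrite -mulrA ler_wpM2l.
have Ku0 : 0 <= Kd * lam1 + u by apply: addr_ge0; [rewrite mulr_ge0// ltW|rewrite ltW].
have e1 : (Kd * lam1 + u) ^+ 2 <= W ^+ 2 * tau ^+ 2.
  rewrite -exprMn ler_pXn2r// ?nnegrE ?mulr_ge0 ?(ltW W0) ?(ltW t0)// /W.
  by move: KA q2; lra.
have e2 : lam1 ^+ 2 <= A0 ^+ 2 * tau ^+ 2.
  by rewrite -exprMn ler_pXn2r// ?nnegrE ?mulr_ge0 ?(ltW A00) ?(ltW t0) ?(ltW lam10).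
have e3 : (Kd * lam1 + u) ^+ 2 / u ^+ 2 <= W ^+ 2.
  rewrite ler_pdivrMr ?exprn_gt0// -exprMn ler_pXn2r// ?nnegrE ?mulr_ge0 ?(ltW W0) ?(ltW q0)// /W.
  have KA0 : 0 <= Kd * A0 by rewrite mulr_ge0// ltW.
  have := ler_wpM2l KA0 (ltW q1); move: KA q0; lra.
have e4 : lam1 ^+ 2 / u ^+ 2 <= lam1 ^+ 2 / tau ^+ 2.
  rewrite ler_wpM2l ?sqr_ge0// lef_pV2 ?posrE ?exprn_gt0//.
  by rewrite ler_pXn2r ?nnegrE ?(ltW q0) ?(ltW t0)// ltW.
have rN0 : 0 <= r / N by rewrite divr_ge0// ltW.
have {}e4 := ler_wpM2r rN0 e4.
have {}e1 := ler_wpM2r bias0 e1.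
have {}e2 := ler_wpM2r bias0 e2.
have {}e3 := ler_wpM2r dn0 e3.
have {}e4 := ler_wpM2l Kd0 e4.
set q4 := lam1 ^+ 2 / tau ^+ 2 * (r / N) in e4 *.
have q40 : 0 <= q4 by rewrite mulr_ge0// divr_ge0// sqr_ge0.
have b0 : 0 <= tau ^+ 2 * bias by rewrite mulr_ge0// sqr_ge0.
have f1 : 0 <= A0 ^+ 2 * q4 by rewrite mulr_ge0// sqr_ge0.
have f2 : 0 <= W ^+ 2 * q4 by rewrite mulr_ge0// sqr_ge0.
have f3 : 0 <= Kd * q4 by rewrite mulr_ge0.
have f4 : 0 <= A0 ^+ 2 * dn by rewrite mulr_ge0// sqr_ge0.
have f5 : 0 <= Kd * dn by rewrite mulr_ge0.
have f6 : 0 <= Kd * (tau ^+ 2 * bias) by rewrite mulr_ge0.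
have g : 3 * ((Kd * lam1 + u) ^+ 2 / u ^+ 2) * dn + 22 / 10 * Kd * (lam1 ^+ 2 / u ^+ 2 * (r / N))
    <= upper_const * (dn + q4).
  by rewrite /upper_const -/W; move: e3 e4; lra.
have := ler_wpM2l s20 g.
have {g} : 3 * ((Kd * lam1 + u) ^+ 2 * bias) + 3 * (lam1 ^+ 2 * bias) <= upper_const * (bias * tau ^+ 2).
  by rewrite /upper_const -/W; move: e1 e2; lra.
move: (upper_const) => M g1 g2; rewrite [M * _]mulrDr (mulrCA M s2); lra.
Qed.

Lemma lower_const_gt0 : 0 < lower_const.
Proof. by rewrite invr_gt0. Qed.

Lemma upper_const_gt0 : 0 < upper_const.
Proof.
by rewrite /upper_const -/W; have := W20; have := A20; move: Kd0; lra.
Qed.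

End Deterministic.

(** For b = 0 the quotient is +oo unless a = 0, so the hypothesis forces a = 0. *)
Lemma ereal_ratio_le (R : realType) (a b c : R) : 0 <= a -> 0 <= b ->
  (a%:E / b%:E <= c%:E)%E -> a <= c * b.
Proof.
move=> a0; rewrite le_eqVlt => /predU1P[<-|b0].
  rewrite inve0 mulr0; move: a0; rewrite le_eqVlt => /predU1P[<- _|a0]; first by [].
  by rewrite gt0_muley ?lte_fin// leye_eq.
by rewrite inver gt_eqF// -EFinM lee_fin ler_pdivrMr.
Qed.

Lemma ae_forall_rat d (T : measurableType d) (R : realType) (P : {measure set T -> \bar R})
    (Q : rat -> T -> Prop) :
  (forall q, \forall w \ae P, Q q w) -> \forall w \ae P, forall q, Q q w.
Proof.
move=> h; pose S (k : nat) w := forall q, choice.unpickle k = Some q -> Q q w.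
have : \forall w \ae P, forall k, S k w.
  apply: ae_foralln => k; rewrite /S; case: (choice.unpickle k) => [q|].
    by apply: filterS (h q) => w hw _ [<-].
  by apply: aeW.
by apply: filterS => w hw q; apply: (hw (choice.pickle q)); rewrite choice.pickleK.
Qed.

(** * The good event *)

Section GoodEvent.
Context {disp : measure_display} {T : measurableType disp} {R : realType}.
Variable P : probability T R.
Context {n p : nat}.
Variables (theta lam : 'cV[R]_p) (sigma sigma_x : R).
Variables (x : 'I_n -> T -> 'cV[R]_p) (eps y : 'I_n -> T -> R).
Hypothesis model : regression_model P theta lam sigma sigma_x x eps y.
Hypothesis lam0 : forall j, 0 < lam j 0.
Hypothesis sigma_x_gt0 : 0 < sigma_x.

(** A unit-variance projection satisfies 1 + 1/K <= E exp(q/K) <= 2, with q its square. This lower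
    bound on sigma_x allows absolute constants to be absorbed into multiples of sigma_x^2. *)
Lemma sigma_x_sqr_ge (i0 : 'I_n) (j0 : 'I_p) : 1 <= 4 * sigma_x ^+ 2.
Proof.
set K := 4 * sigma_x ^+ 2.
have K0 : 0 < K by rewrite mulr_gt0// exprn_gt0.
pose a : 'cV[R]_p := (Num.sqrt (lam j0 0))^-1 *: delta_mx j0 0.
have a1 : cov_form lam a = 1.
  rewrite /cov_form (bigD1 j0)//= big1 ?addr0 => [|k kj].
    by rewrite !mxE !eqxx mulr1 exprVn sqr_sqrtr ?(ltW (lam0 j0))// mulfV// gt_eqF.
  by rewrite !mxE (negPf kj) mulr0 expr0n mulr0.
have a1' : cov_form lam a <= 1 by rewrite a1.
have h := model_exp_le model lam0 sigma_x_gt0 i0 a1'; rewrite -/K in h.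
have mq := model_mdot model i0 a.
have : (\int[P]_w (1 + K^-1 * dot a (x i0 w) ^+ 2)%:E <= 2%:E)%E.
  apply: le_trans h; apply: ge0_le_integral => //.
  - by move=> w _; rewrite lee_fin addr_ge0// mulr_ge0 ?sqr_ge0// invr_ge0 ltW.
  - apply/measurable_EFinP; apply: measurable_funD => //.
    by apply: measurable_funM => //; exact: measurable_funX.
  - apply/measurable_EFinP; apply: measurableT_comp => //.
    by apply: measurable_funM => //; exact: measurable_funX.
  - by move=> w _; rewrite lee_fin mulrC; exact: expR_ge1Dx.
under eq_integral do rewrite EFinD EFinM.
have mq2 : measurable_fun setT (fun w => (dot a (x i0 w) ^+ 2)%:E).
  by apply/measurable_EFinP; exact: measurable_funX.
rewrite ge0_integralD//; last 2 first.
- by move=> w _; rewrite lee_fin mulr_ge0 ?sqr_ge0// invr_ge0 ltW.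
- by apply: measurable_funeM.
rewrite integral_cst//= probability_setT mul1e.
rewrite ge0_integralZl//; last 2 first.
- by move=> w _; rewrite lee_fin sqr_ge0.
- by rewrite lee_fin invr_ge0 ltW.
rewrite (model_dot_sqr model) a1 -EFinM mulr1 -EFinD lee_fin => {}h.
have : K^-1 <= 1 by lra.
by rewrite invf_le1.
Qed.

Hypothesis lam_dec : forall i j : 'I_p, (i <= j)%N -> lam j 0 <= lam i 0.
Hypothesis n0 : (0 < n)%N.
Variable d : nat.
Hypothesis d0 : (0 < d)%N.
Hypothesis dp : (d < p)%N.
Variable m : 'M[R]_(n, p) -> R -> R.
Hypothesis mse : in_sample_mse P theta (design x) (response y) m.

Let N : R := n%:R.
Let rate : R := expR (- (N / ((30 ^+ 2 * (1024 * 4 ^+ 2)) * sigma_x ^+ 4))).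
Let L : R := \sum_(j < p | (d <= j)%N) lam j 0.

Let rateE : expR (- (30^-1 ^+ 2 * n%:R / (1024 * (4 * sigma_x ^+ 2) ^+ 2))) = rate.
Proof. by rewrite /rate; congr (expR (- _)); rewrite -/N; field; rewrite gt_eqF. Qed.

(** Complement of six events: four of exponentially small probability, and two null ones for
    continuity in tau and for the risk formula at positive rationals. *)
Lemma good_event : exists E : set T, [/\ measurable E,
  ((1 - (2 ^+ (18 * d) * (2 * rate) + 2 * rate + 2 * rate + expR (- N)))%:E <= P E)%E &
  forall w, E w ->
    [/\ forall u, 9 / 10 * N * sqn u <= sqn (block lam x 0 d w *m u) <= 11 / 10 * N * sqn u,
        9 / 10 * (N * L) <= fro (tail_design x d w) <= 11 / 10 * (N * L),
        sqn (tail_design x d w *m tail_part d theta)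
          <= 11 / 10 * N * \sum_(j < p | (d <= j)%N) lam j 0 * theta j 0 ^+ 2,
        forall u, sqn (tail_design x d w *m u)
          <= N * (60 * (4 * sigma_x ^+ 2) * (entry lam d.+1 + L / N)) * sqn u
      & {within `[0, +oo[, continuous (m (design x w))} /\
        forall q : rat, 0 < (ratr q : R) ->
          m (design x w) (ratr q) = ridge_risk (design x w) theta sigma (ratr q)]].
Proof.
have [B1 [m1 P1 h1]] := gram_head model lam0 sigma_x_gt0 n0 d0 dp.
have [B2 [m2 P2 h2]] := trace_tail model lam0 sigma_x_gt0 n0 dp.
have [B3 [m3 P3 h3]] := signal_tail model lam0 sigma_x_gt0 n0 dp theta.
have [B4 [m4 P4 h4]] := tail_op model lam0 lam_dec sigma_x_gt0 n0 dp.
have [B5 [m5 P5 h5]] := mse_continuous mse.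
have : \forall w \ae P, forall q : rat, 0 < (ratr q : R) ->
    m (design x w) (ratr q) = ridge_risk (design x w) theta sigma (ratr q).
  apply: ae_forall_rat => q; case: (boolP (0 < (ratr q : R))) => [q0|_]; last exact: aeW.
  by apply: filterS (mse_ae model mse n0 q0).
move=> [B6 [m6 P6 h6]].
rewrite rateE in P1 P2 P3.
pose B := B1 `|` B2 `|` B3 `|` B4 `|` B5 `|` B6.
have mB : measurable B by rewrite /B; do 5 (apply: measurableU => //).
have PB : (P B <= (2 ^+ (18 * d) * (2 * rate) + 2 * rate + 2 * rate + expR (- N))%:E)%E.
  have -> : ((2 ^+ (18 * d) * (2 * rate) + 2 * rate + 2 * rate + expR (- N))%:E =
    (2 ^+ (18 * d) * (2 * rate))%R%:E + (2 * rate)%R%:E + (2 * rate)%R%:E + (expR (- N))%:E + 0 + 0)%E.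
    by rewrite !adde0 -!EFinD.
  have PU A A' a a' : measurable A -> measurable A' -> (P A <= a)%E -> (P A' <= a')%E ->
      (P (A `|` A') <= a + a')%E.
    by move=> mA mA' hA hA'; apply: le_trans (measureU2 _ mA mA') _; exact: leeD.
  rewrite /B; apply: (PU) => //; [do ?apply: measurableU => //|idtac|by rewrite P6].
  apply: (PU) => //; [do ?apply: measurableU => //|idtac|by rewrite P5].
  apply: (PU) => //; [do ?apply: measurableU => //|].
  apply: (PU) => //; [do ?apply: measurableU => //|].
  by apply: (PU).
exists (~` B); split; first exact: measurableC.
  rewrite probability_setC// EFinB; apply: leeB => //.
move=> w Bw.
have [[[[[n1 n2] n3] n4] n5] n6] : ((((~ B1 w /\ ~ B2 w) /\ ~ B3 w) /\ ~ B4 w) /\ ~ B5 w) /\ ~ B6 w.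
  by move: Bw; rewrite /B /= !not_orE.
split; [exact: h1|exact: h2|exact: h3| |split].
- move=> u; rewrite -[tail_design x d w]trmxK; apply: sqn_mulmx_trmx.
    have e0 : 0 <= entry lam d.+1 by rewrite -[d.+1]/((Ordinal dp).+1) entryE ltW.
    have L0 : 0 <= L by apply: sumr_ge0 => j _; exact: ltW.
    have LN : 0 <= L / N by rewrite divr_ge0// ler0n.
    have s2 := sqr_ge0 sigma_x.
    apply: mulr_ge0; [exact: ler0n|apply: mulr_ge0; [lra|exact: addr_ge0]].
  by move=> b; have := h4 w n4 b; rewrite addn0.
- by apply: contrapT => h; apply: n5; apply: h5.
- by apply: contrapT => h; apply: n6; apply: h6.
Qed.
End GoodEvent.

Lemma divr_4_le (R : realFieldType) (a s : R) : 0 <= a -> 0 <= s ->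
  a / (4 * (1 + s)) <= 1 / 4 * a.
Proof. by move=> a0 s0; rewrite ler_pdivrMr; [nra|lra]. Qed.

Lemma threshold_ge1 (R : realFieldType) (C0 s C : R) : 1200 <= C0 -> 1 <= 4 * s -> 0 < C ->
  1 <= 2 * C0 * s * (2 + C).
Proof.
move=> hC0 hs hC; have h : 300 <= C0 * s by nra.
have := mulr_ge0 (le_trans (ler0n R 300) h) (ltW hC); lra.
Qed.

(** Compares 10 [Kd] with the coefficient of lambda_{d+1} / tau in [kappa1]: positivity of [kappa1]
    then gives the condition 10 Kd lambda_{d+1} <= tau of [risk_ge_bias]. *)
Lemma threshold_ge (R : realFieldType) (C0 s C : R) : 1200 <= C0 -> 1 <= 4 * s -> 0 < C ->
  10 * (60 * (4 * s) * (1 + C)) <= 2 * C0 * s * (2 + C).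
Proof.
move=> hC0 hs hC; have h : 1200 * s <= C0 * s by rewrite ler_wpM2r//; lra.
have s0 : 0 <= s by lra.
have sC := mulr_ge0 s0 (ltW hC).
have := ler_wpM2r (ltW hC) h; lra.
Qed.

Theorem theorem2 (R : realType) :
  exists C0 : R, 0 < C0 /\
  forall sigma_x eta1 C1 delta1 nu A0 : R,
    eta1 < 1 / 2 ->
    0 < C1 ->
    0 < delta1 < 1 ->
    0 < nu < 1 / 4 * Num.min 1 (sigma_x ^+ 2) ->
    1 <= A0 ->
    (1 + A0) ^+ 2 < 4 * delta1^-1 ->
  exists M1 M2 : R, 0 < M1 /\ 0 < M2 /\
  forall (n d p : nat) (theta lam : 'cV[R]_p) (sigma : R)
    (disp : measure_display) (T : measurableType disp) (P : probability T R)
    (x : 'I_n -> T -> 'cV[R]_p) (eps y : 'I_n -> T -> R)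
    (m : 'M[R]_(n, p) -> R -> R),
    let lamd := entry lam d in
    let lamd1 := entry lam d.+1 in
    let rd := eff_rank lam d in
    let bias := qnorm (invmx (Diag (head_part d lam))) (head_part d theta) ^+ 2 in
    let tail := qnorm (Diag (tail_part d lam)) (tail_part d theta) ^+ 2 in
    let kappa := kappa1 C0 sigma_x C1 delta1 lamd1 in
    (1 <= n)%N ->
    (1 <= d < p)%N ->
    (forall j k : nat, (1 <= j <= k)%N -> (k <= p)%N ->
       0 < entry lam k <= entry lam j) ->
    regression_model P theta lam sigma sigma_x x eps y ->
    in_sample_mse P theta (design x) (response y) m ->
    (d <= n)%N ->
    eta1 = C0 * sigma_x ^+ 2 * Num.sqrt (d%:R / n%:R) ->
    rd / n%:R <= C1 ->
    (* The quotient is taken in the extended reals, where t / 0 = +oo for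
       t > 0 and 0 / 0 = 0. *)
    (tail%:E / bias%:E
       <= (delta1 / (4 * (1 + sigma_x ^+ 2)) * lamd1 ^+ 2)%:E)%E ->
  exists E : set T, measurable E /\
    ((1 - 2 * expR (- (nu ^+ 2 * n%:R / (C0 ^+ 2 * sigma_x ^+ 4)))
        - 2 * expR (- (nu ^+ 2 * n%:R / (C0 * sigma_x ^+ 4)))
        - 8 * expR (- (n%:R / C0)))%:E <= P E)%E /\
    forall (w : T) (tau : R), E w -> 0 <= tau ->
      let MSE := m (design x w) tau in
      [/\ tau <= A0^-1 * lamd1 ->
            M1 * (sigma ^+ 2 * (d%:R / n%:R + rd ^+ 2 / n%:R ^+ 2)) <= MSE,
          A0^-1 * lamd1 <= tau <= A0 * lamd ->
            M1 * (kappa tau * bias * tau ^+ 2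
                  + sigma ^+ 2 * (d%:R / n%:R
                      + lamd1 ^+ 2 / tau ^+ 2 * (rd ^+ 2 / n%:R ^+ 2)))
              <= MSE
              <= M2 * (bias * tau ^+ 2
                  + sigma ^+ 2 * (d%:R / n%:R
                      + lamd1 ^+ 2 / tau ^+ 2 * (rd / n%:R)))
        & A0 * lamd <= tau ->
            M1 * (kappa tau * bias * lamd ^+ 2
                  + sigma ^+ 2 * (lamd1 ^+ 2 / tau ^+ 2
                      * (rd ^+ 2 / n%:R ^+ 2)))
              <= MSE].
Proof.
(* With tolerance 1/30 and K = 4 sigma_x^2, Bernstein's exponent is n / (C0 sigma_x^4) for exactly
   this [C0]. *)
have [C0 C0E] : exists C0 : R, C0 = 30 ^+ 2 * (1024 * 4 ^+ 2) by eexists.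
have C0_ge : 1200 <= C0.
  have a : 100 <= 30 ^+ 2 :> R by rewrite expr2; lra.
  have b : 12 <= 1024 * 4 ^+ 2 :> R by rewrite expr2; lra.
  have := ler_pM (ler0n R 100) (ler0n R 12) a b.
  by rewrite -C0E -natrM.
have C00 : 0 < C0 by lra.
have C09 : 9 <= C0 by lra.
exists C0; split=> // sigma_x eta1 C1 delta1 nu A0 eta_lt C10 delta01 /andP[nu0 nu_lt] A01 _.
(* The constant of [tail_op], with L / n = lambda_{d+1} r_d / n at most C1 lambda_{d+1}. *)
pose Kd := 60 * (4 * sigma_x ^+ 2) * (1 + C1).
have sx2 := sqr_ge0 sigma_x.
have sx240 : 0 <= 60 * (4 * sigma_x ^+ 2) by clear -sx2; lra.
have Kd0 : 0 <= Kd by apply: mulr_ge0 => //; clear -C10; lra.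
exists (lower_const A0 Kd), (upper_const A0 Kd).
split; first exact: lower_const_gt0.
split; first exact: upper_const_gt0.
move=> n d p theta lam sigma disp T P x eps y m lamd lamd1 rd bias tail kappa.
move=> n0 /andP[d0 dp] lamP model mse dn eta_def rdC tail_le.
have lam0 j : 0 < lam j 0.
  have := lamP j.+1 j.+1; rewrite !leqnn (ltn_ord j) /= => /(_ isT isT) /andP[].
  by rewrite entryE.
have lam_dec (i j : 'I_p) : (i <= j)%N -> lam j 0 <= lam i 0.
  move=> ij; have /andP[_] := lamP i.+1 j.+1 ij (ltn_ord j).
  by rewrite !entryE.
have lam10 : 0 < lamd1 by have := lamP d.+1 d.+1; rewrite !leqnn dp => /(_ isT isT)/andP[].
have lamL : lamd1 <= lamd.
  by have := lamP d d.+1; rewrite d0 leqnSn dp => /(_ isT isT)/andP[].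
(* If sigma_x were 0, the upper limit imposed on the positive [nu] would be 0. *)
have sx0 : 0 < sigma_x.
  have := sigma_x_ge0 model (Ordinal n0) (Ordinal dp).
  rewrite le_eqVlt => /predU1P[sx|//]; move: nu_lt; rewrite -sx expr0n /=.
  have : Num.min 1 0 <= 0 :> R by rewrite ge_min lexx orbT.
  by move: (Num.min _ _) => c; lra.
have sxq := sigma_x_sqr_ge model lam0 sx0 (Ordinal n0) (Ordinal dp).
have nuS : nu <= 1 / 4.
  apply: (le_trans (ltW nu_lt)); rewrite -[X in _ <= X]mulr1 ler_wpM2l//.
  by rewrite ge_min lexx.
have N0 : 0 < n%:R :> R by rewrite ltr0n.
have d1 : 1 <= d%:R :> R by rewrite ler1n.
(* The square of eta1 < 1/2: a sample size linear in d, which pays for the net in [prob_bound]. *)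
have sample : 4 * C0 ^+ 2 * sigma_x ^+ 4 * d%:R < n%:R.
  have dn0 : 0 <= d%:R / n%:R :> R by rewrite divr_ge0.
  have e0 : 0 <= eta1 by rewrite eta_def mulr_ge0 ?sqrtr_ge0// mulr_ge0 ?(ltW C00).
  have : eta1 ^+ 2 < (1 / 2) ^+ 2 by rewrite ltr_pXn2r ?nnegrE.
  rewrite eta_def exprMn sqr_sqrtr// exprMn mulrA ltr_pdivrMr//.
  have -> : (sigma_x ^+ 2) ^+ 2 = sigma_x ^+ 4 by rewrite -exprM.
  have -> : (1 / 2) ^+ 2 = 1 / 4 :> R by field.
  lra.
have [E [mE PE hE]] := good_event model lam0 sx0 lam_dec n0 d0 dp mse.
have rdE := eff_rankE dp lam0; rewrite -/lamd1 -/rd in rdE.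
have rd0 : 0 <= rd.
  rewrite -(pmulr_rge0 _ lam10) rdE; apply: sumr_ge0 => j _; exact: ltW.
have biasE : bias = sqn (head_signal lam d theta) by exact: bias_eq.
have tailE : tail = \sum_(j < p | (d <= j)%N) lam j 0 * theta j 0 ^+ 2 by exact: tail_eq.
have bias0 : 0 <= bias by rewrite sqr_ge0.
have tail0 : 0 <= tail by rewrite sqr_ge0.
have {}tail_le := ereal_ratio_le tail0 bias0 tail_le.
set delta := delta1 / (4 * (1 + sigma_x ^+ 2)) in tail_le.
have [dl0 dl1] := andP delta01.
have delta_le : delta <= 1 / 4 * delta1 by exact: divr_4_le (ltW dl0) sx2.
have delta20 : delta1 <= 1 / 5 -> delta <= 1 / 20 by clear -delta_le; lra.
have delta_1 : delta <= 1 by clear -delta_le dl1; lra.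
exists E; split => //; split.
  apply: le_trans PE; rewrite lee_fin -C0E.
  have := @prob_bound _ C0 nu sigma_x n%:R d%:R _ _ sx0 d1 sample d erefl.
  rewrite C09 nu0 nuS => /(_ isT isT); move: (_ + expR (- n%:R)); clear=> u; lra.
move=> w tau Ew tau0 MSE.
have [gram trace signal op [m_cont mF]] := hE w Ew.
have gram_ge a : 9 / 10 * n%:R * sqn a <= sqn (block lam x 0 d w *m a) by case/andP: (gram a).
have gram_le a : sqn (block lam x 0 d w *m a) <= 11 / 10 * n%:R * sqn a by case/andP: (gram a).
have {trace}[trace_ge trace_le] := andP trace.
rewrite -rdE in trace_ge trace_le op.
rewrite -tailE in signal.
have Kd_op b : sqn (tail_design x d w *m b) <= n%:R * (Kd * lamd1) * sqn b.
  apply: (le_trans (op b)); rewrite ler_wpM2r ?sqn_ge0// ler_wpM2l ?ler0n//.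
  rewrite /Kd -[X in _ <= X]mulrA ler_wpM2l ?sx240//.
  rewrite -/lamd1 -mulrA [X in _ <= X]mulrC mulrDr mulr1 lerD2l.
  by rewrite ler_wpM2l// ltW.
have LL : 0 < lamd by exact: lt_le_trans lamL.
have lL k : lamd <= head_part d lam k 0.
  rewrite mxE; have := lamP k.+1 d; rewrite /= (ltn_ord k) (ltnW dp) => /(_ isT isT).
  by case/andP.
have XXt := gram_split dp lam0 x w.
have Xth := signal_split dp lam0 x w theta.
have dn0 : 0 <= d%:R / n%:R :> R by rewrite divr_ge0.
have s20 := sqr_ge0 sigma.
have KdC : 10 * Kd <= 2 * C0 * sigma_x ^+ 2 * (2 + C1) by exact: threshold_ge.
have C0sx : 1 <= 2 * C0 * sigma_x ^+ 2 * (2 + C1) by exact: threshold_ge1.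
have lam2 : 0 <= lamd1 ^+ 2 * bias by rewrite mulr_ge0 ?sqr_ge0.
have F_head t (t0 : 0 < t) := risk_ge_head sigma n0 t0 LL lL gram_ge gram_le XXt Xth.
have F_tail t (t0 : 0 < t) := risk_ge_tail sigma n0 Kd0 t0 lam10 LL rd0 lL Kd_op trace_ge XXt Xth.
have F_bias t mu (t0 : 0 < t) : 10 * (Kd * lamd1) <= t -> lamd1 <= mu -> mu <= t ->
    mu <= lamd -> delta1 <= 1 / 5 ->
    1 / 40 * (mu ^+ 2 * bias) <= ridge_risk (design x w) theta sigma t.
  move=> h1 h2 h3 h4 h5; rewrite biasE.
  apply: (risk_ge_bias sigma n0 Kd0 t0 lam10 LL lL gram_ge gram_le Kd_op signal XXt Xth h1 h2 h3 h4 (delta := delta)).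
    exact: delta20.
  by rewrite -biasE.
have F_upper t (t0 : 0 < t) : ridge_risk (design x w) theta sigma t <=
    3 * ((Kd * lamd1 + t) ^+ 2 * bias) + 3 * (lamd1 ^+ 2 * bias)
     + sigma ^+ 2 * (3 * ((Kd * lamd1 + t) ^+ 2 / t ^+ 2) * (d%:R / n%:R)
         + 22 / 10 * Kd * (lamd1 ^+ 2 / t ^+ 2 * (rd / n%:R))).
  rewrite biasE.
  apply: (risk_le sigma n0 Kd0 t0 lam10 LL lL gram_ge gram_le Kd_op trace_le signal XXt Xth).
  rewrite -biasE; apply: (le_trans tail_le); rewrite -mulrA.
  by rewrite -[X in _ <= X]mul1r ler_wpM2r.
split=> [ht|/andP[ht1 ht2]|ht].
- exact: (lower_small A01 Kd0 lam10 lamL rd0 N0 dn0 s20 m_cont mF F_head F_tail).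
- rewrite (lower_moderate A01 Kd0 lam10 lamL rd0 N0 dn0 s20 bias0 C00 C10 delta01 KdC C0sx m_cont mF F_head F_tail F_bias) ?ht1//=.
  exact: (upper_moderate A01 Kd0 lam10 rd0 N0 dn0 s20 bias0 m_cont mF F_upper).
- exact: (lower_large A01 Kd0 lam10 lamL rd0 N0 s20 bias0 C00 C10 delta01 KdC C0sx m_cont mF F_tail F_bias).
Qed.
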